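(* Let $\Omega\subset\mathbb{A}_3$ be a domain such that all intersections of $\Omega$ with hyperplanes parallel to the radical $\mathcal{I}$ of $\mathbb{A}_3$ (that is, with the translates $\zeta_0+\mathcal{I}$, $\zeta_0\in\mathbb{A}_3$) are connected. Let $\Phi:\Omega\to\mathbb{A}_3$ be a locally bounded function such that for every $\zeta\in\Omega$ there exists an element $\Phi'(\zeta)\in\mathbb{A}_3$ with $$\lim_{\delta\to 0+}\bigl(\Phi(\zeta+\delta h)-\Phi(\zeta)\bigr)\delta^{-1}=h\,\Phi'(\zeta)$$ for all $h\in\{\pm 1,\pm i,\pm\rho,\pm i\rho,\pm\rho^2,\pm i\rho^2\}$. Then the function $\Phi$ admits the representation $$\Phi(\zeta)=\frac{1}{2\pi i}\int_{\gamma}\bigl(F_0(t)+F_1(t)\rho+F_2(t)\rho^2\bigr)(t-\zeta)^{-1}\,dt,$$ where $F_0$, $F_1$ and $F_2$ are analytic functions in the domain $D=f(\Omega)$, and $\gamma$ is a closed rectifiable Jordan curve in $D=f(\Omega)\subset\mathbb{C}$ enclosing the point $f(\zeta)$.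
   Context: $\mathbb{A}_3$ is the three-dimensional commutative associative Banach algebra with identity $1$ over $\mathbb{C}$ with basis $\{1,\rho,\rho^2\}$, where $\rho^3=0$, and with the Euclidean norm $\|a+b\rho+c\rho^2\|=\sqrt{|a|^2+|b|^2+|c|^2}$, $a,b,c\in\mathbb{C}$. Complex numbers $t$ are identified with the elements $t\cdot 1\in\mathbb{A}_3$. The radical (which is the unique maximal ideal) is $\mathcal{I}=\{\lambda_1\rho+\lambda_2\rho^2:\lambda_1,\lambda_2\in\mathbb{C}\}$, and $f:\mathbb{A}_3\to\mathbb{C}$ is the continuous multiplicative linear functional $f(a+b\rho+c\rho^2)=a$. An element $t-\zeta$ is invertible in $\mathbb{A}_3$ exactly when $t\neq f(\zeta)$, and $(t-\zeta)^{-1}$ denotes the inverse in $\mathbb{A}_3$. A domain is a nonempty open connected set; the empty set counts as connected. ''Locally bounded'' means that every point of $\Omega$ has a neighbourhood in $\Omega$ on which $\|\Phi\|$ is bounded. *)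

(* Defs.v *)
From HB Require Import structures.
From mathcomp Require Import all_boot all_order all_algebra.
From mathcomp Require Import complex.
From mathcomp Require Import all_classical all_reals all_analysis.
From mathcomp Require Import ring.

Set Implicit Arguments.
Unset Strict Implicit.
Unset Printing Implicit Defensive.

Import Order.TTheory GRing.Theory Num.Theory.
Import numFieldNormedType.Exports.

Local Open Scope classical_set_scope.
Local Open Scope ring_scope.
Local Open Scope complex_scope.

(* [R[i]] as a normed space over itself, with the topology of its modulus. *)
HB.instance Definition _ (R : realType) := NormedModule.copy R[i] R[i]^o.

(* The element [a + b rho + c rho^2], with [rho^3 = 0]. *)
Record A3 (R : realType) := MkA3 { coef0 : R[i]; coef1 : R[i]; coef2 : R[i] }.

Section algebra.
Variable R : realType.
Local Notation C := R[i].
Local Notation A := (A3 R).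
Implicit Types x y z : A.

Let to_triple x := (coef0 x, coef1 x, coef2 x).
Let of_triple (t : C * C * C) : A := MkA3 t.1.1 t.1.2 t.2.

Let to_tripleK : cancel to_triple of_triple. Proof. by case. Qed.

HB.instance Definition _ := Choice.copy A (can_type to_tripleK).

Definition addA3 x y : A :=
  MkA3 (coef0 x + coef0 y) (coef1 x + coef1 y) (coef2 x + coef2 y).
Definition oppA3 x : A := MkA3 (- coef0 x) (- coef1 x) (- coef2 x).

Let addA3A : associative addA3.
Proof. by move=> x y z; rewrite /addA3 /= !addrA. Qed.
Let addA3C : commutative addA3.
Proof. by move=> x y; congr MkA3; rewrite addrC. Qed.
Let add0A3 : left_id (MkA3 0 0 0) addA3.
Proof. by case=> a b c; rewrite /addA3 /= !add0r. Qed.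
Let addNA3 : left_inverse (MkA3 0 0 0) oppA3 addA3.
Proof. by move=> x; rewrite /addA3 /= !addNr. Qed.

HB.instance Definition _ := GRing.isZmodule.Build A addA3A addA3C add0A3 addNA3.

Definition mulA3 x y : A :=
  MkA3 (coef0 x * coef0 y)
       (coef0 x * coef1 y + coef1 x * coef0 y)
       (coef0 x * coef2 y + coef1 x * coef1 y + coef2 x * coef0 y).

Let mulA3A : associative mulA3.
Proof. by move=> x y z; congr MkA3 => /=; ring. Qed.
Let mulA3C : commutative mulA3.
Proof. by move=> x y; congr MkA3 => /=; ring. Qed.
Let mul1A3 : left_id (MkA3 1 0 0) mulA3.
Proof. by case=> a b c; congr MkA3 => /=; ring. Qed.
Let mulA3Dl : left_distributive mulA3 addA3.
Proof. by move=> x y z; congr MkA3 => /=; ring. Qed.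
Let oneA3_neq0 : MkA3 1 0 0 != 0 :> A.
Proof. by apply/eqP => -[] /eqP; rewrite oner_eq0. Qed.

HB.instance Definition _ :=
  GRing.Zmodule_isComNzRing.Build A mulA3A mulA3C mul1A3 mulA3Dl oneA3_neq0.

Definition scaleA3 (l : C) x : A :=
  MkA3 (l * coef0 x) (l * coef1 x) (l * coef2 x).

Let scaleA3A l m x : scaleA3 l (scaleA3 m x) = scaleA3 (l * m) x.
Proof. by congr MkA3; rewrite mulrA. Qed.
Let scale1A3 : left_id 1 scaleA3.
Proof. by case=> a b c; rewrite /scaleA3 /= !mul1r. Qed.
Let scaleA3Dr : right_distributive scaleA3 +%R.
Proof. by move=> l x y; congr MkA3; rewrite mulrDr. Qed.
Let scaleA3Dl x : {morph scaleA3^~ x : l m / l + m}.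
Proof. by move=> l m; congr MkA3; rewrite mulrDl. Qed.

HB.instance Definition _ :=
  GRing.Zmodule_isLmodule.Build C A scaleA3A scale1A3 scaleA3Dr scaleA3Dl.

Let scaleA3Al (l : C) x y : l *: (x * y) = l *: x * y.
Proof. by congr MkA3 => /=; ring. Qed.

HB.instance Definition _ := GRing.Lmodule_isLalgebra.Build C A scaleA3Al.
HB.instance Definition _ := GRing.Lalgebra_isComAlgebra.Build C A.

Definition unitA3 : pred A := fun x => coef0 x != 0.
Definition invA3 x : A :=
  if unitA3 x then
    MkA3 (coef0 x)^-1
         (- (coef1 x / coef0 x ^+ 2))
         (coef1 x ^+ 2 / coef0 x ^+ 3 - coef2 x / coef0 x ^+ 2)
  else x.

Let mulVA3 : {in unitA3, left_inverse 1 invA3 *%R}.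
Proof.
move=> x ux; have {}ux : coef0 x != 0 := ux; rewrite /invA3 /unitA3 ux.
by congr MkA3 => /=; field.
Qed.
Let unitA3P x y : y * x = 1 -> unitA3 x.
Proof.
by case=> + _ _; rewrite /unitA3; apply: contra_eqN => /eqP ->;
  rewrite mulr0 eq_sym oner_eq0.
Qed.
Let invA3_out : {in [predC unitA3], invA3 =1 id}.
Proof. by move=> x nux; rewrite /invA3; case: ifP nux => // ux /negP[]. Qed.

HB.instance Definition _ :=
  GRing.ComNzRing_hasMulInverse.Build A mulVA3 unitA3P invA3_out.

Definition normA3 x : C :=
  sqrtC (`|coef0 x| ^+ 2 + `|coef1 x| ^+ 2 + `|coef2 x| ^+ 2).

Let normsq_ge0 x : 0 <= `|coef0 x| ^+ 2 + `|coef1 x| ^+ 2 + `|coef2 x| ^+ 2.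
Proof. by rewrite !addr_ge0 // exprn_ge0. Qed.

Let normA3_ge0 x : 0 <= normA3 x.
Proof. by rewrite sqrtC_ge0. Qed.

Let normA3_sq x :
  normA3 x ^+ 2 = `|coef0 x| ^+ 2 + `|coef1 x| ^+ 2 + `|coef2 x| ^+ 2.
Proof. by rewrite sqrtCK. Qed.

Let normA3D x y : normA3 (x + y) <= normA3 x + normA3 y.
Proof.
rewrite -(@ler_pXn2r _ 2) ?nnegrE ?addr_ge0 // sqrrD !normA3_sq.
set a := `|coef0 x|; set b := `|coef1 x|; set c := `|coef2 x|.
set a' := `|coef0 y|; set b' := `|coef1 y|; set c' := `|coef2 y|.
have CS : a * a' + b * b' + c * c' <= normA3 x * normA3 y.
  rewrite -(@ler_pXn2r _ 2) ?nnegrE ?addr_ge0 ?mulr_ge0 ?normr_ge0 //.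
  rewrite exprMn !normA3_sq -/a -/b -/c -/a' -/b' -/c' -subr_ge0.
  have -> : (a ^+ 2 + b ^+ 2 + c ^+ 2) * (a' ^+ 2 + b' ^+ 2 + c' ^+ 2)
      - (a * a' + b * b' + c * c') ^+ 2
    = (a * b' - b * a') ^+ 2 + (a * c' - c * a') ^+ 2 + (b * c' - c * b') ^+ 2.
    by ring.
  by rewrite !addr_ge0 // real_exprn_even_ge0 // !(rpredB, rpredM) ?normr_real.
apply: (@le_trans _ _ ((a + a') ^+ 2 + (b + b') ^+ 2 + (c + c') ^+ 2)).
  by rewrite !lerD // lerXn2r ?nnegrE ?addr_ge0 ?normr_ge0 // ler_normD.
have -> : (a + a') ^+ 2 + (b + b') ^+ 2 + (c + c') ^+ 2
    = a ^+ 2 + b ^+ 2 + c ^+ 2 + (a * a' + b * b' + c * c') *+ 2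
      + (a' ^+ 2 + b' ^+ 2 + c' ^+ 2) by ring.
by rewrite lerD2r lerD2l lerMn2r.
Qed.

Let normA3Z (l : C) x : normA3 (l *: x) = `|l| * normA3 x.
Proof.
apply/(@pexpIrn _ 2); rewrite ?nnegrE ?mulr_ge0 ?normA3_ge0 ?normr_ge0 //.
by rewrite exprMn !normA3_sq /= !normrM; ring.
Qed.

Let normA3_eq0 x : normA3 x = 0 -> x = 0.
Proof.
move=> /eqP; rewrite sqrtC_eq0 !paddr_eq0 ?addr_ge0 ?exprn_ge0 ?normr_ge0 //.
rewrite !expf_eq0 /= !normr_eq0; case: x => a b c /=.
by move=> /andP[/andP[/eqP -> /eqP ->] /eqP ->].
Qed.

HB.instance Definition _ :=
  Lmodule_isNormed.Build C A normA3D normA3Z normA3_eq0.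

Definition rho : A := MkA3 0 1 0.

Definition radical : set A :=
  [set u | exists l1 l2 : C, u = l1 *: rho + l2 *: rho ^+ 2].

(* The multiplicative functional with kernel [radical]. *)
Definition fA3 : A -> C := @coef0 R.

Definition directions : seq A :=
  [:: 1; - 1; 'i%:A; - 'i%:A; rho; - rho; 'i *: rho; - ('i *: rho);
      rho ^+ 2; - rho ^+ 2; 'i *: rho ^+ 2; - ('i *: rho ^+ 2)].

End algebra.

Arguments rho R : clear implicits.
Arguments radical R : clear implicits.
Arguments directions R : clear implicits.
Arguments fA3 {R}.

Section complex_analysis.
Variable R : realType.
Local Notation C := R[i].

Definition analytic_on (D : set C) (F : C -> C) :=
  forall z, D z -> exists a : nat -> C, \forall w \near z,
    series (fun n => a n * (w - z) ^+ n) @ \oo --> F w.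

(* Curves are parametrized by [0, 1]. *)
Definition curve_image (gamma : R -> C) : set C := gamma @` `[0, 1].

Definition jordan_curve (gamma : R -> C) :=
  [/\ {within `[0, 1], continuous gamma},
      gamma 0 = gamma 1 &
      {in `[0, 1[ &, injective gamma}].

(* The points of the subdivision [0 :: s] of [0, 1]. *)
Definition knot (s : seq R) (k : nat) : R := nth 1 (0 :: s) k.

Definition rectifiable (gamma : R -> C) :=
  exists L : R, forall s, itv_partition 0 1 s ->
    \sum_(0 <= k < size s) `|gamma (knot s k.+1) - gamma (knot s k)| <= L%:C.

(* [I] is the integral of [g (t) dt] along [gamma], as the limit of
   Riemann-Stieltjes sums when the mesh of the subdivision tends to 0. *)
Definition is_curve_integral (V : normedModType C)
    (gamma : R -> C) (g : C -> V) (I : V) :=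
  forall e : R, 0 < e -> exists2 d : R, 0 < d &
    forall (s : seq R) (tau : nat -> R),
      itv_partition 0 1 s ->
      (forall k, (k < size s)%N -> knot s k.+1 - knot s k < d) ->
      (forall k, (k < size s)%N -> knot s k <= tau k <= knot s k.+1) ->
      `|\sum_(0 <= k < size s)
          (gamma (knot s k.+1) - gamma (knot s k)) *: g (gamma (tau k)) - I|
        < e%:C.

Definition two_pi_i : C := 2 * (pi : R)%:C * 'i.

(* Union of the bounded components of the complement of the curve. *)
Definition inside (gamma : R -> C) : set C :=
  [set z | (~` curve_image gamma) z /\
           bounded_set (connected_component (~` curve_image gamma) z)].

Definition positively_oriented (gamma : R -> C) :=
  forall z, inside gamma z ->
    is_curve_integral gamma (fun t => (t - z)^-1 : C) two_pi_i.

(* The curves allowed in Cauchy's integral formula in [D] at the point [z]: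
   the curve lies in [D] together with its inside, since [D] need not be simply
   connected, and the factor [1 / (2 pi i)] presupposes the positive
   orientation. *)
Definition cauchy_curve (D : set C) (z : C) (gamma : R -> C) :=
  [/\ jordan_curve gamma, rectifiable gamma, positively_oriented gamma,
      curve_image gamma `|` inside gamma `<=` D & inside gamma z].

End complex_analysis.

Arguments two_pi_i R : clear implicits.

(* Main.v *)
Require Import Defs.
From HB Require Import structures.
From mathcomp Require Import all_boot all_order all_algebra.
From mathcomp Require Import complex.
From mathcomp Require Import all_classical all_reals all_analysis.
From mathcomp Require Import measurable_realfun.
From mathcomp Require Import ring lra.
(* For [coef0], which is also the name of a lemma on polynomials. *)
Import Defs.

Set Implicit Arguments.
Unset Strict Implicit.
Unset Printing Implicit Defensive.

Import Order.TTheory GRing.Theory Num.Theory.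
Import numFieldNormedType.Exports.

Local Open Scope classical_set_scope.
Local Open Scope ring_scope.

(** Write [zeta = a + b rho + c rho^2] and
[Phi = Phi0 + Phi1 rho + Phi2 rho^2]. If
[Phi' = p0 + p1 rho + p2 rho^2] at a point, comparing coefficients in
[h * Phi'] for [h] proportional to [1], [rho], [rho^2] shows that
[(Phi0, Phi1, Phi2)] has the derivatives [(p0, p1, p2)] in [a],
[(0, p0, p1)] in [b] and [(0, 0, p0)] in [c]; each of them is a complex
derivative only along the real and the imaginary axis of the variable.

Hence [Phi0] is constant on the slices [a = const], which are connected, and
descends to a function [F0] on [D = f(Omega)] whose derivative is [p0]. Then
[Phi1 - b F0'] has vanishing derivatives in [b] and [c], and descends to [F1]
with [F1' = p1 - b F0'']; finally
[Phi2 - (b^2/2 F0'' + b F1' + c F0')] descends to [F2] ([descend],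
[slice_const]). Since
[[
(t - zeta)^-1 = 1/(t - a) + b/(t - a)^2 rho
                + (b^2/(t - a)^3 + c/(t - a)^2) rho^2,
]]
the representation of [Phi] is Cauchy's formula for [F0], [F1], [F2] and
for their first two derivatives ([cauchy_formula], [cauchy_formula2],
[cauchy_formula3]).

Two theorems of complex analysis carry this argument.

The functions [F0], [F1], [F2] are only known to be locally bounded and to
have complex derivatives along the axes. That they are analytic is Tolstov's
form of the Looman-Menchoff theorem ([tolstov]). Let [oint u v] be the integral of
[u dx - v dy], the real part of [f dz] for [f = u + i v], around a rectangle, and
let the bad set be the closed set of points near which it does not vanish
identically. By Baire's theorem, a nonempty bad set has a portion on which the
difference quotients of [f] are uniformly bounded. In a small rectangle
that meets this portion, up to a set of small measure the Cauchy-Riemann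
equations hold at a uniform scale with precision [e], and on the
exceptional set the uniform bound is used ([cell_estimate]). Adding these
estimates over a fine subdivision shows that [oint u v] vanishes near the portion,
a contradiction ([looman_menchoff]). So a bounded [f] with axis derivatives has
local primitives; a primitive [H] of a primitive of [f] is continuously
differentiable, which suffices for Cauchy's formula on a circle and hence for a
Taylor expansion of [H] ([cauchy_formula_circle], [taylor_circle]). Differentiating
this expansion twice ([taylor_deriv]) gives the expansion of [f].

Cauchy's formula for a rectifiable Jordan curve that lies in [D] together
with its inside is proved by Dixon's method ([cauchy_formula]): the function
that is the integral of [(F(t) - F(z)) / (t - z)] over the curve for [z] in
[D] and of [F(t) / (t - z)] for [z] outside [D] is entire and tends to [0] at
infinity, so it vanishes. The curve enters only through its winding number, which is
[0] on the unbounded component by connectedness and [1] inside by positive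
orientation. Small circles provide such curves around every point of [D]
([circ_cauchy_curve]). *)

(** * Integrals of continuous functions of one real variable *)

Section real_integral.
Variable R : realType.
Local Notation mu := (@lebesgue_measure R).
Implicit Types (g h : R -> R) (a b c M : R).

(** Half-open intervals make the integral additive in the interval without
any condition on the endpoints. *)
Definition intoc g a b : R := \int[mu]_(x in `]a, b]) g x.

Lemma cont_integrable g a b : continuous g ->
  mu.-integrable `[a, b] (EFin \o g).
Proof.
move=> cg; apply: continuous_compact_integrable; first exact: segment_compact.
exact: continuous_subspaceT.
Qed.

Lemma cont_integrable_oc g a b : continuous g ->
  mu.-integrable `]a, b] (EFin \o g).
Proof.
move=> cg; apply: integrableS (cont_integrable a b cg) => //.
exact: subset_itv_oc_cc.
Qed.

Lemma intoc_split g a b c : continuous g -> a <= b -> b <= c ->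
  intoc g a c = intoc g a b + intoc g b c.
Proof.
move=> cg ab bc; rewrite /intoc -(@Rintegral_itvB _ g (BRight a) (BRight c) b) //.
  by rewrite addrC subrK.
exact: cont_integrable_oc.
Qed.

Lemma intoc_xx g a : intoc g a a = 0.
Proof. by rewrite /intoc set_itv_ge ?Rintegral_set0 // bnd_simp ltxx. Qed.

Lemma intocB g h a b : continuous g -> continuous h ->
  intoc (fun x => g x - h x) a b = intoc g a b - intoc h a b.
Proof. by move=> cg ch; rewrite /intoc RintegralB //; exact: cont_integrable_oc. Qed.

Lemma intoc_cst M a b : a <= b -> intoc (fun=> M) a b = M * (b - a).
Proof.
move=> ab; rewrite /intoc Rintegral_cst //; congr (_ * _).
rewrite /= [X in fine X](_ : _ = mu `]a, b]) // lebesgue_measure_itv /= lte_fin.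
have [//|ba] := ltP a b; have -> : a = b by apply/eqP; rewrite eq_le ab.
by rewrite subrr.
Qed.

Lemma intoc_le g M a b : continuous g -> a <= b ->
  (forall x, a <= x <= b -> `|g x| <= M) -> `|intoc g a b| <= M * (b - a).
Proof.
move=> cg ab gM; rewrite -(intoc_cst M ab).
apply: le_trans (le_normr_Rintegral _ _) _ => //; first exact: cont_integrable_oc.
apply: le_Rintegral => //.
- apply: (@cont_integrable_oc (fun x => `|g x|)) => x.
  by apply: cvg_norm; exact: cg.
- by apply: (@cont_integrable_oc (fun x => M)) => x; exact: cvg_cst.
- by move=> x /=; rewrite in_itv /= => /andP[ax xb]; apply: gM; rewrite (ltW ax).
Qed.

Lemma intoc_derive g a x : continuous g -> a < x ->
  is_derive x (1 : R) (intoc g a) (g x).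
Proof.
move=> cg ax.
have xu : x < x + 1 by rewrite ltrDl.
have ax' : (BRight a < BRight x)%O by rewrite bnd_simp.
have [d1 d2] := @continuous_FTC1 R g (BRight a) x _ xu
  (cont_integrable_oc _ _ cg) ax' (cg x).
split; [exact: d1|by rewrite -derive1E d2].
Qed.

(** By dominated convergence; continuity in each variable and a common bound
are enough. *)
Lemma intoc_param (f : R -> R -> R) M a b x : (forall y, continuous (f ^~ y)) ->
  (forall x, continuous (f x)) -> (forall x y, `|f x y| <= M) ->
  {for x, continuous (fun x => intoc (f x) a b)}.
Proof.
move=> c1 c2 fM.
apply: (@continuity_under_integral R _ _ mu f `]a, b] _ (x - 1) (x + 1)
   _ _ (fun=> M)) => //.
- by move=> x' _; exact: cont_integrable_oc.
- by apply: aeW => y _ z _; exact: c1.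
- by apply: (@cont_integrable_oc (fun x => M)) => z; exact: cvg_cst.
- by move=> x' _; apply: aeW.
- by rewrite inE /= in_itv /= ltrBlDr !ltrDl !ltr01.
Qed.

End real_integral.

(** * Integration around rectangles *)

Section rectangles.
Variable R : realType.
Implicit Types (u v : R -> R -> R) (a b c d e x y M : R).

(** The regularity that the existence of derivatives along the axes gives for
a bounded function: continuity in each variable, not joint continuity. *)
Definition sep_cont u := [/\ forall y, continuous (u ^~ y), forall x, continuous (u x)
  & exists M, forall x y, `|u x y| <= M].

(** The reflection in the diagonal. The pair [(flip v, flip u)] satisfies the
Cauchy-Riemann equations if [(u, v)] does, so that results on horizontal sides
apply to vertical sides. *)
Definition flip u : R -> R -> R := fun x y => u y x.

Lemma sep_cont_flip u : sep_cont u -> sep_cont (flip u).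
Proof. by move=> [u1 u2 [M uM]]; split => //; exists M => x y; exact: uM. Qed.

(** The integral of [u dx - v dy], the real part of [f dz] for [f = u + i v],
around the rectangle with corners [(a, c)] and [(b, d)]. The imaginary part
is the same expression for [-i f]. *)
Definition oint u v a b c d : R :=
  intoc (u ^~ c) a b - intoc (u ^~ d) a b - (intoc (v b) c d - intoc (v a) c d).

Lemma oint_flip u v a b c d : oint u v a b c d = oint (flip v) (flip u) c d a b.
Proof. rewrite /oint /flip; ring. Qed.

Lemma oint_splitx u v a m b c d : sep_cont u -> sep_cont v -> a <= m -> m <= b ->
  oint u v a b c d = oint u v a m c d + oint u v m b c d.
Proof.
move=> [u1 u2 _] [v1 v2 _] am mb.
rewrite /oint (intoc_split (u1 c) am mb) (intoc_split (u1 d) am mb); ring.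
Qed.

Lemma oint_splity u v a b c m d : sep_cont u -> sep_cont v -> c <= m -> m <= d ->
  oint u v a b c d = oint u v a b c m + oint u v a b m d.
Proof.
move=> su sv cm md; rewrite (oint_flip u v a b c d) (oint_flip u v a b c m) (oint_flip u v a b m d).
exact: (oint_splitx _ _ (sep_cont_flip sv) (sep_cont_flip su)).
Qed.

Lemma oint_xx u v a c d : oint u v a a c d = 0.
Proof. by rewrite /oint !intoc_xx !subrr. Qed.

Lemma oint_yy u v a b c : oint u v a b c c = 0.
Proof. by rewrite oint_flip oint_xx. Qed.

(** The horizontal sides are short and [u] is bounded; the integrals of [v] over
the two vertical sides differ little by dominated convergence. *)
Lemma oint_small u v c d b e : sep_cont u -> sep_cont v -> 0 < e ->
  exists2 r, 0 < r & forall x x', `|x - b| < r -> `|x' - b| < r -> x <= x' ->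
    `|oint u v x x' c d| < e.
Proof.
move=> [u1 u2 [M uM]] [v1 v2 [N vN]] e0.
have M0 : 0 <= M by apply: le_trans (uM 0 0); exact: normr_ge0.
have /(@cvgrPdist_lt _ R^o) /(_ (e / 8)) := @intoc_param R v N c d b v1 v2 vN.
have e8 : 0 < e / 8 by rewrite divr_gt0.
move=> /(_ e8) /nbhs_ballP[r /= r0 rb].
(* The radius [r] serves for the vertical sides, the other bound for the short horizontal ones. *)
pose r' := Num.min r (e / (8 * (M + 1))).
have r'0 : 0 < r' by rewrite lt_min r0 divr_gt0 // mulr_gt0 // ltr_wpDl.
exists r' => // x x' xb x'b xx'.
have [rr rM] : `|x - b| < r /\ `|x' - b| < r.
  by move: xb x'b; rewrite !lt_min => /andP[-> _] /andP[-> _].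
have H1 : `|intoc (v b) c d - intoc (v x) c d| < e / 8.
  by apply: rb; rewrite /ball /= distrC.
have H2 : `|intoc (v b) c d - intoc (v x') c d| < e / 8.
  by apply: rb; rewrite /ball /= distrC.
have xx'M : M * (x' - x) <= e / 4.
  have : x' - x <= 2 * (e / (8 * (M + 1))).
    move: xb x'b; rewrite !lt_min => /andP[_ xb] /andP[_ x'b].
    by move: xb x'b; rewrite !ltr_norml => /andP[? ?] /andP[? ?]; lra.
  move=> /(ler_wpM2l M0) /le_trans; apply.
  have -> : M * (2 * (e / (8 * (M + 1)))) = e / 4 * (M / (M + 1)).
    by field; lra.
  by rewrite ler_piMr ?divr_ge0 ?(ltW e0) // ler_pdivrMr; lra.
have H3 : `|intoc (u^~ c) x x'| <= M * (x' - x) by apply: intoc_le.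
have H4 : `|intoc (u^~ d) x x'| <= M * (x' - x) by apply: intoc_le.
rewrite /oint; move: H1 H2 H3 H4; rewrite !ltr_norml !ler_norml.
by move=> /andP[? ?] /andP[? ?] /andP[? ?] /andP[? ?]; apply/andP; split; lra.
Qed.

(** By [oint_small] the integral depends continuously on the position of a side. *)
Lemma oint_lim_right u v a b c d : sep_cont u -> sep_cont v -> a <= b ->
  (forall x, a <= x < b -> oint u v a x c d = 0) -> oint u v a b c d = 0.
Proof.
move=> su sv; rewrite le_eqVlt => /predU1P[->|ab] H; first exact: oint_xx.
apply/eqP; rewrite -normr_le0 leNgt; apply/negP => e0.
have [r r0 rH] := oint_small c d b su sv e0.
pose x := Num.max a (b - r / 2).
have ax : a <= x by rewrite le_max lexx.
have xb : x < b by rewrite gt_max ab; lra.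
have bx : b - r / 2 <= x by rewrite le_max lexx orbT.
have E : oint u v a b c d = oint u v x b c d.
  by rewrite (oint_splitx c d su sv ax (ltW xb)) H ?ax // add0r.
suff : `|oint u v x b c d| < `|oint u v a b c d| by rewrite E ltxx.
by apply: rH; rewrite ?(ltW xb) // ?subrr ?normr0 // ltr_norml; apply/andP; split; lra.
Qed.

Lemma oint_lim_left u v a b c d : sep_cont u -> sep_cont v -> a <= b ->
  (forall x, a < x <= b -> oint u v x b c d = 0) -> oint u v a b c d = 0.
Proof.
move=> su sv; rewrite le_eqVlt => /predU1P[->|ab] H; first exact: oint_xx.
apply/eqP; rewrite -normr_le0 leNgt; apply/negP => e0.
have [r r0 rH] := oint_small c d a su sv e0.
pose x := Num.min b (a + r / 2).
have ax : x <= b by rewrite ge_min lexx.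
have xb : a < x by rewrite lt_min ab; lra.
have bx : x <= a + r / 2 by rewrite ge_min lexx orbT.
have E : oint u v a b c d = oint u v a x c d.
  by rewrite (oint_splitx c d su sv (ltW xb) ax) H ?ax ?xb // addr0.
suff : `|oint u v a x c d| < `|oint u v a b c d| by rewrite E ltxx.
by apply: rH; rewrite ?(ltW xb) // ?subrr ?normr0 // ltr_norml; apply/andP; split; lra.
Qed.

(** Repeated bisection in both directions: a property of rectangles that is
additive in each direction holds for a rectangle if it holds for all its small
similar copies. That the copies are similar keeps the quotient of their sides
fixed, on which the constant in [cell_estimate] depends. *)
Lemma halving (P : R -> R -> R -> R -> Prop) a b c d e :
  (forall a m b c d, a <= m -> m <= b -> c <= d ->
     P a m c d -> P m b c d -> P a b c d) ->
  (forall a b c m d, a <= b -> c <= m -> m <= d ->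
     P a b c m -> P a b m d -> P a b c d) ->
  0 < e -> a <= b -> c <= d ->
  (forall n a' b' c' d', a <= a' -> b' <= b -> c <= c' -> d' <= d ->
     b' - a' = (b - a) / 2 ^+ n -> d' - c' = (d - c) / 2 ^+ n ->
     b' - a' < e -> d' - c' < e -> P a' b' c' d') ->
  P a b c d.
Proof.
move=> Px Py e0 ab cd small.
(* [N] bisections produce copies with sides less than [e]. *)
have [N NP] : exists N, (b - a) / 2 ^+ N < e /\ (d - c) / 2 ^+ N < e.
  pose w := (b - a) + (d - c).
  have [N Nw] : exists N, w < e * 2 ^+ N.
    exists (Num.trunc (w / e)).+1; rewrite mulrC -ltr_pdivrMr //.
    apply: lt_le_trans (truncnS_gt _) _; rewrite -natrX ler_nat.
    exact/ltnW/ltn_expl.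
  exists N; rewrite !ltr_pdivrMr ?exprn_gt0 //; split; apply: le_lt_trans Nw;
  rewrite /w; lra.
have main k n : (n + k = N)%N -> forall a' b' c' d', a <= a' -> b' <= b ->
    c <= c' -> d' <= d ->
    b' - a' = (b - a) / 2 ^+ n -> d' - c' = (d - c) / 2 ^+ n -> P a' b' c' d'.
  elim: k n => [|k IH] n nN a' b' c' d' aa bb cc dd wb wd.
    move: nN; rewrite addn0 => nN; case: NP; rewrite -nN -wb -wd => h1 h2.
    exact: (small n).
  have hS (w : R) : w / 2 ^+ n.+1 = w / 2 ^+ n / 2 by rewrite exprSr invfM mulrA.
  have IHn := IH n.+1; rewrite addSnnS in IHn; move/(_ nN) in IHn.
  rewrite !hS -wb -wd in IHn.
  have : 0 <= b' - a' by rewrite wb divr_ge0 ?subr_ge0 // exprn_ge0.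
  have : 0 <= d' - c' by rewrite wd divr_ge0 ?subr_ge0 // exprn_ge0.
  move=> cd' ab'.
  by apply: (Px _ ((a' + b') / 2)); [lra|lra|lra| |];
    apply: (Py _ _ _ ((c' + d') / 2)); (try lra); apply: IHn; lra.
by apply: (main N 0%N) => //; rewrite expr0 divr1.
Qed.

Definition loc_oint0 u v x y := exists2 r : R, 0 < r & forall a b c d,
  x - r < a -> a <= b -> b < x + r -> y - r < c -> c <= d -> d < y + r ->
  oint u v a b c d = 0.

(** By compactness there is a common size below which all rectangles have
integral [0]; larger ones are reduced to these by bisection. *)
Lemma oint0_compact u v a b c d : sep_cont u -> sep_cont v -> a <= b -> c <= d ->
  (forall x y, a <= x <= b -> c <= y <= d -> loc_oint0 u v x y) ->
  oint u v a b c d = 0.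
Proof.
move=> su sv ab cd H.
pose P (r : R) (z : R * R) := forall a' b' c' d', a' <= z.1 <= b' ->
  c' <= z.2 <= d' -> b' - a' < r -> d' - c' < r -> oint u v a' b' c' d' = 0.
have cK : compact (`[a, b] `*` `[c, d])%classic.
  by apply: compact_setX; exact: segment_compact.
have /compact_near_coveringP /(_ R (0^'+) P _) := cK.
case.
  move=> [x y] [/=]; rewrite !in_itv /= => xab ycd.
  have [r r0 rJ] := H x y xab ycd.
  have r2 : 0 < r / 2 by rewrite divr_gt0.
  exists (ball (x, y) (r / 2), [set t | 0 < t < r / 2]); first split.
  - exact: nbhsx_ballx.
  - by near=> t => /=; apply/andP; split; near: t; [exact: nbhs_right_gt|exact: nbhs_right_lt].
  - move=> [[x' y'] t] [[]] /=; rewrite /ball /= !ltr_norml.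
    move=> /andP[? ?] /andP[? ?] /andP[t0 tr] a' b' c' d' /= /andP[? ?] /andP[? ?] ? ?.
    by apply: rJ; lra.
move=> r0 /= r00 rP.
apply: (@halving (fun a b c d => oint u v a b c d = 0) _ _ _ _ (r0 / 2)) => //.
- by move=> ? m ? ? ? ? ? ? J1 J2; rewrite (@oint_splitx _ _ _ m) // J1 J2 addr0.
- by move=> ? ? ? m ? ? ? ? J1 J2; rewrite (@oint_splity _ _ _ _ _ m) // J1 J2 addr0.
- by rewrite divr_gt0.
move=> n a' b' c' d' aa bb cc dd wb wd sb sd.
have : 0 <= b' - a' by rewrite wb divr_ge0 ?subr_ge0 // exprn_ge0.
have : 0 <= d' - c' by rewrite wd divr_ge0 ?subr_ge0 // exprn_ge0.
move=> cd' ab'.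
apply: (rP (r0 / 2) _ _ (a', c')) => //=.
- by rewrite /ball /= sub0r normrN gtr0_norm; lra.
- by rewrite divr_gt0.
- by rewrite !in_itv /=; split; apply/andP; split; lra.
- by apply/andP; split; lra.
- by apply/andP; split; lra.
Unshelve. all: by end_near. Qed.

End rectangles.

(** * Approximate Cauchy-Riemann equations *)

Section cross_estimates.
Variable R : realType.
Implicit Types (u v : R -> R -> R) (a b c d e x y M p q r : R).

(** The slope [p + i q] satisfies the defining inequality of a complex derivative of
[u + i v], with error [e], on the cross of radius [r] formed by the two axis directions. *)
Definition cross u v p q e r x y := forall h, `|h| < r ->
  [/\ `|u (x + h) y - u x y - p * h| <= e * `|h|,
      `|v (x + h) y - v x y - q * h| <= e * `|h|,
      `|u x (y + h) - u x y + q * h| <= e * `|h| &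
      `|v x (y + h) - v x y - p * h| <= e * `|h| ].

Definition CRat u v x y := exists p q, forall e, 0 < e ->
  exists2 r, 0 < r & cross u v p q e r x y.

Lemma cross_flip u v p q e r x y :
  cross u v p q e r x y -> cross (flip v) (flip u) p (- q) e r y x.
Proof.
move=> H h hr; have [h1 h2 h3 h4] := H h hr; rewrite /flip; split => //.
- by rewrite mulNr opprK.
- by rewrite mulNr.
Qed.

Lemma cross_sub u v p q e r e' r' x y : e <= e' -> r' <= r ->
  cross u v p q e r x y -> cross u v p q e' r' x y.
Proof.
move=> ee rr H h hr; have [h1 h2 h3 h4] := H h (lt_le_trans hr rr).
have eh : e * `|h| <= e' * `|h| by rewrite ler_wpM2r.
by split; apply: le_trans eh.
Qed.

(** A limit of centres that satisfy the estimate satisfies it too, although [f]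
is continuous only in the second variable: the centre [x'] may be moved to [x] at
the cost of two applications of the estimate itself, and only [y'] is then moved
by continuity. *)
Lemma cross_lim1 (f : R -> R -> R) p e r x y :
  (forall x, continuous (f x)) -> 0 <= e ->
  (forall t, 0 < t -> exists x' y', [/\ `|x' - x| < t, `|y' - y| < t &
     forall h, `|h| < r -> `|f (x' + h) y' - f x' y' - p * h| <= e * `|h|]) ->
  forall h, `|h| < r -> `|f (x + h) y - f x y - p * h| <= e * `|h|.
Proof.
move=> cf e0 H h hr; apply/ler_addgt0Pr => t t0.
have t4 : 0 < t / 4 by rewrite divr_gt0.
have /(@cvgrPdist_lt _ R^o) /(_ _ t4) /nbhs_ballP[r1 /= r10 b1] := cf (x + h) y.
have /(@cvgrPdist_lt _ R^o) /(_ _ t4) /nbhs_ballP[r2 /= r20 b2] := cf x y.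
(* The third bound keeps [x + h - x'] within the radius [r] of the cross at [x']. *)
pose s := Num.min (Num.min r1 r2) (Num.min (r - `|h|) (t / (4 * (e + 1)))).
have s0 : 0 < s.
  by rewrite !lt_min r10 r20 subr_gt0 hr /= divr_gt0 // mulr_gt0 // ltr_wpDl.
have [sr1 sr2 srh st] : [/\ s <= r1, s <= r2, s <= r - `|h| & s <= t / (4 * (e + 1))].
  by split; rewrite !ge_min lexx ?orbT.
have [x' [y' [xx yy C]]] := H s s0.
have h0 := normr_ge0 h.
have := C (x + h - x'); have := C (x - x').
rewrite ![x' + _]addrC !subrK.
have k1 : `|x - x'| < s by rewrite distrC.
have k2 : `|x + h - x'| <= `|h| + s.
  have -> : x + h - x' = h + (x - x') by ring.
  by apply: le_trans (ler_normD _ _) _; rewrite lerD2l ltW.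
move=> C1 C2.
have {}C1 : `|f x y' - f x' y' - p * (x - x')| <= e * s.
  apply: le_trans (C1 _) _; first by lra.
  by rewrite ler_wpM2l // ltW.
have {}C2 : `|f (x + h) y' - f x' y' - p * (x + h - x')| <= e * `|h| + e * s.
  have hlt : `|x + h - x'| < r.
    have -> : x + h - x' = h + (x - x') by ring.
    by apply: le_lt_trans (ler_normD _ _) _; lra.
  by apply: le_trans (C2 hlt) _; rewrite -mulrDr ler_wpM2l.
have B1 : `|f (x + h) y - f (x + h) y'| < t / 4.
  by apply: b1; rewrite /ball /= distrC (lt_le_trans yy).
have B2 : `|f x y - f x y'| < t / 4.
  by apply: b2; rewrite /ball /= distrC (lt_le_trans yy).
have es : e * s <= t / 4.
  apply: le_trans (ler_wpM2l e0 st) _.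
  have -> : e * (t / (4 * (e + 1))) = t / 4 * (e / (e + 1)) by field; lra.
  by rewrite ler_piMr ?(ltW t4) // ler_pdivrMr; lra.
have -> : f (x + h) y - f x y - p * h =
  (f (x + h) y - f (x + h) y') - (f x y - f x y')
  + (f (x + h) y' - f x' y' - p * (x + h - x'))
  - (f x y' - f x' y' - p * (x - x')) by ring.
apply: le_trans (ler_normB _ _) _.
have := ler_normD (f (x + h) y - f (x + h) y' - (f x y - f x y'))
  (f (x + h) y' - f x' y' - p * (x + h - x')).
have := ler_normB (f (x + h) y - f (x + h) y') (f x y - f x y').
by clear -C1 C2 B1 B2 es; lra.
Qed.

Lemma cross_closed u v p q e r : sep_cont u -> sep_cont v -> 0 <= e ->
  closed [set z : R * R | cross u v p q e r z.1 z.2].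
Proof.
move=> [u1 u2 _] [v1 v2 _] e0 [x y] /= H.
have {}H t : 0 < t -> exists x' y', [/\ `|x' - x| < t, `|y' - y| < t &
    cross u v p q e r x' y'].
  move=> t0; have [[x' y'] [/= C [/= b1 b2]]] := H _ (nbhsx_ballx (x, y) _ t0).
  by exists x', y'; split => //; rewrite distrC.
have lim := @cross_lim1.
move=> h hr; split.
- apply: (lim u p e r x y u2 e0) => // t /H[x' [y' [xx yy C]]]; exists x', y'.
  by split => // k /C[].
- apply: (lim v q e r x y v2 e0) => // t /H[x' [y' [xx yy C]]]; exists x', y'.
  by split => // k /C[].
- rewrite -[q]opprK mulNr.
  apply: (lim (flip u) (- q) e r y x u1 e0) => // t /H[x' [y' [xx yy C]]]; exists y', x'.
  by split => // k /C[_ _]; rewrite /flip mulNr opprK.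
- apply: (lim (flip v) p e r y x v1 e0) => // t /H[x' [y' [xx yy C]]]; exists y', x'.
  by split => // k /C[].
Qed.

(** Both slopes approximate the same difference quotient. *)
Lemma cross_same u v p q e p' q' e' r x y : 0 < r ->
  cross u v p q e r x y -> cross u v p' q' e' r x y ->
  `|p - p'| <= e + e' /\ `|q - q'| <= e + e'.
Proof.
move=> r0 C C'; have h0 : 0 < r / 2 by rewrite divr_gt0.
have hr : `|r / 2| < r by rewrite gtr0_norm //; lra.
have [h1 h2 _ _] := C _ hr; have [h1' h2' _ _] := C' _ hr.
split; rewrite -(ler_pM2r h0) -{1}(gtr0_norm h0) -normrM.
  have -> : (p - p') * (r / 2) = (u (x + r / 2) y - u x y - p' * (r / 2)) -
    (u (x + r / 2) y - u x y - p * (r / 2)) by ring.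
  apply: le_trans (ler_normB _ _) _.
  by move: h1 h1'; rewrite (gtr0_norm h0); lra.
have -> : (q - q') * (r / 2) = (v (x + r / 2) y - v x y - q' * (r / 2)) -
    (v (x + r / 2) y - v x y - q * (r / 2)) by ring.
apply: le_trans (ler_normB _ _) _.
by move: h2 h2'; rewrite (gtr0_norm h0); lra.
Qed.

Lemma norm_sum4 (t1 t2 t3 t4 e1 e2 : R) :
  `|t1| <= e1 -> `|t2| <= e2 -> `|t3| <= e2 -> `|t4| <= e1 ->
  `|t1 - t2 - t3 + t4| <= 2 * (e1 + e2).
Proof.
rewrite !ler_norml => /andP[? ?] /andP[? ?] /andP[? ?] /andP[? ?].
by apply/andP; split; lra.
Qed.

(** Compatibility of slopes at nearby points. The crosses at [(x, y)] and
[(x', y')] meet in the two remaining corners [(x', y)] and [(x, y')] of a rectangle.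
Going from [(x, y)] to [(x', y')] and back through these corners, the values of [f]
cancel, and the Cauchy-Riemann form of the slopes leaves
[P a + Q b] and [P b - Q a], with [P + i Q] the difference of the slopes and
[a + i b] the displacement. The sum of the squares of these two numbers is
[(P^2 + Q^2) (a^2 + b^2)]. *)
Lemma cross_cmp u v p q p' q' e r x y x' y' : 0 < r -> 0 <= e ->
  cross u v p q e r x y -> cross u v p' q' e r x' y' ->
  `|x' - x| < r -> `|y' - y| < r -> `|p' - p| <= 4 * e /\ `|q' - q| <= 4 * e.
Proof.
move=> r0 e0 C C' xr yr.
pose a := x' - x; pose b := y' - y; pose P := p' - p; pose Q := q' - q.
have Ea : x + a = x' by rewrite /a addrC subrK.
have Eb : y + b = y' by rewrite /b addrC subrK.
have Ea' : x' + - a = x by rewrite /a opprB addrC subrK.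
have Eb' : y' + - b = y by rewrite /b opprB addrC subrK.
have [u1 v1 _ _] := C a xr; have [_ _ u2 v2] := C b yr.
have xr' : `|- a| < r by rewrite normrN.
have yr' : `|- b| < r by rewrite normrN.
have [u3 v3 _ _] := C' (- a) xr'; have [_ _ u4 v4] := C' (- b) yr'.
rewrite Ea Ea' Eb Eb' !normrN in u1 v1 u2 v2 u3 v3 u4 v4.
have k1 : `|P * a + Q * b| <= 2 * (e * `|a| + e * `|b|).
  have -> : P * a + Q * b = (u x' y - u x y - p * a)
    - (u x' y - u x' y' + q' * (- b)) - (u x y' - u x y + q * b)
    + (u x y' - u x' y' - p' * (- a)) by rewrite /P /Q; ring.
  exact: norm_sum4.
have k2 : `|P * b - Q * a| <= 2 * (e * `|b| + e * `|a|).
  have -> : P * b - Q * a = (v x y' - v x y - p * b)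
    - (v x y' - v x' y' - q' * (- a)) - (v x' y - v x y - q * a)
    + (v x' y - v x' y' - p' * (- b)) by rewrite /P /Q; ring.
  exact: norm_sum4.
have [ab0|ab0] := eqVneq (a ^+ 2 + b ^+ 2) 0.
  have [a0 b0] : a = 0 /\ b = 0.
    by move: ab0 => /eqP; rewrite paddr_eq0 ?sqr_ge0 // !sqrf_eq0 => /andP[/eqP -> /eqP ->].
  have xx : x' = x by rewrite -Ea a0 addr0.
  have yy : y' = y by rewrite -Eb b0 addr0.
  rewrite xx yy in C'; have [P1 Q1] := cross_same r0 C' C.
  by split; lra.
have ab1 : 0 < a ^+ 2 + b ^+ 2 by rewrite lt_def ab0 addr_ge0 ?sqr_ge0.
(* By the Lagrange identity, from [k1] and [k2]. *)
have main : (P ^+ 2 + Q ^+ 2) * (a ^+ 2 + b ^+ 2) <= (4 * e) ^+ 2 * (a ^+ 2 + b ^+ 2).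
  have -> : (P ^+ 2 + Q ^+ 2) * (a ^+ 2 + b ^+ 2) =
    (P * a + Q * b) ^+ 2 + (P * b - Q * a) ^+ 2 by ring.
  have sq (s t : R) : `|s| <= t -> s ^+ 2 <= t ^+ 2.
    by move=> st; rewrite -real_normK ?num_real // lerXn2r ?nnegrE // (le_trans _ st).
  have := sq _ _ k1; have := sq _ _ k2.
  rewrite -(real_normK (num_real a)) -(real_normK (num_real b)).
  have := sqr_ge0 (e * (`|a| - `|b|)).
  by move: `|a| `|b| => s t; lra.
move: main; rewrite ler_pM2r // => main.
have e4 : 0 <= 4 * e by rewrite mulr_ge0.
have root (s : R) : s ^+ 2 <= (4 * e) ^+ 2 -> `|s| <= 4 * e.
  by rewrite -[s ^+ 2]real_normK ?num_real // ler_pXn2r ?nnegrE.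
split; apply: root; apply: le_trans main.
  by rewrite lerDl sqr_ge0.
by rewrite lerDr sqr_ge0.
Qed.

End cross_estimates.

Section relative_baire.
Variable R : realType.

(** Baire's theorem relative to a closed set [S]: if closed sets [A n] cover [S]
inside an open set [O] that meets [S], then one of them contains a
nonempty portion of [S]. Otherwise there are nested closed balls, centred on [S]
and inside [O], the [n]-th one avoiding [A n]; they have a common point. *)
Lemma baire_closed (S O : set (R * R)) (A : nat -> set (R * R)) z :
  closed S -> open O -> (forall n, closed (A n)) -> S z -> O z ->
  S `&` O `<=` \bigcup_n A n ->
  exists n w r, [/\ 0 < r, S w, ball w r `<=` O & S `&` ball w r `<=` A n].
Proof.
move=> cS oO cA Sz Oz SA; apply: contrapT => no.
(* A step of the construction is a centre with a radius. *)
pose inv (t : R * R * R) := [/\ S t.1, 0 < t.2 & ball t.1 t.2 `<=` O].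
pose cb (t : R * R * R) : set (R * R) :=
  [set w | `|w.1 - t.1.1| <= t.2 /\ `|w.2 - t.1.2| <= t.2].
have step (nt : nat * (R * R * R)) : exists t' : R * R * R, inv nt.2 ->
    [/\ inv t', t'.2 <= nt.2.2 / 2 & cb t' `<=` ball nt.2.1 nt.2.2 `\` A nt.1].
  case: nt => n [w r] /=.
  have [|ninv] := pselect (inv (w, r)); last by exists (w, r).
  move=> [/= Sw r0 rO].
  have [w' [Sw' rw' Aw']] : exists w', [/\ S w', ball w r w' & ~ A n w'].
    apply: contrapT => no'; apply: no; exists n, w, r; split => //.
    by move=> w' [Sw' bw']; apply: contrapT => nA; apply: no'; exists w'.
  have : \forall w'' \near w', (ball w r `\` A n) w''.
    apply: filterI; last by apply: open_nbhs_nbhs; split => //; exact/closed_openC/cA.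
    move: rw' => [/=]; rewrite /ball /= => b1 b2.
    apply/nbhs_ballP; exists (Num.min (r - `|w.1 - w'.1|) (r - `|w.2 - w'.2|)) => /=.
      by rewrite lt_min !subr_gt0 b1.
    move=> w'' [/=]; rewrite /ball /= !lt_min => /andP[h1 _] /andP[_ h2].
    split; rewrite /ball /=.
      by apply: le_lt_trans (ler_distD w'.1 _ _) _; rewrite addrC -ltrBrDr.
    by apply: le_lt_trans (ler_distD w'.2 _ _) _; rewrite addrC -ltrBrDr.
  move=> /nbhs_ballP[s /= s0 sb].
  exists (w', Num.min (s / 2) (r / 2)) => _; split.
  - split => //=; first by rewrite lt_min !divr_gt0.
    move=> w'' b''; apply: rO; apply: (sb w'' _).1.
    by apply: le_ball b''; rewrite ge_min; apply/orP; left; lra.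
  - by rewrite /= ge_min lexx orbT.
  - move=> [x y] [/= hx hy]; apply: sb.
    have ls : Num.min (s / 2) (r / 2) < s by rewrite gt_min; apply/orP; left; lra.
    by split; rewrite /ball /= distrC; apply: le_lt_trans ls.
have [f fP] := choice step.
have [r0 r00 r0O] : exists2 r, 0 < r & ball z r `<=` O.
  have /nbhs_ballP[r /= r0 rb] : nbhs z O by apply: open_nbhs_nbhs.
  by exists r.
pose s := fix s n := if n is m.+1 then f (m, s m) else (z, r0).
have s_inv n : inv (s n).
  by elim: n => [|n IH] //=; have [] := fP (n, s n) IH.
have sP n : [/\ (s n.+1).2 <= (s n).2 / 2 &
    cb (s n.+1) `<=` ball (s n).1 (s n).2 `\` A n].
  by have [] := fP (n, s n) (s_inv n).
have ball_cb t : ball t.1 t.2 `<=` cb t.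
  move=> [x y] [/= b1 b2]; split => /=; rewrite distrC; exact: ltW.
have nest n m : (n <= m)%N -> cb (s m) `<=` cb (s n).
  elim: m => [|m IH]; first by rewrite leqn0 => /eqP ->.
  rewrite leq_eqVlt => /predU1P[-> //|/IH {}IH] w' w'P.
  by apply: IH; apply: ball_cb; have [_ /(_ _ w'P)[]] := sP m.
have ctr n : cb (s n) (s n).1.
  have [_ r_gt0 _] := s_inv n.
  by split; rewrite subrr normr0 ltW.
have lim (pr : R * R -> R) : (forall n w, cb (s n) w -> `|pr w - pr (s n).1| <= (s n).2) ->
    exists X, forall n, `|X - pr (s n).1| <= (s n).2.
  move=> H; pose L := [set pr (s n).1 - (s n).2 | n in [set: nat]].
  have LU n m : pr (s n).1 - (s n).2 <= pr (s m).1 + (s m).2.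
    have := H _ _ (nest n (maxn n m) (leq_maxl n m) _ (ctr (maxn n m))).
    have := H _ _ (nest m (maxn n m) (leq_maxr n m) _ (ctr (maxn n m))).
    by rewrite !ler_norml => /andP[? ?] /andP[? ?]; lra.
  exists (sup L) => n; rewrite ler_norml; apply/andP; split.
    rewrite lerBrDr addrC; apply: ub_le_sup; last by exists n.
    by exists (pr (s n).1 + (s n).2) => _ [m _ <-].
  rewrite lerBlDr addrC; apply: ge_sup; first by exists (pr (s n).1 - (s n).2), n.
  by move=> _ [m _ <-].
have [X XP] := lim fst (fun n w cw => cw.1).
have [Y YP] := lim snd (fun n w cw => cw.2).
have XY n : cb (s n) (X, Y) by split; [exact: XP|exact: YP].
have s_small n : (s n).2 <= r0 / 2 ^+ n.
  elim: n => [|n IH]; first by rewrite expr0 divr1.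
  have [h _] := sP n; apply: le_trans h _.
  by rewrite exprSr invfM mulrA ler_wpM2r // invr_ge0.
have SXY : S (X, Y).
  apply: cS => B /nbhs_ballP[t /= t0 tB].
  have [n nt] : exists n, r0 / 2 ^+ n < t.
    exists (Num.trunc (r0 / t)).+1; rewrite ltr_pdivrMr ?exprn_gt0 // mulrC.
    rewrite -ltr_pdivrMr //; apply: lt_le_trans (truncnS_gt _) _.
    by rewrite -natrX ler_nat; exact/ltnW/ltn_expl.
  have [Sn _ _] := s_inv n; exists (s n).1; split => //; apply: tB.
  by have [h1 h2] := XY n; split; rewrite /ball /=;
    apply: le_lt_trans nt; apply: le_trans (s_small n).
have OXY : O (X, Y).
  by apply: r0O; have [_ /(_ _ (XY 1%N))[]] := sP 0%N.
have [n _ An] := SA _ (conj SXY OXY).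
by have [_ /(_ _ (XY n.+1))[]] := sP n.
Qed.

End relative_baire.

(** * Plane measure *)

Lemma measurable_xsectionD d1 d2 (T1 : measurableType d1) (T2 : measurableType d2)
    (R : realType) (m2 : {sigma_finite_measure set T2 -> \bar R})
    (A : set (T1 * T2)) (D : set T1) :
  measurable A -> measurable_fun D (fun x => m2 (xsection A x)).
Proof. by move=> mA; apply: measurable_funTS; exact: measurable_fun_xsection. Qed.

Section plane_measure.
Variable R : realType.
Local Notation mu := (@lebesgue_measure R).

Definition mu2 : set (R * R) -> \bar R := (mu \x mu)%E.

(** An open set is a countable union of products of intervals with rational data,
so it belongs to the product of the two Borel sigma-algebras. *)
Lemma open_measurable2 (U : set (measurableTypeR R * measurableTypeR R)) :
  open (U : set (R * R)) -> measurable U.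
Proof.
move=> oU.
pose B (q : rat * rat * rat) : set (R * R) :=
  [set x : R | ratr q.1.1 - ratr q.2 < x < ratr q.1.1 + ratr q.2] `*`
  [set x : R | ratr q.1.2 - ratr q.2 < x < ratr q.1.2 + ratr q.2].
have -> : U = \bigcup_(q in [set q | B q `<=` U]) B q.
  rewrite eqEsubset; split; last by move=> z [q /= qU Bz]; exact: qU.
  move=> [x y] Uxy.
  have /nbhs_ballP[r /= r0 rU] : nbhs (x, y) U by apply: open_nbhs_nbhs.
  have r4 : r / 4 < r / 2 by lra.
  have [s] := rat_in_itvoo r4; rewrite in_itv /= => /andP[s1 s2].
  have near (t : R) : exists q : rat, t - ratr s < ratr q < t + ratr s.
    have tt : t - ratr s < t + ratr s by lra.
    by have [q] := rat_in_itvoo tt; rewrite in_itv; exists q.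
  have [q1 /andP[? ?]] := near x; have [q2 /andP[? ?]] := near y.
  exists (q1, q2, s) => /=.
    move=> [x' y'] [/= /andP[? ?] /andP[? ?]]; apply: rU.
    by split; rewrite /ball /= ltr_norml; apply/andP; split; lra.
  by split => /=; apply/andP; split; lra.
rewrite bigcup_mkcond; apply: countable_bigcupT_measurable => // q.
case: ifP => // _; apply: measurableX.
  rewrite (_ : [set x | _] = `](ratr q.1.1 - ratr q.2), (ratr q.1.1 + ratr q.2)[%classic) //.
rewrite (_ : [set x | _] = `](ratr q.1.2 - ratr q.2), (ratr q.1.2 + ratr q.2)[%classic) //.
Qed.

Lemma closed_measurable2 (U : set (measurableTypeR R * measurableTypeR R)) :
  closed (U : set (R * R)) -> measurable U.
Proof.
move=> cU; rewrite -(setCK U); apply: measurableC; apply: open_measurable2.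
by rewrite openC.
Qed.

(** The reflection in the diagonal, on sets. *)
Definition flip_set (X : set (R * R)) : set (R * R) := [set z | X (z.2, z.1)].

Lemma measurable_flip_set (X : set (measurableTypeR R * measurableTypeR R)) :
  measurable X -> measurable (flip_set X : set (measurableTypeR R * measurableTypeR R)).
Proof.
move=> mX; rewrite -[flip_set X]setTI.
exact: (@measurable_swap _ _ (measurableTypeR R) (measurableTypeR R) measurableT _ mX).
Qed.

Lemma mu2_flip_set (X : set (measurableTypeR R * measurableTypeR R)) :
  measurable X -> mu2 (flip_set X) = mu2 X.
Proof.
move=> mX; rewrite {2}/mu2.
rewrite (@product_measure_unique _ _ _ _ _ mu mu (mu \x^ mu)%E _ X mX) /=.
  by rewrite /mu2 /product_measure1 /product_measure2; apply: eq_integral => y _ /=;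
    congr (mu _); apply/seteqP; split => x; rewrite /xsection /ysection /flip_set /= !inE.
by move=> *; rewrite product_measure2E.
Qed.

Definition cell (a b c d : R) : set (R * R) := `]a, b]%classic `*` `]c, d]%classic.

Lemma measurable_cell a b c d :
  measurable (cell a b c d : set (measurableTypeR R * measurableTypeR R)).
Proof. exact: measurableX. Qed.

Lemma mu2_cell a b c d : a <= b -> c <= d ->
  mu2 (cell a b c d) = ((b - a) * (d - c))%:E.
Proof.
move=> ab cd; rewrite /mu2 product_measure1E // EFinM.
have mi (s t : R) : s <= t -> mu `]s, t] = (t - s)%:E.
  rewrite lebesgue_measure_itv /= lte_fin le_eqVlt => /predU1P[->|->].
    by rewrite ltxx subrr.
  by rewrite EFinB.
by congr (_ * _)%E; exact: mi.
Qed.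

(** At abscissas whose vertical line meets [E] the function [g] is at most [al]. If the
line misses [E], its whole section, of length [d - c], belongs to the complement of
[E] in the cell, and the bound [K] is paid by [K / (d - c)] times the
length of this section; by Fubini these lengths add up to a plane
measure. *)
Lemma strip_estimate (g : R -> R) (E : set (measurableTypeR R * measurableTypeR R))
    (a b c d a' b' al K : R) : measurable E -> continuous g ->
  a <= a' -> a' <= b' -> b' <= b -> c < d -> 0 <= al -> 0 <= K ->
  (forall x y, a' <= x <= b' -> c <= y <= d -> E (x, y) -> `|g x| <= al) ->
  (forall x, a' <= x <= b' -> `|g x| <= K) ->
  `|intoc g a' b'| <= al * (b - a) + K / (d - c) * fine (mu2 (cell a b c d `\` E)).
Proof.
move=> mE cg aa ab bb cd al0 K0 gal gK.
set X := cell a b c d `\` E.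
have mX : measurable (X : set (measurableTypeR R * measurableTypeR R)).
  by apply: measurableD => //; exact: measurable_cell.
have Xfin : mu2 X \is a fin_num.
  rewrite ge0_fin_numE; last exact: measure_ge0.
  apply: le_lt_trans (ltry ((b - a) * (d - c))); rewrite -mu2_cell; [|lra|lra].
  by apply: le_measure; rewrite ?inE //; [exact: measurable_cell|move=> z []].
have Kd : 0 <= K / (d - c) by rewrite divr_ge0 // subr_ge0 ltW.
rewrite -lee_fin EFinD [in leRHS]EFinM [X in (_ <= _ + X)%E]EFinM (fineK Xfin).
rewrite /intoc EFin_normr_Rintegral //; last exact: cont_integrable_oc.
have /integrableP[mg _] := cont_integrable_oc a' b' cg.
apply: le_trans (le_abse_integral _ _ mg) _ => //.
apply: (@le_trans _ _ (\int[mu]_(x in `]a', b']) (al%:E + (K / (d - c))%:E * mu (xsection X x)))%E).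
  apply: ge0_le_integral => //.
  - exact: (measurable_int mu (integrable_abse (cont_integrable_oc a' b' cg))).
  - by apply: emeasurable_funD => //; apply: measurable_funeM; exact: measurable_xsectionD.
  move=> x /=; rewrite in_itv /= => /andP[a'x xb'].
  have xab : a' <= x <= b' by rewrite (ltW a'x).
  have [[y [cyd Exy]]|nE] := pselect (exists y, c <= y <= d /\ E (x, y)).
    rewrite -[leLHS]adde0; apply: leeD; first by rewrite lee_fin; exact: gal cyd Exy.
    by rewrite mule_ge0 ?lee_fin.
  have -> : xsection X x = `]c, d]%classic.
    apply/seteqP; split => y; rewrite /xsection /= inE /X /cell /=.
      by move=> [[]].
    rewrite in_itv /= => /andP[cy yd]; split; first by rewrite !in_itv /= cy yd (le_trans xb') // (le_lt_trans aa).
    by move=> Exy; apply: nE; exists y; rewrite (ltW cy).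
  have -> : mu `]c, d] = (d - c)%:E by rewrite lebesgue_measure_itv /= lte_fin cd EFinB.
  rewrite -EFinM divfK ?subr_eq0 ?gt_eqF // -[leLHS]add0e; apply: leeD.
    by rewrite lee_fin.
  by rewrite lee_fin gK.
rewrite ge0_integralD //; last first.
- by apply: measurable_funeM; exact: measurable_xsectionD.
- by move=> x _; rewrite mule_ge0 ?lee_fin.
apply: leeD.
  rewrite integral_cst //= -EFinM.
  rewrite [X in (_ * X)%E](_ : _ = mu `]a', b']) // lebesgue_measure_itv /= lte_fin.
  have [lt|ge] := ltP a' b'; first by rewrite -EFinB -EFinM lee_fin ler_wpM2l //; lra.
  by rewrite mule0 lee_fin mulr_ge0 //; lra.
rewrite ge0_integralZl //; last exact: measurable_xsectionD.
apply: lee_wpmul2l; first by rewrite lee_fin.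
by apply: ge0_subset_integral => //; exact: measurable_xsectionD.
Qed.

(** The same set function, with its structure of measure. *)
Definition mu2_measure : {measure set (measurableTypeR R * measurableTypeR R) -> \bar R} :=
  (mu \x mu)%E.

End plane_measure.

(** * Integration around a small rectangle *)

Section cell_estimate.
Variable R : realType.
Implicit Types (u v : R -> R -> R) (a b c d e x y M N p q r : R).
Implicit Types S E : set (R * R).

Lemma dist_itv x y a b : a <= x <= b -> a <= y <= b -> `|x - y| <= b - a.
Proof.
by move=> /andP[? ?] /andP[? ?]; rewrite ler_norml; apply/andP; split; lra.
Qed.

Lemma oint0_off_bad u v S a b c d : sep_cont u -> sep_cont v -> a <= b -> c <= d ->
  (forall x y, ~ S (x, y) -> loc_oint0 u v x y) ->
  (forall x y, a <= x <= b -> c <= y <= d -> ~ S (x, y)) -> oint u v a b c d = 0.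
Proof.
by move=> su sv ab cd off noS; apply: oint0_compact => // x y xab ycd; apply: off; exact: noS.
Qed.

(** The four strips between the rectangle and a smaller one that still contains all
the bad points have no bad point in their interior, so the integral around
them vanishes; that it vanishes up to the sides that touch [S] follows by
continuity. *)
Lemma oint_shrink u v S a b c d a' b' c' d' : sep_cont u -> sep_cont v ->
  a <= a' -> a' <= b' -> b' <= b -> c <= c' -> c' <= d' -> d' <= d ->
  (forall x y, ~ S (x, y) -> loc_oint0 u v x y) ->
  (forall x y, a <= x <= b -> c <= y <= d -> S (x, y) ->
     (a' <= x <= b') && (c' <= y <= d')) ->
  oint u v a b c d = oint u v a' b' c' d'.
Proof.
move=> su sv aa ab bb cc cd dd off sub.
have cd' : c <= d := le_trans cc (le_trans cd dd).
have out x1 x2 y1 y2 : a <= x1 -> x1 <= x2 -> x2 <= b -> c <= y1 -> y1 <= y2 ->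
    y2 <= d -> [|| x2 < a', b' < x1, y2 < c' | d' < y1] -> oint u v x1 x2 y1 y2 = 0.
  move=> h1 h2 h3 h4 h5 h6 h7.
  apply: (@oint0_off_bad _ _ S) => // x y /andP[x1x xx2] /andP[y1y yy2] Sxy.
  have := sub x y; rewrite (le_trans h1 x1x) (le_trans xx2 h3) (le_trans h4 y1y).
  rewrite (le_trans yy2 h6) => /(_ isT isT Sxy) /andP[/andP[k1 k2] /andP[k3 k4]].
  by case/or4P: h7 => h7; lra.
rewrite (@oint_splitx _ u v a a' b) ?(le_trans ab) // (@oint_splitx _ u v a' b' b) //.
rewrite (@oint_splity _ u v a' b' c c' d) ?(le_trans cd) // (@oint_splity _ u v a' b' c' d' d) //.
have -> : oint u v a a' c d = 0.
  apply: oint_lim_right => // x /andP[ax xa']; apply: out => //; first by lra.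
  by rewrite xa'.
have -> : oint u v b' b c d = 0.
  apply: oint_lim_left => // x /andP[ax xa']; apply: out => //; first by lra.
  by rewrite ax orbT.
have -> : oint u v a' b' c c' = 0.
  rewrite oint_flip; apply: oint_lim_right => //; try exact: sep_cont_flip.
  move=> y /andP[cy yc']; rewrite -oint_flip; apply: out => //; first by lra.
  by rewrite yc' !orbT.
have -> : oint u v a' b' d' d = 0.
  rewrite oint_flip; apply: oint_lim_left => //; try exact: sep_cont_flip.
  move=> y /andP[cy yc']; rewrite -oint_flip; apply: out => //; first by lra.
  by rewrite cy !orbT.
ring.
Qed.

(** The contribution of the two horizontal sides, compared with that of a linear
function with slope [q0]. If the vertical line at [x] contains a point [(x, y)] of
[E], then [u x c'] and [u x d'] are compared with [u x y] by means of a slope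
close to [q0]. For the other [x] there is only a bound: [S] meets both sides, at
[(s, c')] and [(t, d')], and the estimates on [S] with constant [N] bound the
variation of [u] along the path [(x, c')], [(s, c')], [(s, d')], [(t, d')],
[(x, d')]. *)
Lemma half_estimate u v S (E : set (measurableTypeR R * measurableTypeR R))
    a b c d a' b' c' d' e N r q0 :
  sep_cont u -> measurable E -> a <= a' -> a' <= b' -> b' <= b ->
  c <= c' -> c' <= d' -> d' <= d -> c < d -> 0 <= e -> e <= N ->
  b - a < r -> d - c < r ->
  (forall x y, a <= x <= b -> c <= y <= d -> S (x, y) -> cross u v 0 0 N r x y) ->
  (forall x y, a <= x <= b -> c <= y <= d -> E (x, y) ->
     exists p q, cross u v p q e r x y /\ `|q - q0| <= 4 * e) ->
  `|q0| <= N + e ->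
  (exists2 x, a <= x <= b & S (x, c')) -> (exists2 x, a <= x <= b & S (x, d')) ->
  `|intoc (u ^~ c') a' b' - intoc (u ^~ d') a' b' - q0 * (d' - c') * (b' - a')| <=
  6 * e * (d - c) * (b - a) +
  3 * N * (b - a + (d - c)) / (d - c) * fine (mu2 (cell a b c d `\` E)).
Proof.
move=> [u1 u2 _] mE aa ab bb cc cd dd cd0 e0 eN abr cdr SN Ee q0N [s sab Ss] [t tab St].
(* The integral of [g] is the quantity to be estimated. *)
pose g x := u x c' - u x d' - q0 * (d' - c').
have cg : continuous g.
  move=> x; apply: (@cvgB _ R^o); last exact: cvg_cst.
  by apply: (@cvgB _ R^o); exact: u1.
have -> : intoc (u ^~ c') a' b' - intoc (u ^~ d') a' b' - q0 * (d' - c') * (b' - a') = intoc g a' b'.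
  rewrite /g intocB; last by move=> x; exact: cvg_cst.
    by rewrite intocB // intoc_cst.
  by move=> x; apply: (@cvgB _ R^o); exact: u1.
have N0 : 0 <= N by lra.
have c'cd : c <= c' <= d by rewrite cc (le_trans cd).
have d'cd : c <= d' <= d by rewrite dd (le_trans cc).
apply: strip_estimate => //.
- by rewrite !mulr_ge0 // subr_ge0 ltW.
- by rewrite !mulr_ge0 //; lra.
- move=> x y /andP[a'x xb'] cyd Exy.
  have xab : a <= x <= b by rewrite (le_trans aa) // (le_trans xb').
  have [p [q [C qq0]]] := Ee x y xab cyd Exy.
  have h1 := le_lt_trans (dist_itv c'cd cyd) cdr.
  have h2 := le_lt_trans (dist_itv d'cd cyd) cdr.
  have [_ _ k1 _] := C _ h1; have [_ _ k2 _] := C _ h2.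
  rewrite ![y + _]addrC !subrK in k1 k2.
  have -> : g x = (u x c' - u x y + q * (c' - y)) - (u x d' - u x y + q * (d' - y))
      + (q - q0) * (d' - c') by rewrite /g; ring.
  have l1 : e * `|c' - y| <= e * (d - c).
    by rewrite ler_wpM2l // dist_itv.
  have l2 : e * `|d' - y| <= e * (d - c).
    by rewrite ler_wpM2l // dist_itv.
  have l3 : `|(q - q0) * (d' - c')| <= 4 * e * (d - c).
    by rewrite normrM ler_pM // dist_itv.
  move: (le_trans k1 l1) (le_trans k2 l2) l3.
  set A := _ + _; set B := _ + _; set C' := (_ - _) * _.
  clearbody A B C'; clear -d; rewrite !ler_norml => /andP[? ?] /andP[? ?] /andP[? ?].
  by apply/andP; split; lra.
move=> x /andP[a'x xb'].
have xab : a <= x <= b by rewrite (le_trans aa) // (le_trans xb').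
have Cs := SN _ _ sab c'cd Ss; have Ct := SN _ _ tab d'cd St.
have h1 := le_lt_trans (dist_itv xab sab) abr.
have h2 := le_lt_trans (dist_itv d'cd c'cd) cdr.
have h3 := le_lt_trans (dist_itv sab tab) abr.
have h4 := le_lt_trans (dist_itv xab tab) abr.
have [k1 _ _ _] := Cs _ h1; have [_ _ k2 _] := Cs _ h2.
have [k3 _ _ _] := Ct _ h3; have [k4 _ _ _] := Ct _ h4.
rewrite ![_ + (_ - _)]addrC !subrK !mul0r !addr0 !subr0 in k1 k2 k3 k4.
have m1 : N * `|x - s| <= N * (b - a).
  by rewrite ler_wpM2l // dist_itv.
have m2 : N * `|d' - c'| <= N * (d - c).
  by rewrite ler_wpM2l // dist_itv.
have m3 : N * `|s - t| <= N * (b - a).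
  by rewrite ler_wpM2l // dist_itv.
have m4 : N * `|x - t| <= N * (b - a).
  by rewrite ler_wpM2l // dist_itv.
have m5 : `|q0 * (d' - c')| <= 2 * N * (d - c).
  by rewrite normrM ler_pM ?dist_itv //; lra.
have -> : g x = (u x c' - u s c') - (u s d' - u s c') + (u s d' - u t d')
   - (u x d' - u t d') - q0 * (d' - c') by rewrite /g; ring.
move: (le_trans k1 m1) (le_trans k2 m2) (le_trans k3 m3) (le_trans k4 m4) m5.
have -> : 3 * N * (b - a + (d - c)) = 3 * (N * (b - a)) + 3 * (N * (d - c)) by ring.
rewrite -[2 * N * _]mulrA.
set t1 := _ - _; set t2 := u s d' - _; set t3 := u s d' - _; set t4 := u x d' - _.
move: (N * (b - a)) (N * (d - c)) (q0 * (d' - c')) t1 t2 t3 t4 => w1 w2 w3.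
clear; move=> t1 t2 t3 t4.
rewrite !ler_norml => /andP[? ?] /andP[? ?] /andP[? ?] /andP[? ?] /andP[? ?].
by apply/andP; split; lra.
Qed.

(** It provides the sides of the bounding rectangle of a closed set; each of these
sides contains a point of the set. *)
Lemma compact_extrema S a b c d : closed S ->
  (exists x y, [/\ a <= x <= b, c <= y <= d & S (x, y)]) ->
  forall pr : R * R -> R, continuous pr ->
  (exists x y, [/\ a <= x <= b, c <= y <= d, S (x, y) &
     forall x' y', a <= x' <= b -> c <= y' <= d -> S (x', y') -> pr (x', y') <= pr (x, y)]).
Proof.
move=> cS [x [y [xab ycd Sxy]]] pr cpr.
pose K := (`[a, b] `*` `[c, d])%classic `&` S.
have cK : compact K.
  by apply: compact_closedI => //; apply: compact_setX; exact: segment_compact.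
have K0 : K !=set0.
  by exists (x, y); split => //; split; rewrite /= in_itv.
have [[x0 y0] + H] := compact_EVT_max K0 cK (continuous_subspaceT cpr).
rewrite inE => -[[/=]]; rewrite !in_itv /= => x0P y0P S0.
exists x0, y0; split => // x' y' x'P y'P S'; apply: H; rewrite inE.
by split => //; split; rewrite /= in_itv.
Qed.

(** The rectangle is replaced by the bounding rectangle of the bad points in it, by
[oint_shrink]. The horizontal and the vertical sides are treated by
[half_estimate] with the same slope [q0], by [cross_cmp] a slope common to all
points of [E]; the linear terms of the two parts cancel, as the
integral of a constant around a rectangle. *)
Lemma cell_estimate u v S (E : set (measurableTypeR R * measurableTypeR R))
    a b c d e N r :
  sep_cont u -> sep_cont v -> closed S -> measurable E -> (E `<=` S)%classic ->
  a < b -> c < d -> 0 <= e -> e <= N -> b - a < r -> d - c < r ->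
  (forall x y, ~ S (x, y) -> loc_oint0 u v x y) ->
  (forall x y, a <= x <= b -> c <= y <= d -> S (x, y) -> cross u v 0 0 N r x y) ->
  (forall x y, a <= x <= b -> c <= y <= d -> E (x, y) ->
     exists p q, cross u v p q e r x y) ->
  (exists x y, [/\ a <= x <= b, c <= y <= d & S (x, y)]) ->
  `|oint u v a b c d| <= 12 * e * ((b - a) * (d - c)) +
    3 * N * ((b - a + (d - c)) / (d - c) + (b - a + (d - c)) / (b - a)) *
    fine (mu2 (cell a b c d `\` E)).
Proof.
move=> su sv cS mE ES ab cd e0 eN abr cdr off SN Ee Sne.
have c1 : continuous (@fst R R) by move=> z; exact: cvg_fst.
have c2 : continuous (@snd R R) by move=> z; exact: cvg_snd.
(* The sides of the bounding rectangle, each with a point of [S] on it. *)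
have [b' [yb [b'ab ybcd Sb b'max]]] := compact_extrema cS Sne c1.
have [xd [d' [xdab d'cd Sd d'max]]] := compact_extrema cS Sne c2.
have cN1 : continuous (fun z : R * R => - z.1).
  by move=> z; apply: (@cvgN _ R^o); exact: c1.
have cN2 : continuous (fun z : R * R => - z.2).
  by move=> z; apply: (@cvgN _ R^o); exact: c2.
have [a' [ya [a'ab yacd Sa a'min]]] := compact_extrema cS Sne cN1.
have [xc [c' [xcab c'cd Sc c'min]]] := compact_extrema cS Sne cN2.
have a'b' : a' <= b' by have /= := b'max _ _ a'ab yacd Sa.
have c'd' : c' <= d' by have /= := d'max _ _ xcab c'cd Sc.
have [[/andP[? ?] /andP[? ?]] [/andP[? ?] /andP[? ?]]] :
  ((a <= a' <= b) /\ (a <= b' <= b)) /\ ((c <= c' <= d) /\ (c <= d' <= d)) by [].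
rewrite (@oint_shrink u v S a b c d a' b' c' d') //; last first.
  move=> x y xP yP Sxy.
  have /= := b'max _ _ xP yP Sxy; have /= := d'max _ _ xP yP Sxy.
  have /= := a'min _ _ xP yP Sxy; have /= := c'min _ _ xP yP Sxy.
  by rewrite !lerN2 => -> -> -> ->.
have r0 : 0 < r by lra.
have [q0 [q0N q0E]] : exists q0, `|q0| <= N + e /\ forall x y, a <= x <= b ->
    c <= y <= d -> E (x, y) -> exists p q, cross u v p q e r x y /\ `|q - q0| <= 4 * e.
  have [[x0 [y0 [x0P y0P E0]]]|none] :=
    pselect (exists x y, [/\ a <= x <= b, c <= y <= d & E (x, y)]); last first.
    exists 0; split; first by rewrite normr0; lra.
    by move=> x y xP yP Exy; case: none; exists x, y.
  have [p0 [q0 C0]] := Ee _ _ x0P y0P E0.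
  exists q0; split.
    have [_] := cross_same r0 (SN _ _ x0P y0P (ES _ E0)) C0.
    by rewrite sub0r normrN.
  move=> x y xP yP Exy; have [p [q C]] := Ee _ _ xP yP Exy.
  exists p, q; split => //.
  have h1 := le_lt_trans (dist_itv xP x0P) abr.
  have h2 := le_lt_trans (dist_itv yP y0P) cdr.
  by have [] := cross_cmp r0 e0 C0 C h1 h2.
have H1 := @half_estimate u v S E a b c d a' b' c' d' e N r q0.
have {H1} H1 := H1 su mE ltac:(assumption) a'b' ltac:(assumption) ltac:(assumption)
  c'd' ltac:(assumption) cd e0 eN abr cdr SN q0E q0N.
have {}H1 := H1 (ex_intro2 _ _ xc xcab Sc) (ex_intro2 _ _ xd xdab Sd).
have H2 := @half_estimate (flip v) (flip u) (flip_set S) (flip_set E) c d a b c' d' a' b' e N r (- q0).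
have {}H2 := H2 (sep_cont_flip sv) (measurable_flip_set mE) ltac:(assumption) c'd' ltac:(assumption)
  ltac:(assumption) a'b' ltac:(assumption) ab e0 eN cdr abr.
have {}H2 := H2 ltac:(move=> y x yP xP /= Sxy; have := cross_flip (SN _ _ xP yP Sxy);
  by rewrite oppr0).
have {}H2 := H2 ltac:(move=> y x yP xP /= Exy; have [p [q [C qq]]] := q0E _ _ xP yP Exy;
  exists p, (- q); split; [exact: cross_flip | by rewrite -opprD normrN]).
have {}H2 := H2 ltac:(by rewrite normrN).
have {}H2 := H2 (ex_intro2 _ _ ya yacd Sa) (ex_intro2 _ _ yb ybcd Sb).
have swE : mu2 (cell c d a b `\` flip_set E) = mu2 (cell a b c d `\` E).
  rewrite -(@mu2_flip_set _ (cell a b c d `\` E)); last first.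
    by apply: measurableD => //; exact: measurable_cell.
  by congr mu2; apply/seteqP; split => -[y x] [[/= h1 h2] h3]; split.
rewrite swE in H2.
have -> : oint u v a' b' c' d' =
   (intoc (u ^~ c') a' b' - intoc (u ^~ d') a' b' - q0 * (d' - c') * (b' - a')) +
   (intoc (flip v ^~ a') c' d' - intoc (flip v ^~ b') c' d' - - q0 * (b' - a') * (d' - c')).
  by rewrite /oint /flip; ring.
apply: le_trans (ler_normD _ _) _; apply: le_trans (lerD H1 H2) _.
rewrite le_eqVlt; apply/orP; left; apply/eqP.
by move: (fine _) => m; field; apply/andP; split; rewrite subr_eq0 gt_eqF.
Qed.

End cell_estimate.

(** * The bad set *)

Section bad_points.
Variable R : realType.
Implicit Types (u v : R -> R -> R) (a b c d e x y M N p q r t : R).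

Lemma cross_pert u v p q p' q' e r t x y : cross u v p q e r x y ->
  `|p - p'| <= t -> `|q - q'| <= t -> cross u v p' q' (e + t) r x y.
Proof.
move=> C pp qq h hr; have [h1 h2 h3 h4] := C h hr.
have tri (s s' w : R) : `|w| <= e * `|h| -> `|s - s'| <= t ->
    `|w + (s - s') * h| <= (e + t) * `|h|.
  move=> w1 ss; apply: le_trans (ler_normD _ _) _; rewrite [leRHS]mulrDl lerD //.
  by rewrite normrM ler_wpM2r.
split.
- by have := tri p p' _ h1 pp; congr (`|_| <= _); ring.
- by have := tri q q' _ h2 qq; congr (`|_| <= _); ring.
- by rewrite distrC in qq; have := tri q' q _ h3 qq; congr (`|_| <= _); ring.
- by have := tri p p' _ h4 pp; congr (`|_| <= _); ring.
Qed.

(** The closed set of points near which [u dx - v dy] is not exact; the aim is to show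
that it is empty. *)
Definition badset u v : set (R * R) := [set z | ~ loc_oint0 u v z.1 z.2].

Lemma badset_closed u v : closed (badset u v).
Proof.
rewrite -openC openE => -[x y] /= /contrapT [r r0 rJ]; rewrite /interior.
apply/nbhs_ballP; exists (r / 2) => /=; first by rewrite divr_gt0.
move=> [x' y'] [/=]; rewrite /ball /= !ltr_norml => /andP[? ?] /andP[? ?].
rewrite /badset /=; apply; exists (r / 2); first by rewrite divr_gt0.
by move=> *; apply: rJ => /=; lra.
Qed.

(** The bad points at which the Cauchy-Riemann equations hold with precision [e] at
scale [1 / (k + 1)], for some rational slopes. With rational slopes this is a countable union
of closed sets, hence measurable. *)
Definition slope_set u v e k : set (R * R) := badset u v `&`
  \bigcup_(pq in [set: rat * rat])
    [set z | cross u v (ratr pq.1) (ratr pq.2) e k.+1%:R^-1 z.1 z.2].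

Lemma measurable_slope_set u v e k : sep_cont u -> sep_cont v -> 0 <= e ->
  measurable (slope_set u v e k : set (measurableTypeR R * measurableTypeR R)).
Proof.
move=> su sv e0; apply: measurableI; first by apply: closed_measurable2; exact: badset_closed.
apply: countable_bigcupT_measurable => // pq.
apply: closed_measurable2.
exact: (@cross_closed R u v (ratr pq.1) (ratr pq.2) e k.+1%:R^-1 su sv e0).
Qed.

Definition near_set (S : set (R * R)) t : set (R * R) := \bigcup_(s in S) ball s t.

Lemma measurable_near_set S t :
  measurable (near_set S t : set (measurableTypeR R * measurableTypeR R)).
Proof.
apply: open_measurable2; apply: bigcup_open => -[x y] Ss; rewrite openE => -[x' y'] [/=].
rewrite /ball /interior /= => h1 h2; apply/nbhs_ballP.
exists (Num.min (t - `|x - x'|) (t - `|y - y'|)) => /=.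
  by rewrite lt_min !subr_gt0 h1.
move=> [x2 y2] [/=]; rewrite /ball /= !lt_min => /andP[k1 _] /andP[_ k2].
split; rewrite /ball /=.
  by apply: le_lt_trans (ler_distD x' _ _) _; rewrite addrC -ltrBrDr.
by apply: le_lt_trans (ler_distD y' _ _) _; rewrite addrC -ltrBrDr.
Qed.

Lemma rat_approx x t : 0 < t -> exists q : rat, `|x - ratr q| <= t.
Proof.
move=> t0; have lt : x - t < x + t by lra.
have [q] := rat_in_itvoo lt; rewrite in_itv /= => /andP[? ?].
by exists q; rewrite ler_norml; apply/andP; split; lra.
Qed.

Lemma small_inv t : 0 < t -> exists k, k.+1%:R^-1 < t.
Proof.
move=> t0; exists (Num.trunc t^-1).
by rewrite -[ltRHS]invrK ltf_pV2 ?posrE ?invr_gt0 //; exact: truncnS_gt.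
Qed.

(** A point that lies for every [k] near the bad set but not in [slope_set u v e k] would
be a bad point, as the bad set is closed, without approximate Cauchy-Riemann
equations of precision [e] at any scale. So these decreasing sets have empty intersection, and their
measures tend to [0]. *)
Lemma small_defect u v a b c d e : sep_cont u -> sep_cont v -> 0 < e -> a <= b -> c <= d ->
  (forall x y, a <= x <= b -> c <= y <= d -> CRat u v x y) ->
  exists k, fine (mu2 (cell a b c d `&`
    (near_set (badset u v) k.+1%:R^-1 `\` slope_set u v e k))) <= e.
Proof.
move=> su sv e0 ab cd CR.
pose V k := cell a b c d `&`
    (near_set (badset u v) k.+1%:R^-1 `\` slope_set u v e k).
have mV k : measurable (V k : set (measurableTypeR R * measurableTypeR R)).
  apply: measurableI; first exact: measurable_cell.
  apply: measurableD; first exact: measurable_near_set.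
  exact: measurable_slope_set (ltW e0).
have V0 : \bigcap_k V k = set0.
  apply/seteqP; split => // -[x y] H.
  have [[/=]] := H 0%N I; rewrite !in_itv /= => /andP[ax xb] /andP[cy yd] _.
  have [p [q pqC]] := CR x y ltac:(by rewrite (ltW ax)) ltac:(by rewrite (ltW cy)).
  have e2 : 0 < e / 2 by lra.
  have [r r0 C] := pqC _ e2.
  (* Half of [e] is spent on replacing the slopes by rational ones. *)
  have [p' pp] := rat_approx p e2; have [q' qq] := rat_approx q e2.
  have [k kr] : exists k, k.+1%:R^-1 < r.
    exact: small_inv.
  have [_ [_]] := H k I; apply; split.
    apply: badset_closed => B /nbhs_ballP[t /= t0 tB].
    have [m mt] : exists m, m.+1%:R^-1 < t.
      exact: small_inv.
    have [_ [[s Ss bs] _]] := H m I; exists s; split => //; apply: tB.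
    by apply/ball_sym; apply: le_ball bs; exact: ltW.
  exists (p', q') => //=; have := cross_pert C pp qq.
  by rewrite -splitr; apply: cross_sub => //; exact: ltW.
have Vfin : (mu2 (V 0%N) < +oo)%E.
  apply: le_lt_trans (ltry ((b - a) * (d - c))); rewrite -mu2_cell //.
  by apply: le_measure; rewrite ?inE //; [exact: measurable_cell|move=> z []].
have Vdec : nonincreasing_seq V.
  move=> m n mn; apply/subsetPset => z [cz [[s Ss bs] nE]].
  have mn' : n.+1%:R^-1 <= m.+1%:R^-1 :> R by rewrite lef_pV2 ?posrE // ler_nat.
  split => //; split; first by exists s => //; apply: le_ball bs.
  move=> [Sz [pq _ C]]; apply: nE; split => //; exists pq => //.
  by apply: cross_sub C.
have := @nonincreasing_cvg_mu _ _ _ (mu2_measure R) V Vfin mV _ Vdec.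
rewrite V0 measure0 => /(_ measurable0) /fine_cvgP [_].
move=> /cvgrPdist_le /(_ e e0) [k _ /(_ k (leqnn k))] /=.
by rewrite sub0r normrN => H; exists k; apply: le_trans (ler_norm _) H.
Qed.

End bad_points.

(** * The Looman-Menchoff theorem for bounded functions *)

Section vanishing.
Variable R : realType.
Implicit Types (u v : R -> R -> R) (a b c d e x y M N p q r t : R).

Lemma mu2_split u v (V : set (measurableTypeR R * measurableTypeR R)) (X Y Z : set (R * R)) :
  measurable V -> measurable (X : set (measurableTypeR R * measurableTypeR R)) ->
  measurable (Y : set (measurableTypeR R * measurableTypeR R)) ->
  Z = X `|` Y -> X `&` Y = set0 -> (mu2 X < +oo)%E -> (mu2 Y < +oo)%E ->
  fine (mu2 (Z `&` V)) = fine (mu2 (X `&` V)) + fine (mu2 (Y `&` V)).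
Proof.
move=> mV mX mY -> XY Xf Yf.
have mXV := measurableI _ _ mX mV; have mYV := measurableI _ _ mY mV.
have fin (W W' : set (measurableTypeR R * measurableTypeR R)) :
    measurable W -> measurable W' -> W' `<=` W -> (mu2 W < +oo)%E -> mu2 W' \is a fin_num.
  move=> mW mW' WW Wf; rewrite ge0_fin_numE; last exact: measure_ge0 (mu2_measure R) _.
  by apply: le_lt_trans Wf; apply: (le_measure (mu2_measure R)); rewrite ?inE.
rewrite -fineD; last first.
- exact: (fin _ _ mY mYV (@subIsetl _ _ _) Yf).
- exact: (fin _ _ mX mXV (@subIsetl _ _ _) Xf).
congr fine; rewrite setIUl; apply: (measureU (mu2_measure R)) => //.
by apply/seteqP; split => // z [[Xz _] [Yz _]]; rewrite -XY.
Qed.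

Lemma cell_splitx a m b c d : a <= m -> m <= b ->
  cell a b c d = cell a m c d `|` cell m b c d /\ cell a m c d `&` cell m b c d = set0.
Proof.
move=> am mb; split; apply/seteqP; split => -[x y] /=; rewrite /cell /= ?in_itv /= ?in_itv /=.
- move=> [/andP[ax xb] yP]; by have [xm|mx] := leP x m; [left|right]; split; rewrite ?ax ?xm ?mx ?xb.
- move=> [] [/andP[ax xb] yP]; split => //.
  + by rewrite ax (le_trans xb).
  + by rewrite xb (le_lt_trans am).
- by move=> [[/= /andP[_ h1] _] [/= /andP[h2 _] _]]; have := lt_le_trans h2 h1; rewrite ltxx.
- by [].
Qed.

Lemma cell_splity a b c m d : c <= m -> m <= d ->
  cell a b c d = cell a b c m `|` cell a b m d /\ cell a b c m `&` cell a b m d = set0.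
Proof.
move=> am mb; split; apply/seteqP; split => -[x y] /=; rewrite /cell /= ?in_itv /= ?in_itv /=.
- move=> [xP /andP[ax xb]]; by have [xm|mx] := leP y m; [left|right]; split; rewrite ?ax ?xm ?mx ?xb.
- move=> [] [xP /andP[ax xb]]; split => //.
  + by rewrite ax (le_trans xb).
  + by rewrite xb (le_lt_trans am).
- by move=> [[/= _ /andP[_ h1]] [/= _ /andP[h2 _]]]; have := lt_le_trans h2 h1; rewrite ltxx.
- by [].
Qed.

(** On the small similar rectangles produced by bisection the integral is at most
[12 e] times the area plus a constant times the measure of the exceptional set
[V] in the rectangle, by [cell_estimate], or it vanishes because the rectangle
contains no bad point. Both terms of the bound are additive, so it holds
for the whole rectangle, where [V] has measure at most [e]; finally [e] tends to
[0]. *)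
Lemma oint0_level u v N r a b c d : sep_cont u -> sep_cont v -> 1 <= N -> a <= b -> c <= d ->
  b - a < r -> d - c < r ->
  (forall x y, a <= x <= b -> c <= y <= d -> CRat u v x y) ->
  (forall x y, a <= x <= b -> c <= y <= d -> badset u v (x, y) ->
     cross u v 0 0 N r x y) ->
  oint u v a b c d = 0.
Proof.
move=> su sv N1 + + abr cdr CR SN.
rewrite le_eqVlt => /predU1P[<- _|ab]; first exact: oint_xx.
rewrite le_eqVlt => /predU1P[<-|cd]; first exact: oint_yy.
pose S := badset u v.
pose K := (b - a + (d - c)) / (d - c) + (b - a + (d - c)) / (b - a).
have K0 : 0 <= K by rewrite addr_ge0 // divr_ge0 //; lra.
have N0 : 0 <= N by apply: le_trans N1.
suff main e : 0 < e -> e <= 1 ->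
    `|oint u v a b c d| <= (12 * ((b - a) * (d - c)) + 3 * N * K) * e.
  apply/eqP; rewrite -normr_le0; apply/ler_addgt0Pr => t t0; rewrite add0r.
  pose W := 12 * ((b - a) * (d - c)) + 3 * N * K.
  have W0 : 0 <= W by rewrite addr_ge0 // !mulr_ge0 //; lra.
  have W1 : 0 < W + 1 by lra.
  have e0 : 0 < Num.min 1 (t / (W + 1)) by rewrite lt_min ltr01 divr_gt0.
  apply: le_trans (main _ e0 _) _; first by rewrite ge_min lexx.
  apply: (@le_trans _ _ (W * (t / (W + 1)))).
    by rewrite ler_wpM2l // ge_min lexx orbT.
  by rewrite mulrCA ler_piMr ?(ltW t0) // ler_pdivrMr //; lra.
move=> e0 e1.
have [k kE] := small_defect su sv e0 (ltW ab) (ltW cd) CR.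
set V := near_set S k.+1%:R^-1 `\` slope_set u v e k in kE.
have mV : measurable (V : set (measurableTypeR R * measurableTypeR R)).
  apply: measurableD; first exact: measurable_near_set.
  exact: measurable_slope_set (ltW e0).
pose P a' b' c' d' := [/\ a <= a' , b' <= b, c <= c' & d' <= d] ->
  `|oint u v a' b' c' d'| <= 12 * e * ((b' - a') * (d' - c')) +
    3 * N * K * fine (mu2 (cell a' b' c' d' `&` V)).
suff : P a b c d.
  move=> /(_ ltac:(by split)) /le_trans; apply.
  rewrite [leRHS]mulrDl lerD //; first by rewrite le_eqVlt; apply/orP; left; apply/eqP; ring.
  by rewrite ler_wpM2l // !mulr_ge0 //; lra.
have pmfin a' b' c' d' : a' <= b' -> c' <= d' -> (mu2 (cell a' b' c' d') < +oo)%E.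
  by move=> ? ?; rewrite mu2_cell // ltry.
(* A rectangle of this size that meets the bad set lies in the [1 / (k + 1)]-neighbourhood of it. *)
pose t := Num.min k.+1%:R^-1 r.
have r0 : 0 < r by lra.
have t0 : 0 < t by rewrite lt_min r0 andbT.
apply: (@halving _ P a b c d t) => //; rewrite ?ltW //.
- move=> a' m b' c' d' am mb cd' P1 P2 [aa bb cc dd].
  have [E1 E2] := cell_splitx c' d' am mb.
  rewrite (oint_splitx c' d' su sv am mb) (mu2_split u v mV _ _ E1 E2) //; last first.
  + exact: pmfin.
  + exact: pmfin.
  + exact: measurable_cell.
  + exact: measurable_cell.
  apply: le_trans (ler_normD _ _) _.
  have Q1 := P1 ltac:(split => //; exact: le_trans mb bb).
  have Q2 := P2 ltac:(split => //; exact: le_trans aa am).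
  apply: le_trans (lerD Q1 Q2) _; rewrite addrACA -!mulrDr lerD2r.
  by rewrite le_eqVlt; apply/orP; left; apply/eqP; congr (_ * _); ring.
- move=> a' b' c' m d' ab' cm md P1 P2 [aa bb cc dd].
  have [E1 E2] := cell_splity a' b' cm md.
  rewrite (oint_splity a' b' su sv cm md) (mu2_split u v mV _ _ E1 E2) //; last first.
  + exact: pmfin.
  + exact: pmfin.
  + exact: measurable_cell.
  + exact: measurable_cell.
  apply: le_trans (ler_normD _ _) _.
  have Q1 := P1 ltac:(split => //; exact: le_trans md dd).
  have Q2 := P2 ltac:(split => //; exact: le_trans cc cm).
  apply: le_trans (lerD Q1 Q2) _; rewrite addrACA -!mulrDr lerD2r.
  by rewrite le_eqVlt; apply/orP; left; apply/eqP; congr (_ * _); ring.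
move=> n a' b' c' d' aa bb cc dd wE hE wt ht _.
have two0 : (0 : R) < 2 ^+ n by rewrite exprn_gt0.
have ab' : a' < b' by rewrite -subr_gt0 wE divr_gt0 // subr_gt0.
have cd' : c' < d' by rewrite -subr_gt0 hE divr_gt0 // subr_gt0.
have sub x : a' <= x <= b' -> a <= x <= b.
  by move=> /andP[? ?]; rewrite (le_trans aa) // (le_trans _ bb).
have sub' y : c' <= y <= d' -> c <= y <= d.
  by move=> /andP[? ?]; rewrite (le_trans cc) // (le_trans _ dd).
have off x y : ~ S (x, y) -> loc_oint0 u v x y by move/contrapT.
have fge : 0 <= fine (mu2 (cell a' b' c' d' `&` V)).
  by rewrite fine_ge0 // (measure_ge0 (mu2_measure R)).
have [Sne|noS] := pselect (exists x y, [/\ a' <= x <= b', c' <= y <= d' & S (x, y)]); last first.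
  rewrite (oint0_off_bad su sv (ltW ab') (ltW cd') off) ?normr0; last first.
    by move=> x y xP yP Sxy; apply: noS; exists x, y.
  by rewrite addr_ge0 // !mulr_ge0 ?subr_ge0 ?(ltW e0) ?(ltW ab') ?(ltW cd').
have [tk tr] : t <= k.+1%:R^-1 /\ t <= r by rewrite !ge_min !lexx orbT.
have est := @cell_estimate R u v S (slope_set u v e k) a' b' c' d' e N t su sv
  (@badset_closed R u v) (measurable_slope_set k su sv (ltW e0)) (@subIsetl _ _ _)
  ab' cd' (ltW e0) (le_trans e1 N1) wt ht off.
have {}est := est ltac:(move=> x y xP yP Sxy; apply: cross_sub (SN _ _ (sub _ xP) (sub' _ yP) Sxy) => //).
have {}est := est ltac:(move=> x y xP yP [_ [pq _ C]]; exists (ratr pq.1), (ratr pq.2);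
   by apply: cross_sub C).
have {}est := est Sne.
apply: le_trans est _; rewrite lerD2l.
have -> : (b' - a' + (d' - c')) / (d' - c') + (b' - a' + (d' - c')) / (b' - a') = K.
  by rewrite /K wE hE; field; rewrite !subr_eq0 !gt_eqF.
rewrite (_ : cell a' b' c' d' `\` _ = cell a' b' c' d' `&` V) //.
apply/seteqP; split => z [cz]; last by move=> [].
move=> nE; split => //; split => //.
have [x [y [xP yP Sxy]]] := Sne; exists (x, y) => //.
case: z cz {nE} => x' y' [/=]; rewrite !in_itv /= => /andP[ax xb] /andP[cy yd].
split; rewrite /ball /=.
  by apply: lt_le_trans tk; apply: le_lt_trans wt; apply: dist_itv; rewrite // (ltW ax).
by apply: lt_le_trans tk; apply: le_lt_trans ht; apply: dist_itv; rewrite // (ltW cy).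
Qed.

(** The sets of points at which all difference quotients at scale [1 / (n + 1)] are at
most [n + 1] are closed and cover the region. If there were bad points, by
Baire's theorem one of these sets would contain a portion of the bad set, and
[oint0_level] would show that no point of this portion is bad. *)
Theorem looman_menchoff u v a b c d : sep_cont u -> sep_cont v ->
  (forall x y, a < x < b -> c < y < d -> CRat u v x y) ->
  forall x y, a < x < b -> c < y < d -> loc_oint0 u v x y.
Proof.
move=> su sv CR x0 y0 x0P y0P; apply: contrapT => S0.
pose S := badset u v.
pose O : set (R * R) := [set z | a < z.1 < b /\ c < z.2 < d].
have oO : open O.
  rewrite (_ : O = fst @^-1` `]a, b[%classic `&` snd @^-1` `]c, d[%classic).
    apply: openI; apply: open_comp => // z _; [exact: cvg_fst|exact: cvg_snd].
  by apply/seteqP; split => z; rewrite /O /= !in_itv.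
pose A n : set (R * R) := [set z | cross u v 0 0 n.+1%:R n.+1%:R^-1 z.1 z.2].
have cA n : closed (A n) by exact: (@cross_closed R u v 0 0 n.+1%:R n.+1%:R^-1).
have SA : S `&` O `<=` \bigcup_n A n.
  move=> [x y] [_ [/= xP yP]]; have [p [q H]] := CR x y xP yP.
  have [r r0 C] := H 1 ltr01.
  (* Slopes [p], [q] with error [1] bound the difference quotients by [1 + |p| + |q|]. *)
  have C' : cross u v 0 0 (1 + (`|p| + `|q|)) r x y.
    by apply: cross_pert C _ _; rewrite subr0 ?lerDl ?lerDr.
  pose t := Num.min r (1 + (`|p| + `|q|))^-1.
  have pq0 : 0 < 1 + (`|p| + `|q|) by rewrite ltr_wpDr // addr_ge0.
  have t0 : 0 < t by rewrite lt_min r0 invr_gt0.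
  have [k] := small_inv t0; rewrite lt_min => /andP[kr kp].
  exists k => //; apply: cross_sub C'; last exact: ltW.
  by rewrite -lef_pV2 ?posrE // ltW.
have [n [[w1 w2] [r [r0 Sw bO bA]]]] :=
  baire_closed (@badset_closed R u v) oO cA (S0 : S (x0, y0)) (conj x0P y0P) SA.
apply: Sw; rewrite /=.
have n0 : (0 : R) < n.+1%:R^-1 by rewrite invr_gt0.
pose t := Num.min r (n.+1%:R^-1 / 2).
have [tr tn] : t <= r /\ t <= n.+1%:R^-1 / 2 by rewrite !ge_min !lexx orbT.
have tt : t + t <= n.+1%:R^-1 by rewrite (splitr n.+1%:R^-1) lerD.
exists t; first by rewrite lt_min r0 divr_gt0.
move=> a' b' c' d' /= h1 h2 h3 h4 h5 h6.
have inb x y : a' <= x <= b' -> c' <= y <= d' -> ball (w1, w2) r (x, y).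
  move=> /andP[k1 k2] /andP[k3 k4]; split; rewrite /ball /= ltr_norml.
    by apply/andP; split; lra.
  by apply/andP; split; lra.
apply: (@oint0_level u v n.+1%:R n.+1%:R^-1) => //.
- by rewrite ler1n.
- by apply: lt_le_trans tt; clear -h1 h3; lra.
- by apply: lt_le_trans tt; clear -h4 h6; lra.
- by move=> x y xP yP; have [] := bO _ (inb x y xP yP); exact: CR.
- by move=> x y xP yP Sxy; exact: (bA (x, y) (conj Sxy (inb x y xP yP))).
Qed.

End vanishing.

(** * Primitives of separately continuous functions *)

Section primitive.
Variable R : realType.
Implicit Types (u v : R -> R -> R) (a b c d e x y M N p q r t : R).

Lemma derive_eps (f : R -> R) x l : is_derive x (1 : R) f l ->
  forall e, 0 < e -> exists2 r, 0 < r &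
    forall h, `|h| < r -> `|f (x + h) - f x - l * h| <= e * `|h|.
Proof.
move=> [df <-] e e0.
have /(@cvgrPdist_lt _ R^o) /(_ e e0) := df.
rewrite /derive /at_right /dnbhs /within /=.
move=> /nbhs_ballP[r /= r0 H]; exists r => // h hr.
have [->|h0] := eqVneq h 0; first by rewrite addr0 subrr mulr0 subrr normr0 mulr0.
have bh : ball 0 r h by rewrite /ball /= sub0r normrN.
have := H h bh h0; rewrite /derive /= => {}H.
rewrite -ler_pdivrMr ?normr_gt0 // -normfV -normrM mulrDl mulrBl mulNr.
rewrite mulfK // distrC; apply: le_trans (ltW H); rewrite le_eqVlt; apply/orP; left.
apply/eqP; congr `|_ - _|.
by rewrite /GRing.scale /= mulr1 [h + x]addrC [RHS]mulrC mulrBl.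
Qed.

Lemma derive_eps_cont (f : R -> R) x l :
  (forall e, 0 < e -> exists2 r, 0 < r &
    forall h, `|h| < r -> `|f (x + h) - f x - l * h| <= e * `|h|) ->
  {for x, continuous f}.
Proof.
move=> H; apply/(@cvgrPdist_lt _ R^o) => t t0.
have [r r0 rH] := H 1 ltr01.
have l0 : 0 < 1 + `|l| by rewrite ltr_wpDr.
apply/nbhs_ballP; exists (Num.min r (t / (1 + `|l|))) => /=.
  by rewrite lt_min r0 divr_gt0.
move=> y; rewrite /ball /= lt_min distrC => /andP[yr yt].
have := rH (y - x) yr; rewrite [x + _]addrC subrK => k.
rewrite distrC -[f y - f x](subrK (l * (y - x))).
apply: le_lt_trans (ler_normD _ _) _.
apply: (@le_lt_trans _ _ ((1 + `|l|) * `|y - x|)).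
  by rewrite mulrDl lerD // normrM.
by rewrite mulrC -ltr_pdivlMr.
Qed.

Lemma CRat_cont u v x y : CRat u v x y ->
  [/\ {for x, continuous (u ^~ y)}, {for y, continuous (u x)},
      {for x, continuous (v ^~ y)} & {for y, continuous (v x)}].
Proof.
move=> [p [q H]]; split.
- apply: (@derive_eps_cont _ _ p) => e /H[r r0 C]; exists r => // h /C[].
  by [].
- apply: (@derive_eps_cont _ _ (- q)) => e /H[r r0 C]; exists r => // h /C[_ _ k _].
  by rewrite mulNr opprK.
- by apply: (@derive_eps_cont _ _ q) => e /H[r r0 C]; exists r => // h /C[].
- by apply: (@derive_eps_cont _ _ p) => e /H[r r0 C]; exists r => // h /C[].
Qed.

(** Composition with the projections onto compact intervals turns functions on an open
rectangle into functions on the whole plane, bounded and continuous in each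
variable, without changing them near a smaller rectangle. *)
Definition clamp a b x := Num.max a (Num.min b x).

Lemma clamp_in a b x : a <= b -> a <= clamp a b x <= b.
Proof. by move=> ab; rewrite /clamp le_max lexx ge_max ab ge_min lexx. Qed.

Lemma clamp_id a b x : a <= x <= b -> clamp a b x = x.
Proof.
by move=> /andP[ax xb]; rewrite /clamp min_r // max_r.
Qed.

Lemma clamp_cont a b : continuous (clamp a b).
Proof.
move=> x; apply: (@continuous_max R R (fun=> a) (fun x => Num.min b x)).
  exact: cvg_cst.
by apply: (@continuous_min R R (fun=> b) id); [exact: cvg_cst|exact: cvg_id].
Qed.

Definition clamp2 a b c d u : R -> R -> R := fun x y => u (clamp a b x) (clamp c d y).

Lemma sep_cont_clamp2 a b c d u M : a <= b -> c <= d ->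
  (forall x y, a <= x <= b -> c <= y <= d ->
     {for x, continuous (u ^~ y)} /\ {for y, continuous (u x)}) ->
  (forall x y, a <= x <= b -> c <= y <= d -> `|u x y| <= M) ->
  sep_cont (clamp2 a b c d u).
Proof.
move=> ab cd cu uM; split.
- move=> y x; have [c1 _] := cu _ _ (clamp_in x ab) (clamp_in y cd).
  exact: (@continuous_comp _ _ _ (clamp a b) (u ^~ (clamp c d y)) x (@clamp_cont a b x) c1).
- move=> x y; have [_ c1] := cu _ _ (clamp_in x ab) (clamp_in y cd).
  exact: (@continuous_comp _ _ _ (clamp c d) (u (clamp a b x)) y (@clamp_cont c d y) c1).
- by exists M => x y; apply: uM; exact: clamp_in.
Qed.

Lemma CRat_eq u v u' v' x y r : 0 < r ->
  (forall x' y', `|x' - x| < r -> `|y' - y| < r -> u x' y' = u' x' y' /\ v x' y' = v' x' y') ->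
  CRat u v x y -> CRat u' v' x y.
Proof.
move=> r0 E [p [q H]]; exists p, q => e /H[s s0 C].
exists (Num.min r s); first by rewrite lt_min r0.
move=> h; rewrite lt_min => /andP[hr /C]; rewrite -!(E _ _ _ _).1 -?(E _ _ _ _).2 //;
  by rewrite ?subrr ?normr0 // addrC addKr.
Qed.

(** The primitive is the integral of [u dx - v dy] along a path made of a vertical
and a horizontal segment. The other order of the segments gives the same value,
because the integral around rectangles vanishes; one order gives the derivative in [x],
the other one the derivative in [y]. *)
Lemma real_primitive u v a b c d a' b' c' d' M :
  a < a' -> a' < b' -> b' < b -> c < c' -> c' < d' -> d' < d ->
  (forall x y, a < x < b -> c < y < d -> CRat u v x y) ->
  (forall x y, a < x < b -> c < y < d -> `|u x y| <= M /\ `|v x y| <= M) ->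
  exists P : R -> R -> R, forall x y, a' < x < b' -> c' < y < d' ->
    [/\ `|P x y| <= M * ((b' - a') + (d' - c')),
     forall e, 0 < e -> exists2 r, 0 < r & forall h, `|h| < r ->
       `|P (x + h) y - P x y - u x y * h| <= e * `|h| &
     forall e, 0 < e -> exists2 r, 0 < r & forall h, `|h| < r ->
       `|P x (y + h) - P x y + v x y * h| <= e * `|h| ].
Proof.
move=> aa ab bb cc cd dd CR uvM.
(* An intermediate rectangle on which the functions are clamped. *)
pose a1 := (a + a') / 2; pose b1 := (b + b') / 2.
pose c1 := (c + c') / 2; pose d1 := (d + d') / 2.
have [? ?] : a < a1 /\ a1 < a' by rewrite /a1; lra.
have [? ?] : b' < b1 /\ b1 < b by rewrite /b1; lra.
have [? ?] : c < c1 /\ c1 < c' by rewrite /c1; lra.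
have [? ?] : d' < d1 /\ d1 < d by rewrite /d1; lra.
clearbody a1 b1 c1 d1.
have inx x : a1 <= x <= b1 -> a < x < b by move=> /andP[? ?]; apply/andP; split; lra.
have iny y : c1 <= y <= d1 -> c < y < d by move=> /andP[? ?]; apply/andP; split; lra.
have ab1 : a1 <= b1 by lra.
have cd1 : c1 <= d1 by lra.
pose U := clamp2 a1 b1 c1 d1 u; pose V := clamp2 a1 b1 c1 d1 v.
have sU : sep_cont U.
  apply: (@sep_cont_clamp2 _ _ _ _ _ M) => // x y /inx xP /iny yP.
    by have [] := CRat_cont (CR x y xP yP).
  by have [] := uvM x y xP yP.
have sV : sep_cont V.
  apply: (@sep_cont_clamp2 _ _ _ _ _ M) => // x y /inx xP /iny yP.
    by have [] := CRat_cont (CR x y xP yP).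
  by have [] := uvM x y xP yP.
have UE x y : a1 <= x <= b1 -> c1 <= y <= d1 -> U x y = u x y.
  by move=> xP yP; rewrite /U /clamp2 !clamp_id.
have VE x y : a1 <= x <= b1 -> c1 <= y <= d1 -> V x y = v x y.
  by move=> xP yP; rewrite /V /clamp2 !clamp_id.
have CRUV x y : a1 < x < b1 -> c1 < y < d1 -> CRat U V x y.
  move=> /andP[? ?] /andP[? ?].
  pose r := Num.min (Num.min (x - a1) (b1 - x)) (Num.min (y - c1) (d1 - y)).
  have r0 : 0 < r by rewrite !lt_min !subr_gt0; do ! (apply/andP; split).
  have [r1 r2 r3 r4] : [/\ r <= x - a1, r <= b1 - x, r <= y - c1 & r <= d1 - y].
    by rewrite !ge_min !lexx !orbT.
  apply: (@CRat_eq u v) (CR x y _ _); [exact: r0| |apply: inx|apply: iny].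
  - move=> x' y'; rewrite !ltr_norml => /andP[? ?] /andP[? ?].
    by rewrite UE ?VE //; apply/andP; split; lra.
  - by apply/andP; split; lra.
  - by apply/andP; split; lra.
have LJ := looman_menchoff sU sV CRUV.
have J0 x y : a' <= x <= b' -> c' <= y <= d' -> oint U V a' x c' y = 0.
  move=> /andP[? ?] /andP[? ?]; apply: oint0_compact => // x' y' /andP[? ?] /andP[? ?].
  by apply: LJ; apply/andP; split; lra.
have [U1 U2 _] := sU; have [V1 V2 _] := sV.
pose P x y := intoc (U ^~ y) a' x - intoc (V a') c' y.
have PE x y : a' <= x <= b' -> c' <= y <= d' -> P x y = intoc (U ^~ c') a' x - intoc (V x) c' y.
  by move=> xP yP; have := J0 x y xP yP; rewrite /oint /P => ?; lra.
have UM x y : a' <= x <= b' -> c' <= y <= d' -> `|U x y| <= M /\ `|V x y| <= M.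
  move=> /andP[? ?] /andP[? ?].
  have xP : a1 <= x <= b1 by apply/andP; split; lra.
  have yP : c1 <= y <= d1 by apply/andP; split; lra.
  by rewrite UE // VE //; apply: uvM; [exact: inx|exact: iny].
exists P => x y /andP[ax xb] /andP[cy yd].
have xP : a1 <= x <= b1 by apply/andP; split; lra.
have yP : c1 <= y <= d1 by apply/andP; split; lra.
have M0 : 0 <= M by have [+ _] := uvM _ _ (inx _ xP) (iny _ yP); apply: le_trans; exact: normr_ge0.
split.
- rewrite /P; apply: le_trans (ler_normB _ _) _; rewrite mulrDr lerD //.
    apply: (@le_trans _ _ (M * (x - a'))); last by rewrite ler_wpM2l //; lra.
    apply: intoc_le => //; first exact: ltW.
    by move=> x' /andP[? ?]; apply: (UM x' y _ _).1; apply/andP; split; lra.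
  apply: (@le_trans _ _ (M * (y - c'))); last by rewrite ler_wpM2l //; lra.
  apply: intoc_le => //; first exact: ltW.
  by move=> y' /andP[? ?]; apply: (UM a' y' _ _).2; apply/andP; split; lra.
- move=> e /(derive_eps (intoc_derive (U1 y) ax))[r r0 H]; exists r => // h /H.
  by rewrite UE // /P; congr (`|_| <= _); ring.
move=> e /(derive_eps (intoc_derive (V2 x) cy))[r r0 H].
pose s := Num.min r (Num.min (y - c') (d' - y)).
exists s; first by rewrite !lt_min r0 !subr_gt0 cy.
move=> h; rewrite !lt_min !ltr_norml => /andP[hr /andP[/andP[? ?] /andP[? ?]]].
have := H h; rewrite ltr_norml hr => /(_ isT).
rewrite !PE; [|by apply/andP; split; lra ..].
by rewrite VE // -normrN; congr (`|_| <= _); ring.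
Qed.

End primitive.

Local Open Scope complex_scope.

(** * Moduli and real-variable tools *)

Section modulus.
Variable R : realType.
Local Notation C := R[i].
Implicit Types (z w : C) (x y r : R).

(** The modulus as a real number; that of the algebraic hierarchy is a complex
number. *)
Definition nm z : R := Num.sqrt (complex.Re z ^+ 2 + complex.Im z ^+ 2).

Lemma nmE z : `|z| = (nm z)%:C. Proof. exact: normc_def. Qed.
Lemma nm_le z x : (`|z| <= x%:C) = (nm z <= x). Proof. by rewrite nmE lecR. Qed.
Lemma nm_lt z x : (`|z| < x%:C) = (nm z < x). Proof. by rewrite nmE ltcR. Qed.
Lemma nm_ge0 z : 0 <= nm z. Proof. exact: sqrtr_ge0. Qed.
Lemma nm0 : nm 0 = 0. Proof. by apply: complexI; rewrite -nmE normr0. Qed.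
Lemma nmM z w : nm (z * w) = nm z * nm w.
Proof. by apply: complexI; rewrite rmorphM /= -!nmE normrM. Qed.
Lemma nmV z : nm z^-1 = (nm z)^-1.
Proof. by apply: complexI; rewrite fmorphV /= -!nmE normfV. Qed.
Lemma nmX z n : nm (z ^+ n) = nm z ^+ n.
Proof. by apply: complexI; rewrite rmorphXn /= -!nmE normrX. Qed.
Lemma nmN z : nm (- z) = nm z.
Proof. by apply: complexI; rewrite -!nmE normrN. Qed.
Lemma nmC z w : nm (z - w) = nm (w - z). Proof. by rewrite -nmN opprB. Qed.
Lemma nmD z w : nm (z + w) <= nm z + nm w.
Proof. by rewrite -lecR rmorphD /= -!nmE; exact: ler_normD. Qed.
Lemma nmB z w : nm (z - w) <= nm z + nm w.
Proof. by rewrite -(nmN w) nmD. Qed.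
Lemma nm_tri z u w : nm (z - w) <= nm (z - u) + nm (u - w).
Proof. by rewrite (_ : z - w = (z - u) + (u - w)) ?nmD //; ring. Qed.
Lemma nm_sub z w : nm z - nm w <= nm (z - w).
Proof. by rewrite lerBlDr -{1}(subrK w z) nmD. Qed.
Lemma nm_eq0 z : (nm z == 0) = (z == 0).
Proof. by rewrite -(inj_eq (@complexI R)) -nmE normr_eq0. Qed.
Lemma nm_gt0 z : (0 < nm z) = (z != 0).
Proof. by rewrite lt_def nm_ge0 andbT nm_eq0. Qed.
Lemma nmR x : nm x%:C = `|x|.
Proof. by rewrite /nm /= expr0n addr0 sqrtr_sqr. Qed.
Lemma nmi : nm 'i = 1.
Proof. by rewrite /nm /= expr0n add0r expr1n sqrtr1. Qed.
Lemma nm_nat n : nm n%:R = n%:R.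
Proof. by rewrite -(rmorph_nat (real_complex R)) nmR normr_nat. Qed.
Lemma Re_le_nm z : `|complex.Re z| <= nm z.
Proof. by rewrite -sqrtr_sqr ler_sqrt ?addr_ge0 ?sqr_ge0 // lerDl sqr_ge0. Qed.
Lemma Im_le_nm z : `|complex.Im z| <= nm z.
Proof. by rewrite -sqrtr_sqr ler_sqrt ?addr_ge0 ?sqr_ge0 // lerDr sqr_ge0. Qed.
Lemma nm_le_ReIm z : nm z <= `|complex.Re z| + `|complex.Im z|.
Proof.
have h : 0 <= `|complex.Re z| + `|complex.Im z| by rewrite addr_ge0.
rewrite -[leRHS]ger0_norm // -sqrtr_sqr ler_sqrt ?sqr_ge0 // sqrrD.
by rewrite !real_normK ?num_real // addrAC lerDl mulrn_wge0 // mulr_ge0.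
Qed.

Lemma nm_sum (I : Type) (s : seq I) (P : pred I) (F : I -> C) :
  nm (\sum_(i <- s | P i) F i) <= \sum_(i <- s | P i) nm (F i).
Proof.
elim/big_ind2: _ => [|z x w y zx wy|//]; first by rewrite nm0.
exact: le_trans (nmD _ _) (lerD zx wy).
Qed.

Lemma nm_small z : (forall e, 0 < e -> nm z <= e) -> z = 0.
Proof.
move=> H; apply/eqP; rewrite -nm_eq0 eq_le nm_ge0 andbT.
by apply/ler_addgt0Pr => e e0; rewrite add0r; exact: H.
Qed.

Lemma cauchy_lim (u : nat -> C) :
  (forall e, 0 < e -> exists N, forall n m, (N <= n)%N -> (N <= m)%N ->
     nm (u n - u m) <= e) ->
  exists l, forall e, 0 < e -> exists N, forall n, (N <= n)%N -> nm (u n - l) <= e.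
Proof.
move=> H.
have lim (pr : C -> R) : (forall z w, `|pr z - pr w| <= nm (z - w)) ->
    exists l, forall e, 0 < e -> exists N, forall n, (N <= n)%N -> `|pr (u n) - l| <= e.
  move=> Hpr.
  have : cauchy_ex ((pr \o u) @ \oo).
    move=> e e0; have e2 : 0 < e / 2 by rewrite divr_gt0.
    have [N HN] := H _ e2; exists (pr (u N)); exists N => // n /= Nn.
    rewrite /ball /=; apply: le_lt_trans (Hpr _ _) _.
    by apply: le_lt_trans (HN _ _ (leqnn N) Nn) _; lra.
  move=> /cauchy_exP /cauchy_cvgP /cvg_ex [l /= /cvgrPdist_le lP].
  exists l => e /lP [N _ HN]; exists N => n Nn.
  by rewrite distrC; exact: HN.
have [a aP] := lim (@complex.Re R) ltac:(move=> z w; rewrite -raddfB; exact: Re_le_nm).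
have [b bP] := lim (@complex.Im R) ltac:(move=> z w; rewrite -raddfB; exact: Im_le_nm).
exists (a +i* b) => e e0; have e2 : 0 < e / 2 by rewrite divr_gt0.
have [N1 H1] := aP _ e2; have [N2 H2] := bP _ e2.
exists (maxn N1 N2) => n; rewrite geq_max => /andP[n1 n2].
apply: le_trans (nm_le_ReIm _) _; rewrite (splitr e) !raddfB /=.
by rewrite lerD ?H1 ?H2.
Qed.

(** The supremum of the points up to which the bound with [M + e] holds must be
[b]. *)
Lemma mean_value (k : R -> C) a b M : a <= b ->
  (forall s, a <= s <= b -> forall e, 0 < e -> exists2 r, 0 < r &
     forall s', a <= s' <= b -> `|s' - s| < r -> nm (k s' - k s) <= (M + e) * `|s' - s|) ->
  nm (k b - k a) <= M * (b - a).
Proof.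
move=> ab H.
suff main e : 0 < e -> nm (k b - k a) <= (M + e) * (b - a).
  apply/ler_addgt0Pr => t t0.
  have ab1 : 0 < b - a + 1 by lra.
  have := main (t / (b - a + 1)) (divr_gt0 t0 ab1).
  rewrite mulrDl => /le_trans; apply; rewrite lerD2l mulrAC -mulrA ler_piMr ?(ltW t0) //.
  by rewrite ler_pdivrMr //; lra.
move=> e0.
pose A := [set x | a <= x <= b /\ nm (k x - k a) <= (M + e) * (x - a)].
have Aa : A a by rewrite /A /= lexx ab !subrr nm0 mulr0.
have Ab : ubound A b by move=> x [/andP[]].
have sA : has_sup A by split; [exists a|exists b].
pose X := sup A.
have aX : a <= X by apply: ub_le_sup => //; exists b.
have Xb : X <= b by apply: ge_sup => //; exists a.
have XP : a <= X <= b by rewrite aX.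
have [r r0 rH] := H X XP e e0.
have AX : nm (k X - k a) <= (M + e) * (X - a).
  have [x [xP kx] xX] := sup_adherent r0 sA.
  have xX' : x <= X by apply: ub_le_sup => //; exists b.
  apply: le_trans (nm_tri _ (k x) _) _.
  have xr : `|x - X| < r by rewrite distrC ger0_norm; rewrite -/X in xX; lra.
  have := rH x xP xr; rewrite nmC distrC ger0_norm ?subr_ge0 // => k1.
  by apply: le_trans (lerD k1 kx) _; rewrite -mulrDr addrA subrK.
have [bX|bX] := leP b X; first by have -> : b = X by apply/eqP; rewrite eq_le bX.
exfalso; pose Y := Num.min b (X + r / 2).
have [Yb Yr] : Y <= b /\ Y <= X + r / 2 by rewrite !ge_min !lexx orbT.
have XY : X < Y by rewrite lt_min bX; lra.
have YP : a <= Y <= b by rewrite Yb (le_trans aX) // ltW.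
have Yr' : `|Y - X| < r by rewrite gtr0_norm; lra.
suff : A Y by move=> /(ub_le_sup (ex_intro _ b Ab)); rewrite leNgt XY.
split=> //; apply: le_trans (nm_tri _ (k X) _) _.
have := rH Y YP Yr'; rewrite gtr0_norm ?subr_gt0 // => k1.
by apply: le_trans (lerD k1 AX) _; rewrite -mulrDr addrA subrK.
Qed.

(** A property that holds locally, with radii that depend on the point, holds at a
uniform scale around some centre near each point. *)
Lemma lebesgue_number (Q : R -> R -> Prop) :
  (forall t, 0 <= t <= 1 -> exists2 r, 0 < r & Q t r) ->
  exists2 d, 0 < d & forall t, 0 <= t <= 1 -> exists t0 r0,
    [/\ 0 <= t0 <= 1, Q t0 r0 & forall s, `|s - t| < d -> `|s - t0| < r0].
Proof.
move=> H.
pose P (d : R) (t : R) := 0 <= t <= 1 -> exists t0 r0,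
    [/\ 0 <= t0 <= 1, Q t0 r0 & forall s, `|s - t| < d -> `|s - t0| < r0].
have /compact_near_coveringP /(_ R (0^'+) P _) := @segment_compact R 0 1.
case.
  move=> t0 /=; rewrite in_itv /= => t0P; have [r r0 Qr] := H t0 t0P.
  have r2 : 0 < r / 2 by rewrite divr_gt0.
  exists (ball t0 (r / 2), [set d | 0 < d < r / 2]); first split.
  - exact: nbhsx_ballx.
  - by near=> d => /=; apply/andP; split; near: d; [exact: nbhs_right_gt|exact: nbhs_right_lt].
  move=> [t d] [/=]; rewrite /ball /= distrC => bt /andP[d0 dr] tP.
  exists t0, r; split => // s sd; apply: le_lt_trans (ler_distD t _ _) _; lra.
move=> d0 /= d00 dP; exists (d0 / 2); first by rewrite divr_gt0.
move=> t tP; apply: (dP (d0 / 2)) => //=.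
- by rewrite /ball /= sub0r normrN gtr0_norm; lra.
- by rewrite divr_gt0.
Unshelve. all: by end_near. Qed.

End modulus.

(** * Complex primitives *)

Section complex_primitive.
Variable R : realType.
Local Notation C := R[i].
Implicit Types (z w c : C) (x y r M : R) (f F G H : C -> C).

(** The complex difference quotients converge along the real and the imaginary
axis; this is all that the hypotheses of the theorem give. *)
Definition axdiff f c z := forall e : R, 0 < e -> exists2 r : R, 0 < r &
  forall h : R, `|h| < r ->
    nm (f (z + h%:C) - f z - c * h%:C) <= e * `|h| /\
    nm (f (z + 'i * h%:C) - f z - c * ('i * h%:C)) <= e * `|h|.

Definition cdiff f c z := forall e : R, 0 < e -> exists2 r : R, 0 < r &
  forall w, nm (w - z) < r -> nm (f w - f z - c * (w - z)) <= e * nm (w - z).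

(** Strict differentiability: neither end of the increment is the point [z]. It is what
the fundamental theorem of calculus along a curve that is merely rectifiable
needs, and second primitives have it. *)
Definition sdiff f c z := forall e : R, 0 < e -> exists2 r : R, 0 < r &
  forall w w', nm (w - z) < r -> nm (w' - z) < r ->
    nm (f w - f w' - c * (w - w')) <= e * nm (w - w').

Lemma sdiff_cdiff f c z : sdiff f c z -> cdiff f c z.
Proof.
move=> H e e0; have [r r0 rH] := H e e0; exists r => // w wr.
by apply: rH => //; rewrite subrr nm0.
Qed.

Lemma cdiff_axdiff f c z : cdiff f c z -> axdiff f c z.
Proof.
move=> H e e0; have [r r0 rH] := H e e0; exists r => // h hr.
have h1 := rH (z + h%:C); have h2 := rH (z + 'i * h%:C).
by split; [move: h1|move: h2]; rewrite [z + _]addrC addrK ?nmM ?nmi ?mul1r nmR; exact.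
Qed.

Definition box z r : set C := [set w | `|complex.Re w - complex.Re z| < r /\
  `|complex.Im w - complex.Im z| < r].

Lemma nm_box z w r : nm (w - z) < r -> box z r w.
Proof.
by move=> h; split; apply: le_lt_trans h; rewrite -raddfB; [exact: Re_le_nm|exact: Im_le_nm].
Qed.

Lemma axdiff_CRat f c z : axdiff f c z ->
  CRat (fun x y => complex.Re (f (x +i* y))) (fun x y => complex.Im (f (x +i* y)))
    (complex.Re z) (complex.Im z).
Proof.
case: z => x y /= H; case: c H => p q H; exists p, q => e /H[r r0 rH].
exists r => // h /rH[].
have -> : x +i* y + h%:C = (x + h) +i* y by simpc.
have -> : x +i* y + 'i * h%:C = x +i* (y + h).
  by simpc.
move: (f _) (f _) (f _) => [f1 f2] [g1 g2] [k1 k2] E1 E2.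
have {}E1 := conj (le_trans (Re_le_nm _) E1) (le_trans (Im_le_nm _) E1).
have {}E2 := conj (le_trans (Re_le_nm _) E2) (le_trans (Im_le_nm _) E2).
move: E1 E2; simpc => /= -[E1 E2] [E3 E4]; split => //=.
Qed.

(** The real and the imaginary part of the primitive are real primitives for the pairs
[(u, v)] and [(v, - u)]. *)
Lemma axdiff_box_primitive f z r M : 0 < r -> (forall w, box z r w -> exists c, axdiff f c w) ->
  (forall w, box z r w -> nm (f w) <= M) ->
  exists G, forall w, box z (r / 2) w -> axdiff G (f w) w /\ nm (G w) <= 4 * M * r.
Proof.
case: z => x0 y0 r0 fcr fM.
pose u x y := complex.Re (f (x +i* y)); pose v x y := complex.Im (f (x +i* y)).
pose v' x y := - u x y.
have inb x y : x0 - r < x < x0 + r -> y0 - r < y < y0 + r -> box (x0 +i* y0) r (x +i* y).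
  move=> /andP[? ?] /andP[? ?]; rewrite /box /= !ltr_norml.
  by split; apply/andP; split; lra.
have CRuv x y : x0 - r < x < x0 + r -> y0 - r < y < y0 + r -> CRat u v x y.
  by move=> xP yP; have [c /axdiff_CRat] := fcr _ (inb x y xP yP).
have CRvu x y : x0 - r < x < x0 + r -> y0 - r < y < y0 + r -> CRat v v' x y.
  move=> xP yP; have [p [q H]] := CRuv x y xP yP.
  exists q, (- p) => e /H[s s0 C]; exists s => // h /C[h1 h2 h3 h4].
  split; rewrite // /v'.
  - by rewrite -normrN; move: h1; congr (`|_| <= _); ring.
  - by move: h4; congr (`|_| <= _); ring.
  - by rewrite -normrN; move: h3; congr (`|_| <= _); ring.
have uM x y : x0 - r < x < x0 + r -> y0 - r < y < y0 + r -> `|u x y| <= M /\ `|v x y| <= M.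
  move=> xP yP; have := fM _ (inb x y xP yP) => h.
  by split; apply: le_trans h; [exact: Re_le_nm|exact: Im_le_nm].
have vM x y : x0 - r < x < x0 + r -> y0 - r < y < y0 + r -> `|v x y| <= M /\ `|v' x y| <= M.
  by move=> xP yP; rewrite /v' normrN; have [] := uM x y xP yP.
have l1 (t : R) : t - r < t - r / 2 by lra.
have l2 (t : R) : t - r / 2 < t + r / 2 by lra.
have l3 (t : R) : t + r / 2 < t + r by lra.
have [P PP] := real_primitive (l1 x0) (l2 x0) (l3 x0) (l1 y0) (l2 y0) (l3 y0) CRuv uM.
have [Q QP] := real_primitive (l1 x0) (l2 x0) (l3 x0) (l1 y0) (l2 y0) (l3 y0) CRvu vM.
exists (fun w => P (complex.Re w) (complex.Im w) +i* Q (complex.Re w) (complex.Im w)).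
move=> [x y] [/= bx by_].
have xP : x0 - r / 2 < x < x0 + r / 2.
  by move: bx; rewrite ltr_norml => /andP[? ?]; apply/andP; split; lra.
have yP : y0 - r / 2 < y < y0 + r / 2.
  by move: by_; rewrite ltr_norml => /andP[? ?]; apply/andP; split; lra.
have [Pb P1 P2] := PP x y xP yP; have [Qb Q1 Q2] := QP x y xP yP.
split; last first.
  apply: le_trans (nm_le_ReIm _) _; apply: le_trans (lerD Pb Qb) _.
  by rewrite le_eqVlt; apply/orP; left; apply/eqP => /=; field.
move=> e e0; have e2 : 0 < e / 2 by rewrite divr_gt0.
have [r1 r10 H1] := P1 _ e2; have [r2 r20 H2] := P2 _ e2.
have [r3 r30 H3] := Q1 _ e2; have [r4 r40 H4] := Q2 _ e2.
exists (Num.min (Num.min r1 r2) (Num.min r3 r4)); first by rewrite !lt_min r10 r20 r30.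
move=> h; rewrite !lt_min => /andP[/andP[/H1 k1 /H2 k2] /andP[/H3 k3 /H4 k4]].
have Ef : f (x +i* y) = u x y +i* v x y by rewrite /u /v; case: (f _).
have -> : x +i* y + h%:C = (x + h) +i* y by simpc.
have -> : x +i* y + 'i * h%:C = x +i* (y + h) by simpc.
rewrite Ef; split; apply: le_trans (nm_le_ReIm _) _; rewrite (splitr e) mulrDl; simpc => /=.
  by rewrite lerD.
by rewrite /v' mulNr in k4; rewrite lerD // ?mulNr ?opprK.
Qed.

(** The mean value inequality along the two segments of a path parallel to the
axes; the sum of their lengths is at most twice the distance of the ends. *)
Lemma axdiff_box_lip f g c z r e : (forall w, box z r w -> axdiff f (g w) w) ->
  (forall w, box z r w -> nm (g w - c) <= e) ->
  forall w w', box z r w -> box z r w' -> nm (f w' - f w - c * (w' - w)) <= 2 * e * nm (w' - w).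
Proof.
move=> fg ge w w' wb w'b.
have conv (p q s t t0 : R) : `|p - t| < t0 -> `|q - t| < t0 -> p <= s <= q -> `|s - t| < t0.
  rewrite !ltr_norml => /andP[? ?] /andP[? ?] /andP[? ?]; apply/andP; split; lra.
have hor x x' y : x <= x' -> box z r (x +i* y) -> box z r (x' +i* y) ->
    nm (f (x' +i* y) - f (x +i* y) - c * (x' - x)%:C) <= e * `|x' - x|.
  move=> xx [b1 b2] [b3 _].
  have -> : f (x' +i* y) - f (x +i* y) - c * (x' - x)%:C =
    (f (x' +i* y) - c * x'%:C) - (f (x +i* y) - c * x%:C) by rewrite rmorphB /=; ring.
  rewrite ger0_norm ?subr_ge0 //.
  apply: (@mean_value _ (fun s => f (s +i* y) - c * s%:C)) => // s sP t t0.
  have bs : box z r (s +i* y) by split => //=; exact: conv b1 b3 sP.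
  have [q q0 qH] := fg _ bs t t0; exists q => // s' _ /qH[h1 _].
  have Es : s +i* y + (s' - s)%:C = s' +i* y by simpc; rewrite addrC subrK.
  rewrite Es in h1.
  have -> : f (s' +i* y) - c * s'%:C - (f (s +i* y) - c * s%:C) =
    (f (s' +i* y) - f (s +i* y) - g (s +i* y) * (s' - s)%:C)
    + (g (s +i* y) - c) * (s' - s)%:C by rewrite rmorphB /=; ring.
  apply: le_trans (nmD _ _) _; rewrite [(e + t) * _]mulrDl addrC lerD //.
  by rewrite nmM nmR ler_wpM2r // ge.
have ver x y y' : y <= y' -> box z r (x +i* y) -> box z r (x +i* y') ->
    nm (f (x +i* y') - f (x +i* y) - c * ('i * (y' - y)%:C)) <= e * `|y' - y|.
  move=> xx [b1 b2] [_ b3].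
  have -> : f (x +i* y') - f (x +i* y) - c * ('i * (y' - y)%:C) =
    (f (x +i* y') - c * ('i * y'%:C)) - (f (x +i* y) - c * ('i * y%:C)) by rewrite rmorphB /=; ring.
  rewrite ger0_norm ?subr_ge0 //.
  apply: (@mean_value _ (fun s => f (x +i* s) - c * ('i * s%:C))) => // s sP t t0.
  have bs : box z r (x +i* s) by split => //=; exact: conv b2 b3 sP.
  have [q q0 qH] := fg _ bs t t0; exists q => // s' _ /qH[_ h1].
  have Es : x +i* s + 'i * (s' - s)%:C = x +i* s' by simpc; rewrite addrC subrK.
  rewrite Es in h1.
  have -> : f (x +i* s') - c * ('i * s'%:C) - (f (x +i* s) - c * ('i * s%:C)) =
    (f (x +i* s') - f (x +i* s) - g (x +i* s) * ('i * (s' - s)%:C))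
    + (g (x +i* s) - c) * ('i * (s' - s)%:C) by rewrite rmorphB /=; ring.
  apply: le_trans (nmD _ _) _; rewrite [(e + t) * _]mulrDl addrC lerD //.
  by rewrite !nmM nmi mul1r nmR ler_wpM2r // ge.
case: w wb => x y wb; case: w' w'b => x' y' w'b.
have mb : box z r (x' +i* y) by case: wb => _ ?; case: w'b.
have h1 : nm (f (x' +i* y) - f (x +i* y) - c * (x' - x)%:C) <= e * `|x' - x|.
  have [xx|xx] := leP x x'; first exact: hor.
  have := hor x' x y (ltW xx) mb wb; rewrite -nmN distrC; congr (nm _ <= _).
  by rewrite !rmorphB /=; ring.
have h2 : nm (f (x' +i* y') - f (x' +i* y) - c * ('i * (y' - y)%:C)) <= e * `|y' - y|.
  have [xx|xx] := leP y y'; first exact: ver.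
  have := ver x' y' y (ltW xx) w'b mb; rewrite -nmN distrC; congr (nm _ <= _).
  by rewrite !rmorphB /=; ring.
have e0 : 0 <= e by apply: le_trans (ge _ wb); exact: nm_ge0.
have Ed : x' +i* y' - x +i* y = (x' - x)%:C + 'i * (y' - y)%:C by simpc.
rewrite Ed.
have -> : f (x' +i* y') - f (x +i* y) - c * ((x' - x)%:C + 'i * (y' - y)%:C) =
  (f (x' +i* y) - f (x +i* y) - c * (x' - x)%:C) +
  (f (x' +i* y') - f (x' +i* y) - c * ('i * (y' - y)%:C)) by ring.
apply: le_trans (nmD _ _) _; apply: le_trans (lerD h1 h2) _.
rewrite -Ed.
have k1 := Re_le_nm (x' +i* y' - x +i* y); have k2 := Im_le_nm (x' +i* y' - x +i* y).
move: k1 k2; rewrite !raddfB /= => k1 k2; move: (nm _) k1 k2 => D k1 k2.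
have -> : 2 * e * D = e * (D + D) by ring.
by rewrite -mulrDr ler_wpM2l // lerD.
Qed.

(** The first primitive is Lipschitz because [f] is bounded, so the
second one has a continuous derivative. *)
Lemma axdiff_box_second_primitive f z r M : 0 < r ->
  (forall w, box z r w -> exists c, axdiff f c w) ->
  (forall w, box z r w -> nm (f w) <= M) ->
  exists G H, forall w, box z (r / 4) w -> axdiff G (f w) w /\ sdiff H (G w) w.
Proof.
move=> r0 fcr fM; have r2 : 0 < r / 2 by rewrite divr_gt0.
have [G GP] := axdiff_box_primitive r0 fcr fM.
have [||H HP] := @axdiff_box_primitive G z (r / 2) (4 * M * r) r2.
- by move=> w wb; exists (f w); have [] := GP w wb.
- by move=> w wb; have [] := GP w wb.
have r4 : r / 2 / 2 = r / 4 by field.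
rewrite r4 in HP.
exists G, H => w wb.
have sub w' : box z (r / 4) w' -> box z (r / 2) w'.
  by move=> [b1 b2]; split; [apply: lt_trans b1 _ | apply: lt_trans b2 _]; lra.
have subr w' : box z (r / 4) w' -> box z r w'.
  by move=> [b1 b2]; split; [apply: lt_trans b1 _ | apply: lt_trans b2 _]; lra.
split; first by have [] := GP w (sub _ wb).
have M0 : 0 <= M by apply: le_trans (fM _ (subr _ wb)); exact: nm_ge0.
move=> e e0.
pose q := e / (8 * (M + 1)).
have q0 : 0 < q by rewrite divr_gt0 // mulr_gt0 // ltr_wpDl // mulr_ge0.
pose s := Num.min q (Num.min (r / 4 - `|complex.Re w - complex.Re z|)
                        (r / 4 - `|complex.Im w - complex.Im z|)).
have [wb1 wb2] := wb.
have s0 : 0 < s by rewrite !lt_min q0 !subr_gt0 wb1.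
have [sq s1 s2] : [/\ s <= q, s <= r / 4 - `|complex.Re w - complex.Re z| &
    s <= r / 4 - `|complex.Im w - complex.Im z|] by rewrite !ge_min !lexx !orbT.
have bsub w' : box w s w' -> box z (r / 4) w'.
  move=> [b1 b2]; split.
    by apply: le_lt_trans (ler_distD (complex.Re w) _ _) _; lra.
  by apply: le_lt_trans (ler_distD (complex.Im w) _ _) _; lra.
have HP' w' : box w s w' -> axdiff H (G w') w' by move=> /bsub /HP[].
have GL w' : box w s w' -> nm (G w' - G w) <= e / 2.
  move=> w'b.
  have := @axdiff_box_lip G f 0 z (r / 2) M (fun w wb => (GP w wb).1) _ w w' (sub _ wb)
    (sub _ (bsub _ w'b)).
  rewrite mul0r subr0 => /(_ _) k; apply: le_trans (k _) _.
    move=> w1 [b1 b2]; rewrite subr0; apply: fM.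
    by split; [apply: lt_trans b1 _ | apply: lt_trans b2 _]; lra.
  apply: (@le_trans _ _ (2 * M * (2 * s))).
    rewrite ler_wpM2l ?mulr_ge0 //; apply: le_trans (nm_le_ReIm _) _.
    case: w'b => b1 b2; rewrite !raddfB /=; move: (ltW b1) (ltW b2) => *.
    by rewrite mulr2n mulrDl mul1r lerD.
  apply: (@le_trans _ _ (2 * M * (2 * q))); first by rewrite ler_wpM2l ?mulr_ge0 // ler_wpM2l.
  rewrite /q; have -> : 2 * M * (2 * (e / (8 * (M + 1)))) = e / 2 * (M / (M + 1)).
    by field; lra.
  by rewrite ler_piMr ?divr_ge0 ?(ltW e0) // ler_pdivrMr; lra.
have e2 : 2 * (e / 2) = e by field.
exists s => // w1 w2 b1 b2; rewrite -e2.
exact: axdiff_box_lip HP' GL _ _ (nm_box b2) (nm_box b1).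
Qed.

End complex_primitive.

(** * Riemann-Stieltjes sums *)

Section riemann_stieltjes.
Variable R : realType.
Local Notation C := R[i].
Variable gamma : R -> C.
Implicit Types (g h : R -> C) (a b d e x y L : R) (s p : seq R) (tau : nat -> R) (I : C).

(** Sums over a subdivision are defined by recursion on the list of its points, because
refinement and telescoping are proved by induction. *)
Fixpoint rsum g a s tau : C :=
  if s is x :: s' then (gamma x - gamma a) * g (tau 0%N) + rsum g x s' (tau \o S) else 0.

Fixpoint plen a s : R :=
  if s is x :: s' then nm (gamma x - gamma a) + plen x s' else 0.

Fixpoint tagged a s tau : Prop :=
  if s is x :: s' then a <= tau 0%N <= x /\ tagged x s' (tau \o S) else True.

Fixpoint mesh_lt d a s : Prop :=
  if s is x :: s' then x - a < d /\ mesh_lt d x s' else True.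

Lemma rsumE g a s tau :
  \sum_(0 <= k < size s) (gamma (nth 1 (a :: s) k.+1) - gamma (nth 1 (a :: s) k)) * g (tau k)
  = rsum g a s tau.
Proof.
elim: s a tau => [|x s IH] a tau; first by rewrite big_geq.
by rewrite /= big_nat_recl //=; congr (_ + _); exact: IH.
Qed.

Lemma plenE a s :
  \sum_(0 <= k < size s) nm (gamma (nth 1 (a :: s) k.+1) - gamma (nth 1 (a :: s) k))
  = plen a s.
Proof.
elim: s a => [|x s IH] a; first by rewrite big_geq.
by rewrite /= big_nat_recl //=; congr (_ + _); exact: IH.
Qed.

Lemma taggedP a s tau : (forall k, (k < size s)%N ->
    nth 1 (a :: s) k <= tau k <= nth 1 (a :: s) k.+1) <-> tagged a s tau.
Proof.
elim: s a tau => [|x s IH] a tau //=; split.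
  move=> H; split; first exact: (H 0%N).
  by apply/IH => k ks; exact: (H k.+1).
by move=> [H0 /IH H] [|k] // /H.
Qed.

Lemma meshP d a s : (forall k, (k < size s)%N ->
    nth 1 (a :: s) k.+1 - nth 1 (a :: s) k < d) <-> mesh_lt d a s.
Proof.
elim: s a => [|x s IH] a //=; split.
  move=> H; split; first exact: (H 0%N).
  by apply/IH => k ks; exact: (H k.+1).
by move=> [H0 /IH H] [|k] // /H.
Qed.

Lemma plen_ge0 a s : 0 <= plen a s.
Proof. by elim: s a => [|x s IH] a //=; rewrite addr_ge0 ?nm_ge0. Qed.

Lemma path_le_last a s : path <%R a s -> a <= last a s.
Proof.
elim: s a => [|x s IH] a //= /andP[ax /IH]; apply: le_trans; exact: ltW.
Qed.

Lemma path_rcons_lt a p x y : path <%R a (rcons p x) -> y \in p -> y < x.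
Proof.
move=> + yp; case/splitPr: yp => q1 q2; rewrite rcons_cat cat_path /=.
move=> /andP[_ /andP[_ /(order_path_min lt_trans) /allP]]; apply.
by rewrite mem_rcons inE eqxx.
Qed.

Lemma rsum_piece g a s tau c w : path <%R a s -> tagged a s tau ->
  (forall y, a <= y <= last a s -> nm (c - g y) <= w) ->
  nm ((gamma (last a s) - gamma a) * c - rsum g a s tau) <= w * plen a s.
Proof.
elim: s a tau => [|x s IH] a tau /=; first by rewrite !subrr mul0r subr0 nm0 mulr0.
move=> /andP[ax ps] [/andP[at0 t0x] ts] H.
have xl := path_le_last ps.
have -> : (gamma (last x s) - gamma a) * c -
   ((gamma x - gamma a) * g (tau 0%N) + rsum g x s (tau \o S)) =
   (gamma x - gamma a) * (c - g (tau 0%N)) +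
   ((gamma (last x s) - gamma x) * c - rsum g x s (tau \o S)) by ring.
apply: le_trans (nmD _ _) _; rewrite [leRHS]mulrDr lerD //.
  rewrite nmM mulrC ler_wpM2r ?nm_ge0 //; apply: H.
  by rewrite at0 (le_trans t0x).
apply: IH => // y /andP[xy yl]; apply: H; rewrite yl (le_trans _ xy) //; exact: ltW.
Qed.

Lemma rsum_cat g a p s tau :
  rsum g a (p ++ s) tau = rsum g a p tau + rsum g (last a p) s (fun k => tau (size p + k)%N).
Proof.
elim: p a tau => [|x p IH] a tau /=; first by rewrite add0r.
by rewrite IH addrA.
Qed.

Lemma plen_cat a p s : plen a (p ++ s) = plen a p + plen (last a p) s.
Proof. by elim: p a => [|x p IH] a /=; rewrite ?add0r // IH addrA. Qed.

Lemma tagged_cat a p s tau : tagged a (p ++ s) tau ->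
  tagged a p tau /\ tagged (last a p) s (fun k => tau (size p + k)%N).
Proof.
elim: p a tau => [|x p IH] a tau //= [h1 /IH[h2 h3]]; split => //.
Qed.

(** Inside a piece of the coarse subdivision the tags of both subdivisions differ by less
than its mesh, so [g] varies there by at most [w]. *)
Lemma rsum_refine g a s s2 tau tau2 d w b : 0 <= w ->
  path <%R a s -> path <%R a s2 -> last a s = b -> last a s2 = b ->
  {subset s <= s2} -> mesh_lt d a s -> tagged a s tau -> tagged a s2 tau2 ->
  (forall x y, a <= x <= b -> a <= y <= b -> `|x - y| < d -> nm (g x - g y) <= w) ->
  nm (rsum g a s tau - rsum g a s2 tau2) <= w * plen a s2.
Proof.
move=> w0; elim: s a s2 tau tau2 => [|x s IH] a s2 tau tau2 /=.
  move=> _ p2 ab l2 _ _ _ t2 H; case: s2 p2 l2 t2 => [|y s2] //=.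
    by move=> *; rewrite subrr nm0 mulr0.
  move=> /andP[ay p2] l2 _; have := lt_le_trans ay (path_le_last p2).
  by rewrite l2 -ab ltxx.
move=> /andP[ax ps] p2 ls ls2 sub [xd md] [/andP[at0 t0x] ts] t2 H.
have xs2 : x \in s2 by apply: sub; rewrite inE eqxx.
case/splitPr: xs2 p2 ls2 sub t2 => p1 p2; rewrite -cat_rcons => pp ll sub tt.
have [t1 t2] := tagged_cat tt.
move: pp; rewrite cat_path last_rcons => /andP[pp1 pp2].
rewrite rsum_cat plen_cat last_rcons mulrDr; move: ll t2; rewrite last_cat last_rcons => ll t2.
have xb : x <= b by rewrite -ls path_le_last.
set A := (gamma x - gamma a) * _; set B := rsum g x s _.
set A' := rsum g a _ _; set B' := rsum g x p2 _.
have -> : A + B - (A' + B') = (A - A') + (B - B') by ring.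
apply: le_trans (nmD _ _) _; apply: lerD.
  have := @rsum_piece g a (rcons p1 x) tau2 (g (tau 0%N)) w pp1 t1.
  rewrite last_rcons; apply => y /andP[ay yx]; apply: H.
  - by rewrite at0 (le_trans t0x).
  - by rewrite ay (le_trans yx).
  - rewrite ltr_norml; apply/andP; split; lra.
apply: IH => //.
  move=> y ys; have := sub y; rewrite inE ys orbT => /(_ isT).
  rewrite mem_cat mem_rcons inE => /orP[/orP[/eqP yx|yp1]|//].
    have := order_path_min lt_trans ps => /allP /(_ y ys).
    by rewrite yx ltxx.
  have := order_path_min lt_trans ps => /allP /(_ y ys) xy.
  by have := lt_trans xy (path_rcons_lt pp1 yp1); rewrite ltxx.
move=> y z /andP[xy yb] /andP[xz zb]; apply: H; rewrite ?yb ?zb andbT.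
  by apply: le_trans xy; exact: ltW.
by apply: le_trans xz; exact: ltW.
Qed.

End riemann_stieltjes.

(** * Integrals along rectifiable curves *)

Section curve_integral.
Variable R : realType.
Local Notation C := R[i].
Implicit Types (gamma g h : R -> C) (a b d e x y L t r : R) (s p : seq R) (tau : nat -> R) (I : C).

Lemma fine_partition d : 0 < d -> exists s : seq R, itv_partition 0 1 s /\ mesh_lt d 0 s.
Proof.
move=> d0; have [n nd] := small_inv d0.
pose s : seq R := [seq k.+1%:R / n.+1%:R | k <- iota 0 n.+1].
have sz : size s = n.+1 by rewrite size_map size_iota.
have nths k : (k <= n.+1)%N -> nth 1 (0 :: s) k = k%:R / n.+1%:R.
  case: k => [|k] kn /=; first by rewrite mul0r.
  by rewrite (nth_map 0%N) ?size_iota // nth_iota.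
exists s; split; last first.
  apply/meshP => k; rewrite sz => kn; rewrite !nths // -?mulrBl; last exact: ltnW.
  by rewrite -natr1 addrC addKr mul1r.
split.
  apply/(pathP 1) => k; rewrite sz => kn.
  have := nths k.+1 kn; rewrite /= => ->; rewrite nths; last exact: ltnW.
  by rewrite ltr_pM2r ?invr_gt0 // ltr_nat.
have := nths n.+1 (leqnn _); rewrite divff // => l1.
by apply/eqP; rewrite -nth_last sz -[RHS]l1; apply: set_nth_default; rewrite sz.
Qed.

Lemma left_tagged a s : path <%R a s -> tagged a s (fun k => nth 1 (a :: s) k).
Proof.
elim: s a => [|x s IH] a //= /andP[ax ps]; split; first by rewrite lexx ltW.
exact: IH.
Qed.

(** The sorted union of the points of both subdivisions. *)
Lemma common_refinement s1 s2 : itv_partition 0 1 s1 -> itv_partition 0 1 s2 ->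
  exists s : seq R, [/\ itv_partition 0 1 s, {subset s1 <= s} & {subset s2 <= s}].
Proof.
move=> [p1 l1] [p2 l2].
have pos s : path <%R 0 s -> forall x, x \in s -> (0 : R) < x.
  by move=> /(order_path_min lt_trans) /allP.
have le1 s : path <%R 0 s -> last 0 s == 1 -> forall x, x \in s -> x <= (1 : R).
  move=> ps /eqP ls x xs; case/splitPr: xs ps ls => q1 q2.
  rewrite cat_path last_cat /= => /andP[_ /andP[_ pq]] <-; exact: path_le_last.
pose s := sort <=%R (undup (s1 ++ s2)).
have mems x : (x \in s) = (x \in s1) || (x \in s2) by rewrite mem_sort mem_undup mem_cat.
have one s0 : path <%R 0 s0 -> last 0 s0 == 1 -> 1 \in s0.
  move=> _; case: s0 => [|x s0] /=; first by rewrite eq_sym oner_eq0.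
  by move=> /eqP <-; exact: mem_last.
have ps : path <%R 0 s.
  rewrite path_min_sorted; first by rewrite sort_lt_sorted undup_uniq.
  by apply/allP => x; rewrite mems => /orP[/(pos _ p1)|/(pos _ p2)].
exists s; split; last 2 first.
- by move=> x xs; rewrite mems xs.
- by move=> x xs; rewrite mems xs orbT.
split => //; rewrite eq_le; apply/andP; split; last first.
  have : 1 \in s by rewrite mems (one _ p1 l1).
  move=> h; case/splitPr: h ps => q1 q2.
  by rewrite cat_path last_cat /= => /andP[_ /andP[_ /path_le_last]].
case El : s => [|x s']; first by rewrite /=.
rewrite -El; have : last 0 s \in s by rewrite El /= mem_last.
by rewrite mems => /orP[/(le1 _ p1 l1)|/(le1 _ p2 l2)].
Qed.

Definition cont01 g := forall t, 0 <= t <= 1 -> forall e, 0 < e ->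
  exists2 r, 0 < r & forall t', 0 <= t' <= 1 -> `|t' - t| < r -> nm (g t' - g t) <= e.

Definition length_le gamma L := forall s, itv_partition 0 1 s -> plen gamma 0 s <= L.

Definition rsint gamma g I := forall e, 0 < e -> exists2 d, 0 < d &
  forall s tau, itv_partition 0 1 s -> mesh_lt d 0 s -> tagged 0 s tau ->
    nm (rsum gamma g 0 s tau - I) <= e.

Lemma length_ge0 gamma L : length_le gamma L -> 0 <= L.
Proof.
move=> H; have [s [ps _]] := fine_partition ltr01.
by apply: le_trans (H s ps); exact: plen_ge0.
Qed.

Lemma unif_cont01 g : cont01 g -> forall e, 0 < e -> exists2 d, 0 < d &
  forall x y, 0 <= x <= 1 -> 0 <= y <= 1 -> `|x - y| < d -> nm (g x - g y) <= e.
Proof.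
move=> cg e e0; have e2 : 0 < e / 2 by rewrite divr_gt0.
have [d d0 H] := lebesgue_number (fun t tP => cg t tP _ e2).
exists d => // x y xP yP xy; have [t0 [r0 [t0P Q sub]]] := H y yP.
apply: le_trans (nm_tri _ (g t0) _) _; rewrite (splitr e) lerD //.
  by apply: Q => //; exact: sub.
by rewrite nmC; apply: Q => //; apply: sub; rewrite subrr normr0.
Qed.

Lemma tagged_itv s tau : path <%R 0 s -> last 0 s == 1 -> tagged (0 : R) s tau ->
  forall k, (k < size s)%N -> 0 <= tau k <= 1.
Proof.
suff gen a : 0 <= a -> path <%R a s -> last a s == 1 -> tagged a s tau ->
  forall k, (k < size s)%N -> 0 <= tau k <= 1 by exact: gen.
elim: s tau a => [|x s IH] tau a a0 //= /andP[ax ps] ls [/andP[t0 t1] ts] [|k] ks.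
  by rewrite (le_trans a0) // (le_trans t1) // -(eqP ls) path_le_last.
by apply: (IH (tau \o S) x) => //; apply: le_trans a0 _; exact: ltW.
Qed.

(** Two sums of small mesh are close to any sum of a common refinement, so the sums
satisfy Cauchy's criterion. *)
Lemma rsint_ex gamma g L : length_le gamma L -> cont01 g -> exists I, rsint gamma g I.
Proof.
move=> rL cg; have L0 := length_ge0 rL.
have est e : 0 < e -> exists2 d, 0 < d & forall s s' tau tau',
    itv_partition 0 1 s -> itv_partition 0 1 s' ->
    mesh_lt d 0 s -> mesh_lt d 0 s' -> tagged 0 s tau -> tagged 0 s' tau' ->
    nm (rsum gamma g 0 s tau - rsum gamma g 0 s' tau') <= e.
  move=> e0; pose w := e / (2 * (L + 1)).
  have w0 : 0 < w by rewrite divr_gt0 // mulr_gt0 // ltr_wpDl.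
  have wL : w * L <= e / 2.
    have -> : w * L = e / 2 * (L / (L + 1)) by rewrite /w; field; lra.
    by rewrite ler_piMr ?divr_ge0 ?(ltW e0) // ler_pdivrMr; lra.
  have [d d0 H] := unif_cont01 cg w0; exists d => //.
  move=> s s' tau tau' ps ps' ms ms' ts ts'.
  have [s2 [p2 sub sub']] := common_refinement ps ps'.
  have t2 := left_tagged p2.1.
  apply: le_trans (nm_tri _ (rsum gamma g 0 s2 (fun k => nth 1 (0 :: s2) k)) _) _.
  have one : forall q, itv_partition (0 : R) 1 q -> last 0 q = 1 by move=> q [_ /eqP].
  have b : w * plen gamma 0 s2 <= e / 2.
    by apply: le_trans wL; rewrite ler_wpM2l ?(ltW w0) // rL.
  rewrite (splitr e) lerD //; last rewrite nmC.
    apply: (le_trans _ b).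
    exact: (rsum_refine gamma (ltW w0) ps.1 p2.1 (one _ ps) (one _ p2) sub ms ts t2 H).
  apply: (le_trans _ b).
  exact: (rsum_refine gamma (ltW w0) ps'.1 p2.1 (one _ ps') (one _ p2) sub' ms' ts' t2 H).
have [P PP] := choice (fun n : nat => @fine_partition n.+1%:R^-1 ltac:(by rewrite invr_gt0)).
pose u n := rsum gamma g 0 (P n) (fun k => nth 1 (0 :: P n) k).
have mono d n q : n.+1%:R^-1 < d -> mesh_lt n.+1%:R^-1 0 q -> mesh_lt d (0 : R) q.
  move=> nd /meshP H; apply/meshP => k /H; move=> h; exact: lt_trans h nd.
have mono' N n : (N <= n)%N -> n.+1%:R^-1 <= N.+1%:R^-1 :> R.
  by move=> Nn; rewrite lef_pV2 ?posrE // ler_nat.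
have [I HI] : exists I, forall e, 0 < e -> exists N, forall n, (N <= n)%N -> nm (u n - I) <= e.
  apply: cauchy_lim => e /est[d d0 H]; have [N Nd] := small_inv d0.
  exists N => n m Nn Nm; apply: H; try exact: (PP _).1.
  - by apply: mono (PP n).2; apply: le_lt_trans (mono' _ _ Nn) Nd.
  - by apply: mono (PP m).2; apply: le_lt_trans (mono' _ _ Nm) Nd.
  - exact: left_tagged (PP n).1.1.
  - exact: left_tagged (PP m).1.1.
exists I => e e0; have e2 : 0 < e / 2 by rewrite divr_gt0.
have [d d0 H] := est _ e2; exists d => // s tau ps ms ts.
have [N Nd] := small_inv d0; have [N' HN'] := HI _ e2.
apply: le_trans (nm_tri _ (u (maxn N N')) _) _; rewrite (splitr e) lerD //; last first.
  by apply: HN'; exact: leq_maxr.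
apply: H => //; first exact: (PP _).1.
  by apply: mono (PP _).2; apply: le_lt_trans (mono' _ _ (leq_maxl _ _)) Nd.
exact: left_tagged (PP _).1.1.
Qed.

Lemma rsint_test gamma g I e : rsint gamma g I -> 0 < e -> forall d, 0 < d -> exists s tau,
  [/\ itv_partition 0 1 s, mesh_lt d 0 s, tagged 0 s tau & nm (rsum gamma g 0 s tau - I) <= e].
Proof.
move=> H e0 d d0; have [d' d'0 H'] := H e e0.
have d2 : 0 < Num.min d d' by rewrite lt_min d0.
have [s [ps ms]] := fine_partition d2.
have ms' q : Num.min d d' <= q -> mesh_lt q 0 s.
  by move=> dq; apply/meshP => k /(proj2 (meshP _ _ _) ms) h; apply: lt_le_trans h dq.
exists s, (fun k => nth 1 (0 :: s) k); split => //.
- by apply: ms'; rewrite ge_min lexx.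
- exact: left_tagged ps.1.
- by apply: H' => //; [apply: ms'; rewrite ge_min lexx orbT|exact: left_tagged ps.1].
Qed.

Lemma rsint_uniq gamma g I I' : rsint gamma g I -> rsint gamma g I' -> I = I'.
Proof.
move=> H H'; apply/eqP; rewrite -subr_eq0; apply/eqP; apply: nm_small => e e0.
have e2 : 0 < e / 2 by rewrite divr_gt0.
have [d d0 Hd] := H _ e2.
have [s [tau [ps ms ts k]]] := rsint_test H' e2 d0.
apply: le_trans (nm_tri _ (rsum gamma g 0 s tau) _) _; rewrite (splitr e) lerD //.
by rewrite nmC; exact: Hd.
Qed.

Lemma rsum_eq gamma g h a s tau :
  (forall k, (k < size s)%N -> g (tau k) = h (tau k)) ->
  rsum gamma g a s tau = rsum gamma h a s tau.
Proof.
elim: s a tau => [|x s IH] a tau //= H; rewrite (H 0%N) // IH // => k ks.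
exact: (H k.+1).
Qed.

Lemma rsint_eq gamma g h I : (forall t, 0 <= t <= 1 -> g t = h t) -> rsint gamma g I -> rsint gamma h I.
Proof.
move=> gh H e /H[d d0 Hd]; exists d => // s tau ps ms ts.
rewrite -(@rsum_eq _ g); first exact: Hd.
by move=> k ks; apply: gh; apply: (tagged_itv ps.1 ps.2 ts).
Qed.

Lemma rsumD gamma g h a s tau : rsum gamma (fun t => g t + h t) a s tau =
  rsum gamma g a s tau + rsum gamma h a s tau.
Proof. by elim: s a tau => [|x s IH] a tau /=; rewrite ?addr0 // IH; ring. Qed.

Lemma rsumZ gamma (c : C) g a s tau : rsum gamma (fun t => c * g t) a s tau =
  c * rsum gamma g a s tau.
Proof. by elim: s a tau => [|x s IH] a tau /=; rewrite ?mulr0 // IH; ring. Qed.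

Lemma rsintD gamma g h I I' : rsint gamma g I -> rsint gamma h I' ->
  rsint gamma (fun t => g t + h t) (I + I').
Proof.
move=> Hg Hh e e0; have e2 : 0 < e / 2 by rewrite divr_gt0.
have [d d0 Hd] := Hg _ e2; have [d' d'0 Hd'] := Hh _ e2.
exists (Num.min d d'); first by rewrite lt_min d0.
move=> s tau ps ms ts; rewrite rsumD.
have ms' q : Num.min d d' <= q -> mesh_lt q 0 s.
  by move=> dq; apply/meshP => k /(proj2 (meshP _ _ _) ms) k'; apply: lt_le_trans k' dq.
have -> (x y : C) : x + y - (I + I') = (x - I) + (y - I') by ring.
apply: le_trans (nmD _ _) _; rewrite (splitr e) lerD //.
  by apply: Hd => //; apply: ms'; rewrite ge_min lexx.
by apply: Hd' => //; apply: ms'; rewrite ge_min lexx orbT.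
Qed.

Lemma rsintZ gamma (c : C) g I : rsint gamma g I -> rsint gamma (fun t => c * g t) (c * I).
Proof.
move=> Hg e e0; have c0 : 0 < nm c + 1 by rewrite ltr_wpDl ?nm_ge0.
have [d d0 Hd] := Hg _ (divr_gt0 e0 c0); exists d => // s tau ps ms ts.
rewrite rsumZ -mulrBr nmM; apply: le_trans (ler_wpM2l (nm_ge0 _) (Hd s tau ps ms ts)) _.
by rewrite mulrCA ler_piMr ?(ltW e0) // ler_pdivrMr //; lra.
Qed.

Lemma rsintB gamma g h I I' : rsint gamma g I -> rsint gamma h I' ->
  rsint gamma (fun t => g t - h t) (I - I').
Proof.
move=> Hg Hh; rewrite -mulN1r; apply: rsint_eq (rsintD Hg (rsintZ (-1) Hh)) => t _.
by rewrite mulN1r.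
Qed.

Lemma rsum_bound gamma g a s tau B :
  (forall k, (k < size s)%N -> nm (g (tau k)) <= B) ->
  nm (rsum gamma g a s tau) <= B * plen gamma a s.
Proof.
elim: s a tau => [|x s IH] a tau /= H; first by rewrite nm0 mulr0.
apply: le_trans (nmD _ _) _; rewrite [leRHS]mulrDr lerD //.
  by rewrite nmM mulrC ler_wpM2r ?nm_ge0 // (H 0%N).
by apply: IH => k ks; exact: (H k.+1).
Qed.

Lemma rsint_bound gamma g I L B : length_le gamma L -> 0 <= B ->
  (forall t, 0 <= t <= 1 -> nm (g t) <= B) -> rsint gamma g I -> nm I <= B * L.
Proof.
move=> rL B0 gB H; apply/ler_addgt0Pr => e e0.
have [s [tau [ps ms ts k]]] := rsint_test H e0 ltr01.
have := rsum_bound gamma 0 (fun k ks => gB _ (tagged_itv ps.1 ps.2 ts ks)) => k2.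
rewrite -(subrK (rsum gamma g 0 s tau) I); apply: le_trans (nmD _ _) _.
rewrite addrC lerD //; last by rewrite nmC.
by apply: le_trans k2 _; rewrite ler_wpM2l // rL.
Qed.

Lemma rsum_telescope gamma g (G : C -> C) a s tau d w : 0 <= a -> path <%R a s ->
  last a s = 1 -> mesh_lt d a s -> tagged a s tau ->
  (forall x y t, 0 <= x -> x <= t -> t <= y -> y <= 1 -> y - x < d ->
     nm (G (gamma y) - G (gamma x) - g t * (gamma y - gamma x)) <= w * nm (gamma y - gamma x)) ->
  nm (rsum gamma g a s tau - (G (gamma 1) - G (gamma a))) <= w * plen gamma a s.
Proof.
elim: s a tau => [|x s IH] a tau /= a0.
  by move=> _ -> _ _ _; rewrite !subrr nm0 mulr0.
move=> /andP[ax ps] ls [xa ms] [/andP[at0 t0x] ts] H.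
have x1 : x <= 1 by rewrite -ls path_le_last.
set A := _ * _; set B := rsum _ _ _ _ _.
have -> : A + B - (G (gamma 1) - G (gamma a)) =
   (B - (G (gamma 1) - G (gamma x))) -
   (G (gamma x) - G (gamma a) - g (tau 0%N) * (gamma x - gamma a)) by rewrite /A; ring.
apply: le_trans (nmB _ _) _; rewrite [leRHS]mulrDr [leLHS]addrC lerD //; first exact: H.
by apply: IH => //; apply: le_trans a0 _; exact: ltW.
Qed.

(** The sums telescope up to errors that are controlled by strict differentiability at a
nearby point of the curve; a Lebesgue number makes this uniform. *)
Lemma rsint_ftc gamma g (G : C -> C) L : length_le gamma L -> cont01 gamma -> cont01 g ->
  (forall t, 0 <= t <= 1 -> sdiff G (g t) (gamma t)) ->
  rsint gamma g (G (gamma 1) - G (gamma 0)).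
Proof.
move=> rL cgam cg sG e e0; have L0 := length_ge0 rL.
pose w := e / (2 * (L + 1)).
have w0 : 0 < w by rewrite divr_gt0 // mulr_gt0 // ltr_wpDl.
have wL : 2 * w * L <= e.
  have -> : 2 * w * L = e * (L / (L + 1)) by rewrite /w; field; lra.
  by rewrite ler_piMr ?(ltW e0) // ler_pdivrMr; lra.
pose Q (t0 r0 : R) :=
   (forall x : R, 0 <= x <= 1 -> `|x - t0| < r0 -> nm (g x - g t0) <= w) /\
   (forall x y : R, 0 <= x <= 1 -> 0 <= y <= 1 -> `|x - t0| < r0 -> `|y - t0| < r0 ->
     nm (G (gamma y) - G (gamma x) - g t0 * (gamma y - gamma x)) <= w * nm (gamma y - gamma x)).
have [|d d0 H] := @lebesgue_number R Q.
  move=> t tP.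
  have [r1 r10 H1] := cg t tP _ w0; have [r2 r20 H2] := sG t tP _ w0.
  have r22 : 0 < r2 / 2 by rewrite divr_gt0.
  have [r3 r30 H3] := cgam t tP _ r22.
  exists (Num.min r1 r3); first by rewrite lt_min r10.
  split; first by move=> x xP; rewrite lt_min => /andP[? _]; exact: H1.
  move=> x y xP yP; rewrite !lt_min => /andP[_ x3] /andP[_ y3].
  by apply: H2; [apply: le_lt_trans (H3 _ yP y3) _|apply: le_lt_trans (H3 _ xP x3) _]; lra.
exists d => // s tau ps ms ts.
apply: (@le_trans _ _ (2 * w * plen gamma 0 s)); last first.
  by apply: (le_trans _ wL); apply: ler_wpM2l; [lra | exact: rL].
apply: (rsum_telescope (lexx 0) ps.1 (eqP ps.2) ms ts).
move=> x y t x0 xt ty y1 yx.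
have tP : 0 <= t <= 1 by rewrite (le_trans x0) // (le_trans ty).
have xP : 0 <= x <= 1 by rewrite x0 (le_trans xt) // (le_trans ty).
have yP : 0 <= y <= 1 by rewrite y1 (le_trans x0) // (le_trans xt).
have [t0 [r0 [t0P [H1 H2] sub]]] := H t tP.
have st : `|t - t0| < r0 by apply: sub; rewrite subrr normr0.
have sx : `|x - t0| < r0 by apply: sub; rewrite ler0_norm; lra.
have sy : `|y - t0| < r0 by apply: sub; rewrite ger0_norm; lra.
have -> : G (gamma y) - G (gamma x) - g t * (gamma y - gamma x) =
  (G (gamma y) - G (gamma x) - g t0 * (gamma y - gamma x)) -
  (g t - g t0) * (gamma y - gamma x) by ring.
apply: le_trans (nmB _ _) _; rewrite (_ : 2 * w * _ = w * nm (gamma y - gamma x) + w * nm (gamma y - gamma x)); last by ring.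
by rewrite lerD ?H2 // nmM ler_wpM2r ?nm_ge0 // H1.
Qed.

End curve_integral.

(** * Differentiation rules *)

Section differentiation_rules.
Variable R : realType.
Local Notation C := R[i].
Implicit Types (z w c : C) (e r x y : R) (f g : C -> C) (W : set C).

Definition ccont f z := forall e : R, 0 < e -> exists2 r : R, 0 < r &
  forall w, nm (w - z) < r -> nm (f w - f z) <= e.

(** Differentiability at [z] with increments based at the points of [W]. For
[W = setT] this is strict differentiability and for [W = [set z]] the usual
one, so the rules need only one proof. *)
Definition pdiff W f c z := forall e : R, 0 < e -> exists2 r : R, 0 < r &
  forall w w', W w' -> nm (w - z) < r -> nm (w' - z) < r ->
    nm (f w - f w' - c * (w - w')) <= e * nm (w - w').

Lemma pdiff_sdiff f c z : pdiff setT f c z <-> sdiff f c z.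
Proof.
by split=> H e /H[r r0 rH]; exists r => // w w'; [apply: rH|move=> _; exact: rH].
Qed.

Lemma pdiff_cdiff f c z : pdiff [set z] f c z <-> cdiff f c z.
Proof.
split=> H e /H[r r0 rH]; exists r => // w.
  by move=> wr; apply: rH => //; rewrite subrr nm0.
by move=> w' -> wr _; exact: rH.
Qed.

Lemma pdiff_ccont W f c z : W z -> pdiff W f c z -> ccont f z.
Proof.
move=> Wz H e e0; have [r r0 rH] := H 1 ltr01.
have c0 : 0 < 1 + nm c by rewrite ltr_wpDr ?nm_ge0.
exists (Num.min r (e / (1 + nm c))); first by rewrite lt_min r0 divr_gt0.
move=> w; rewrite lt_min => /andP[wr we].
have := rH w z Wz wr; rewrite subrr nm0 => /(_ r0) k.
rewrite -(subrK (c * (w - z)) (f w - f z)); apply: le_trans (nmD _ _) _.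
apply: (@le_trans _ _ ((1 + nm c) * nm (w - z))); first by rewrite mulrDl lerD // nmM.
by rewrite mulrC -ler_pdivlMr // ltW.
Qed.

Lemma cdiff_ccont f c z : cdiff f c z -> ccont f z.
Proof. by move=> /pdiff_cdiff; exact: pdiff_ccont. Qed.

Lemma pdiff_cst W (k z : C) : pdiff W (fun=> k) 0 z.
Proof.
move=> e e0; exists 1 => // w w' _ _ _.
by rewrite subrr mul0r subr0 nm0 mulr_ge0 ?nm_ge0 // ltW.
Qed.

Lemma pdiff_id W z : pdiff W id 1 z.
Proof.
move=> e e0; exists 1 => // w w' _ _ _.
by rewrite mul1r subrr nm0 mulr_ge0 ?nm_ge0 // ltW.
Qed.

Lemma pdiffD W f g c d z : pdiff W f c z -> pdiff W g d z ->
  pdiff W (fun w => f w + g w) (c + d) z.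
Proof.
move=> Hf Hg e e0; have e2 : 0 < e / 2 by rewrite divr_gt0.
have [r r0 rH] := Hf _ e2; have [r' r'0 rH'] := Hg _ e2.
exists (Num.min r r'); first by rewrite lt_min r0.
move=> w w' Ww; rewrite !lt_min => /andP[h1 h2] /andP[h3 h4].
have -> : f w + g w - (f w' + g w') - (c + d) * (w - w') =
  (f w - f w' - c * (w - w')) + (g w - g w' - d * (w - w')) by ring.
by apply: le_trans (nmD _ _) _; rewrite (splitr e) mulrDl lerD ?rH ?rH'.
Qed.

Lemma pdiffZ W f c z (k : C) : pdiff W f c z -> pdiff W (fun w => k * f w) (k * c) z.
Proof.
move=> Hf e e0; have k0 : 0 < nm k + 1 by rewrite ltr_wpDl ?nm_ge0.
have [r r0 rH] := Hf _ (divr_gt0 e0 k0); exists r => // w w' Ww h1 h2.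
have -> : k * f w - k * f w' - k * c * (w - w') = k * (f w - f w' - c * (w - w')) by ring.
rewrite nmM; apply: le_trans (ler_wpM2l (nm_ge0 _) (rH w w' Ww h1 h2)) _.
rewrite mulrA ler_wpM2r ?nm_ge0 // mulrCA ler_piMr ?(ltW e0) //.
by rewrite ler_pdivrMr // mul1r lerDl.
Qed.

Lemma pdiffB W f g c d z : pdiff W f c z -> pdiff W g d z ->
  pdiff W (fun w => f w - g w) (c - d) z.
Proof.
move=> Hf Hg; have := pdiffD Hf (pdiffZ (-1) Hg).
rewrite mulN1r => H e /H[r r0 rH]; exists r => // w w' Ww h1 h2.
by have := rH w w' Ww h1 h2; rewrite !mulN1r.
Qed.

Lemma pdiffM W f g c d z : W z -> pdiff W f c z -> pdiff W g d z ->
  pdiff W (fun w => f w * g w) (c * g z + f z * d) z.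
Proof.
move=> Wz Hf Hg e e0.
pose K := nm (g z) + nm (f z) + nm c + nm d + 2.
have K0 : 0 < K.
  by rewrite /K; have := nm_ge0 (g z); have := nm_ge0 (f z); have := nm_ge0 c;
    have := nm_ge0 d; lra.
pose q := Num.min 1 (e / K).
have q0 : 0 < q by rewrite lt_min ltr01 divr_gt0.
have [q1 qK] : q <= 1 /\ q * K <= e.
  split; first by rewrite ge_min lexx.
  by rewrite -ler_pdivlMr // ge_min lexx orbT.
have [r1 r10 H1] := Hf _ q0; have [r2 r20 H2] := Hg _ q0.
have [r3 r30 H3] := pdiff_ccont Wz Hf q0; have [r4 r40 H4] := pdiff_ccont Wz Hg q0.
exists (Num.min (Num.min r1 r2) (Num.min r3 r4)); first by rewrite !lt_min r10 r20 r30.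
move=> w w' Ww; rewrite !lt_min => /andP[/andP[w1 w2] /andP[w3 w4]].
move=> /andP[/andP[w'1 w'2] /andP[w'3 w'4]].
have k1 := H1 _ _ Ww w1 w'1; have k2 := H2 _ _ Ww w2 w'2.
have k3 := H3 _ w'3; have k4 := H4 _ w4.
have -> : f w * g w - f w' * g w' - (c * g z + f z * d) * (w - w') =
  (f w - f w' - c * (w - w')) * (g w - g z + g z)
  + (f w' - f z + f z) * (g w - g w' - d * (w - w'))
  + (c * (w - w') * (g w - g z) + (f w' - f z) * (d * (w - w'))) by ring.
apply: (@le_trans _ _ (q * K * nm (w - w'))); last by rewrite ler_wpM2r ?nm_ge0.
set D := nm (w - w') in k1 k2 *; have D0 : 0 <= D := nm_ge0 _.
have -> : q * K * D = q * D * (1 + nm (g z)) + (1 + nm (f z)) * (q * D)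
   + (nm c * D * q + q * (nm d * D)) by rewrite /K; ring.
apply: le_trans (nmD _ _) _; apply: lerD.
  apply: le_trans (nmD _ _) _; apply: lerD; rewrite nmM ler_pM ?nm_ge0 //.
    by apply: le_trans (nmD _ _) _; rewrite lerD2r (le_trans k4).
  by apply: le_trans (nmD _ _) _; rewrite lerD2r (le_trans k3).
apply: le_trans (nmD _ _) _; apply: lerD; rewrite !nmM -/D.
  by rewrite ler_wpM2l // mulr_ge0 ?nm_ge0.
by rewrite ler_wpM2r // mulr_ge0 ?nm_ge0.
Qed.

Lemma pdiffV W f c z : W z -> f z != 0 -> pdiff W f c z ->
  pdiff W (fun w => (f w)^-1) (- (c / f z ^+ 2)) z.
Proof.
move=> Wz fz Hf e e0.
pose a := nm (f z); have a0 : 0 < a by rewrite nm_gt0.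
pose K := 4 / a ^+ 2 + nm c * (4 * (3 * a) / a ^+ 4).
have K0 : 0 < K.
  by rewrite ltr_wpDr ?divr_gt0 ?exprn_gt0 // !mulr_ge0 ?nm_ge0 ?invr_ge0 ?exprn_ge0 // ltW.
pose q := Num.min (a / 2) (e / K).
have q0 : 0 < q by rewrite lt_min !divr_gt0.
have [qa qK] : q <= a / 2 /\ q * K <= e.
  split; first by rewrite ge_min lexx.
  by rewrite -ler_pdivlMr // ge_min lexx orbT.
have [r1 r10 H1] := Hf _ q0; have [r2 r20 H2] := pdiff_ccont Wz Hf q0.
exists (Num.min r1 r2); first by rewrite lt_min r10.
move=> w w' Ww; rewrite !lt_min => /andP[w1 w2] /andP[w'1 w'2].
have k1 := H1 _ _ Ww w1 w'1; have k2 := H2 _ w2; have k3 := H2 _ w'2.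
have low u : nm (f u - f z) <= q -> a / 2 <= nm (f u).
  by move=> h; have := nm_sub (f z) (f u); rewrite nmC -/a; lra.
have l2 := low _ k2; have l3 := low _ k3.
have fw0 : f w != 0 by rewrite -nm_gt0; lra.
have fw'0 : f w' != 0 by rewrite -nm_gt0; lra.
have -> : (f w)^-1 - (f w')^-1 - - (c / f z ^+ 2) * (w - w') =
  - ((f w - f w' - c * (w - w')) * ((f w)^-1 * (f w')^-1))
  + c * (w - w') * ((f z * (f w' - f z) + f w' * (f w - f z)) *
     ((f w)^-1 * (f w')^-1 * (f z)^-1 ^+ 2)).
  by field; rewrite fw0 fw'0 fz.
apply: (@le_trans _ _ (q * K * nm (w - w'))); last by rewrite ler_wpM2r ?nm_ge0.
set D := nm (w - w') in k1 *; have D0 : 0 <= D := nm_ge0 _.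
have -> : q * K * D = q * D * (2 / a * (2 / a)) +
   nm c * D * (3 * a * q * (2 / a * (2 / a) * (1 / a) ^+ 2)).
  by rewrite /K; field; rewrite gt_eqF.
have inv u : a / 2 <= nm u -> nm u^-1 <= 2 / a.
  move=> h; rewrite nmV -[leRHS]invf_div lef_pV2 ?posrE ?divr_gt0 //.
  by apply: lt_le_trans h; rewrite divr_gt0.
have i2 := inv _ l2; have i3 := inv _ l3.
have a20 : 0 <= 2 / a by rewrite divr_ge0 // ltW.
apply: le_trans (nmD _ _) _; rewrite nmN; apply: lerD.
  by rewrite nmM ler_pM ?nm_ge0 // nmM ler_pM ?nm_ge0.
rewrite nmM (nmM c) -/D ler_wpM2l ?mulr_ge0 ?nm_ge0 //.
rewrite nmM ler_pM ?nm_ge0 //; last first.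
  rewrite nmM nmX nmV -/a div1r ler_wpM2r ?exprn_ge0 ?invr_ge0 ?(ltW a0) //.
  by rewrite nmM ler_pM ?nm_ge0.
have up : nm (f w') <= 3 / 2 * a.
  by have := nm_sub (f w') (f z); rewrite -/a; lra.
apply: le_trans (nmD _ _) _; rewrite !nmM -/a.
have -> : 3 * a * q = a * q + 2 * a * q by ring.
rewrite lerD // ?ler_wpM2l ?(ltW a0) //.
by rewrite ler_pM ?nm_ge0 //; lra.
Qed.

Lemma ccontM f g z : ccont f z -> ccont g z -> ccont (fun w => f w * g w) z.
Proof.
move=> Hf Hg e e0.
pose K := nm (g z) + nm (f z) + 1.
have K0 : 0 < K by rewrite /K; have := nm_ge0 (g z); have := nm_ge0 (f z); lra.
pose q := Num.min 1 (e / K).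
have q0 : 0 < q by rewrite lt_min ltr01 divr_gt0.
have [q1 qK] : q <= 1 /\ q * K <= e.
  split; first by rewrite ge_min lexx.
  by rewrite -ler_pdivlMr // ge_min lexx orbT.
have [r1 r10 H1] := Hf _ q0; have [r2 r20 H2] := Hg _ q0.
exists (Num.min r1 r2); first by rewrite lt_min r10.
move=> w; rewrite lt_min => /andP[/H1 k1 /H2 k2].
have -> : f w * g w - f z * g z = (f w - f z) * (g w - g z) + (f z * (g w - g z)
   + (f w - f z) * g z) by ring.
apply: le_trans qK; have -> : q * K = q * 1 + (nm (f z) * q + q * nm (g z)) by rewrite /K; ring.
apply: le_trans (nmD _ _) _; apply: lerD.
  by rewrite nmM ler_pM ?nm_ge0 // (le_trans k2).
apply: le_trans (nmD _ _) _; apply: lerD; rewrite nmM.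
  by rewrite ler_wpM2l ?nm_ge0.
by rewrite ler_wpM2r ?nm_ge0.
Qed.

End differentiation_rules.

Section continuity_on_unit_interval.
Variable R : realType.
Local Notation C := R[i].
Implicit Types (g h gamma : R -> C) (F : C -> C).

Lemma cont01_comp F gamma : cont01 gamma ->
  (forall t, 0 <= t <= 1 -> ccont F (gamma t)) -> cont01 (fun t => F (gamma t)).
Proof.
move=> cg cF t tP e e0; have [r r0 rH] := cF t tP e e0.
have r2 : 0 < r / 2 by rewrite divr_gt0.
have [s s0 sH] := cg t tP _ r2; exists s => // t' t'P tt.
by apply: rH; apply: le_lt_trans (sH t' t'P tt) _; lra.
Qed.

Lemma cont01_max g : cont01 g -> exists2 B, 0 <= B & forall t, 0 <= t <= 1 -> nm (g t) <= B.
Proof.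
move=> cg; have [d d0 H] := unif_cont01 cg ltr01.
have [n nd] := small_inv d0.
exists (nm (g 0) + n.+1%:R); first by rewrite addr_ge0 ?nm_ge0.
move=> t tP.
have key k : (k <= n.+1)%N -> nm (g (t * (k%:R / n.+1%:R))) <= nm (g 0) + k%:R.
  elim: k => [|k IH] kn; first by rewrite mul0r mulr0 addr0.
  have pos j : (j <= n.+1)%N -> 0 <= t * (j%:R / n.+1%:R) <= 1.
    move: tP => /andP[t0 t1] jn; rewrite mulr_ge0 ?divr_ge0 //=.
    by rewrite mulr_ile1 ?divr_ge0 // ler_pdivrMr ?mul1r ?ler_nat.
  rewrite -(subrK (g (t * (k%:R / n.+1%:R))) (g _)).
  apply: le_trans (nmD _ _) _; rewrite -natr1 addrC addrA.
  apply: lerD; first exact: IH (ltnW kn).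
  apply: H; [by have := pos k.+1 kn; rewrite -natr1|exact: pos (ltnW kn)|].
  rewrite -mulrBr -mulrBl [k%:R + 1]addrC addrK mul1r.
  move: tP => /andP[t0 t1]; rewrite ger0_norm ?mulr_ge0 ?invr_ge0 //.
  by apply: le_lt_trans nd; rewrite ler_piMl ?invr_ge0.
by have := key n.+1 (leqnn _); rewrite divff // mulr1.
Qed.

End continuity_on_unit_interval.

(** * Cauchy kernels and winding numbers *)

Section cauchy_kernel.
Variable R : realType.
Local Notation C := R[i].
Implicit Types (z w c : C) (e r x y L : R) (f g F : C -> C) (gamma : R -> C).

Definition on_curve gamma f := forall t, 0 <= t <= 1 -> ccont f (gamma t).

Definition off_curve gamma z := forall t, 0 <= t <= 1 -> gamma t != z.

(** The value is [0] if the integral does not exist. *)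
Definition cint gamma f : C := xget 0 [set I | rsint gamma (f \o gamma) I].

Lemma cint_rsint gamma f L : length_le gamma L -> cont01 gamma -> on_curve gamma f ->
  rsint gamma (f \o gamma) (cint gamma f).
Proof.
move=> rL cg cf; have [I HI] := rsint_ex rL (cont01_comp cg cf).
exact: (xgetI _ (HI : [set I | rsint gamma (f \o gamma) I] I)).
Qed.

Lemma rsint_cint gamma f I : rsint gamma (f \o gamma) I -> cint gamma f = I.
Proof.
move=> HI; apply: (rsint_uniq _ HI).
exact: (xgetI _ (HI : [set I | rsint gamma (f \o gamma) I] I)).
Qed.

Lemma eq_cint gamma f g : (forall t, 0 <= t <= 1 -> f (gamma t) = g (gamma t)) ->
  cint gamma f = cint gamma g.
Proof.
move=> fg; congr xget; apply/seteqP; split => I /=; apply: rsint_eq => t tP /=.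
  exact: fg.
by rewrite fg.
Qed.

Section curve.
Variables (gamma : R -> C) (L : R).
Hypotheses (rL : length_le gamma L) (cg : cont01 gamma) (closed_gamma : gamma 0 = gamma 1).

Lemma cintB f g : on_curve gamma f -> on_curve gamma g ->
  cint gamma (fun w => f w - g w) = cint gamma f - cint gamma g.
Proof.
move=> cf cg'; apply: rsint_cint; apply: rsintB (cint_rsint rL cg cf) (cint_rsint rL cg cg').
Qed.

Lemma cintZ c f : on_curve gamma f -> cint gamma (fun w => c * f w) = c * cint gamma f.
Proof. by move=> cf; apply: rsint_cint; apply: rsintZ (cint_rsint rL cg cf). Qed.

Lemma cint_bound f B : on_curve gamma f -> 0 <= B ->
  (forall t, 0 <= t <= 1 -> nm (f (gamma t)) <= B) -> nm (cint gamma f) <= B * L.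
Proof. by move=> cf B0 fB; apply: rsint_bound rL B0 fB (cint_rsint rL cg cf). Qed.

Lemma cint_primitive f F : on_curve gamma f ->
  (forall t, 0 <= t <= 1 -> sdiff F (f (gamma t)) (gamma t)) -> cint gamma f = 0.
Proof.
move=> cf H; apply: rsint_cint; have := rsint_ftc rL cg (cont01_comp cg cf) H.
by rewrite closed_gamma subrr.
Qed.

Lemma pdiff_shift W z p : pdiff W (fun w => w - z) 1 p.
Proof. by rewrite -[1]subr0; apply: pdiffB; [exact: pdiff_id|exact: pdiff_cst]. Qed.

Lemma pdiff_inv W z p : W p -> p != z -> pdiff W (fun w => (w - z)^-1) (- ((p - z) ^- 2)) p.
Proof.
move=> Wp pz; have := pdiffV Wp _ (pdiff_shift W z p).
by rewrite subr_eq0 => /(_ pz); rewrite div1r.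
Qed.

Lemma pdiff_inv2 W z p : W p -> p != z ->
  pdiff W (fun w => (w - z) ^- 2) (- 2 * (p - z) ^- 3) p.
Proof.
move=> Wp pz; have H := pdiff_inv Wp pz.
have -> : (fun w => (w - z) ^- 2) = (fun w => (w - z)^-1 * (w - z)^-1).
  by apply/funext => w; rewrite -invfM expr2.
have -> : - 2 * (p - z) ^- 3 = - ((p - z) ^- 2) * (p - z)^-1 + (p - z)^-1 * - ((p - z) ^- 2).
  by field; rewrite subr_eq0.
exact: pdiffM.
Qed.

Lemma ccont_inv z p k : p != z -> ccont (fun w => (w - z) ^- k) p.
Proof.
move=> pz; elim: k => [|k IH].
  by move=> e e0; exists 1 => // w _; rewrite !expr0 subrr nm0 ltW.
have H : ccont (fun w => (w - z)^-1) p.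
  by apply: (@pdiff_ccont _ setT) => //; apply: pdiff_inv.
have := ccontM H IH; congr ccont; apply/funext => w.
by rewrite exprS invfM.
Qed.

Lemma on_curve_inv z k : off_curve gamma z -> on_curve gamma (fun w => (w - z) ^- k).
Proof. by move=> oz t tP; apply: ccont_inv; exact: oz. Qed.

Lemma on_curve_kernel f z k : on_curve gamma f -> off_curve gamma z ->
  on_curve gamma (fun w => f w * (w - z) ^- k).
Proof. by move=> cf oz t tP; apply: ccontM; [exact: cf|exact: on_curve_inv]. Qed.

(** The kernel has the primitive [- 1 / (w - z)]. *)
Lemma cint_inv2 z : off_curve gamma z -> cint gamma (fun w => (w - z) ^- 2) = 0.
Proof.
move=> oz; apply: (@cint_primitive _ (fun w => - 1 * (w - z)^-1)).
  exact: on_curve_inv.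
move=> t tP; apply/pdiff_sdiff; have := pdiff_inv (I : setT (gamma t)) (oz t tP).
by move=> /(pdiffZ (-1)); rewrite mulN1r opprK.
Qed.

Lemma cint_inv3 z : off_curve gamma z -> cint gamma (fun w => (w - z) ^- 3) = 0.
Proof.
move=> oz; apply: (@cint_primitive _ (fun w => - 2^-1 * (w - z)^-2)).
  exact: on_curve_inv.
move=> t tP; apply/pdiff_sdiff; have := pdiff_inv2 (I : setT (gamma t)) (oz t tP).
move=> /(pdiffZ (- 2^-1)); congr pdiff.
by rewrite mulNr mulNr mulrN opprK mulrA mulVf ?mul1r // pnatr_eq0.
Qed.

Lemma curve_dist z : off_curve gamma z -> exists2 r, 0 < r &
  forall t, 0 <= t <= 1 -> r <= nm (gamma t - z).
Proof.
move=> oz; have [B B0 HB] := cont01_max (cont01_comp cg (on_curve_inv 1 oz)).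
have B1 : 0 < B + 1 by rewrite ltr_wpDl.
exists (B + 1)^-1; first by rewrite invr_gt0.
move=> t tP; have := HB t tP; rewrite expr1 nmV => k.
have gz : 0 < nm (gamma t - z) by rewrite nm_gt0 subr_eq0 oz.
rewrite -[leRHS]invrK lef_pV2 ?posrE ?invr_gt0 //; lra.
Qed.

(** Differentiation under the integral sign; the kernel is smooth in [z] away from
the curve, uniformly because the curve has positive distance from [z]. *)
Lemma cdiff_cauchy_integral f z : on_curve gamma f -> off_curve gamma z ->
  cdiff (fun z => cint gamma (fun w => f w * (w - z)^-1))
        (cint gamma (fun w => f w * (w - z) ^- 2)) z.
Proof.
move=> cf oz; have [r r0 rH] := curve_dist oz.
have [B B0 fB] := cont01_max (cont01_comp cg cf).
have L0 := length_ge0 rL.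
pose K := B * (r ^- 2 * (2 / r)) * L.
have K0 : 0 <= K by rewrite !mulr_ge0 ?invr_ge0 ?exprn_ge0 // ltW.
have far z' : nm (z' - z) < r / 2 -> forall t, 0 <= t <= 1 -> r / 2 <= nm (gamma t - z').
  move=> zz t tP; have := rH t tP; have := nm_tri (gamma t) z' z; lra.
have r2 : 0 < r / 2 by rewrite divr_gt0.
have off z' : nm (z' - z) < r / 2 -> off_curve gamma z'.
  by move=> zz t tP; rewrite -subr_eq0 -nm_gt0; apply: lt_le_trans r2 (far _ zz t tP).
move=> e e0; have K1 : 0 < K + 1 by rewrite ltr_wpDl.
exists (Num.min (r / 2) (e / (K + 1))); first by rewrite lt_min r2 divr_gt0.
move=> z' ; rewrite lt_min => /andP[zz ze].
have oz' := off _ zz.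
have c1 := @on_curve_kernel f z' 1 cf oz'.
have c0 := @on_curve_kernel f z 1 cf oz.
have c2 := @on_curve_kernel f z 2 cf oz.
have cZ : on_curve gamma (fun w => (z' - z) * (f w * (w - z) ^- 2)).
  move=> t tP; apply: ccontM (c2 t tP).
  by move=> e' e'0; exists 1 => // *; rewrite subrr nm0 ltW.
have cD : on_curve gamma (fun w => f w * (w - z')^-1 - f w * (w - z)^-1).
  move=> t tP e' e'0; have e'2 : 0 < e' / 2 by rewrite divr_gt0.
  have [s1 s10 S1] := c1 t tP _ e'2; have [s2 s20 S2] := c0 t tP _ e'2.
  exists (Num.min s1 s2); first by rewrite lt_min s10.
  move=> w; rewrite lt_min => /andP[/S1 k1 /S2 k2].
  have -> (a b c' d : C) : a - b - (c' - d) = (a - c') - (b - d) by ring.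
  by apply: le_trans (nmB _ _) _; rewrite (splitr e') lerD.
have cDD : on_curve gamma (fun w => f w * (w - z')^-1 - f w * (w - z)^-1 -
    (z' - z) * (f w * (w - z) ^- 2)).
  move=> t tP e' e'0; have e'2 : 0 < e' / 2 by rewrite divr_gt0.
  have [s1 s10 S1] := cD t tP _ e'2; have [s2 s20 S2] := cZ t tP _ e'2.
  exists (Num.min s1 s2); first by rewrite lt_min s10.
  move=> w; rewrite lt_min => /andP[/S1 k1 /S2 k2].
  have -> (a b c' d : C) : a - b - (c' - d) = (a - c') - (b - d) by ring.
  by apply: le_trans (nmB _ _) _; rewrite (splitr e') lerD.
rewrite [cint gamma (fun w => f w * (w - z) ^- 2) * _]mulrC.
rewrite -cintB // -cintZ // -cintB //.
set D := nm (z' - z).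
have D0 : 0 <= D := nm_ge0 _.
apply: (@le_trans _ _ (B * (r ^- 2 * (2 / r)) * (D * D) * L)).
  apply: cint_bound => //.
    by rewrite !mulr_ge0 ?invr_ge0 ?exprn_ge0 // ltW.
  move=> t tP; have n1 := oz t tP; have n2 := oz' t tP.
  have -> : f (gamma t) * (gamma t - z')^-1 - f (gamma t) * (gamma t - z)^-1 -
      (z' - z) * (f (gamma t) * (gamma t - z) ^- 2) =
      f (gamma t) * ((gamma t - z) ^- 2 * (gamma t - z')^-1) * ((z' - z) * (z' - z)).
    by field; rewrite !subr_eq0 n1 n2.
  rewrite !nmM -/D ler_wpM2r ?mulr_ge0 // ler_pM ?mulr_ge0 ?nm_ge0 //; first exact: fB.
  rewrite ler_pM ?nm_ge0 //.
    rewrite nmV nmX lef_pV2 ?posrE ?exprn_gt0 //; last by rewrite nm_gt0 subr_eq0.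
    by rewrite ler_pXn2r ?nnegrE ?nm_ge0 ?(ltW r0) // rH.
  rewrite nmV -[leRHS]invf_div lef_pV2 ?posrE //; last by rewrite nm_gt0 subr_eq0.
  exact: far.
have -> : B * (r ^- 2 * (2 / r)) * (D * D) * L = K * D * D by rewrite /K; ring.
rewrite -/D in ze; apply: ler_wpM2r => //.
apply: (@le_trans _ _ ((K + 1) * D)); first by rewrite ler_wpM2r // lerDl.
by rewrite mulrC -ler_pdivlMr // ltW.
Qed.

End curve.

Lemma segment_const f z0 z1 :
  (forall s : R, 0 <= s <= 1 -> cdiff f 0 (z0 + s%:C * (z1 - z0))) -> f z0 = f z1.
Proof.
move=> H; pose k s := f (z0 + s%:C * (z1 - z0)).
have : nm (k 1 - k 0) <= 0 * (1 - 0).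
  apply: mean_value => // s sP e e0.
  have d0 : 0 < nm (z1 - z0) + 1 by rewrite ltr_wpDl ?nm_ge0.
  have [r r0 rH] := H s sP _ (divr_gt0 e0 d0).
  exists (r / (nm (z1 - z0) + 1)); first by rewrite divr_gt0.
  move=> s' s'P; rewrite ltr_pdivlMr // => ss.
  have E : z0 + s'%:C * (z1 - z0) - (z0 + s%:C * (z1 - z0)) = (s' - s)%:C * (z1 - z0).
    by rewrite rmorphB /=; ring.
  have := rH (z0 + s'%:C * (z1 - z0)); rewrite mul0r subr0 E nmM nmR.
  move=> /(_ _) h; apply: le_trans (h _) _.
    by apply: le_lt_trans ss; rewrite ler_wpM2l // lerDl.
  rewrite add0r [leRHS]mulrC mulrCA ler_wpM2l //.
  by rewrite mulrAC -mulrA ler_piMr ?(ltW e0) // ler_pdivrMr // mul1r lerDl.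
rewrite mul0r => h; apply/esym/eqP; rewrite -subr_eq0 -nm_eq0 eq_le nm_ge0 andbT.
have E1 : z0 + 1%:C * (z1 - z0) = z1 by rewrite rmorph1; ring.
have E0 : z0 + 0%:C * (z1 - z0) = z0 by rewrite rmorph0; ring.
by move: h; rewrite /k E1 E0.
Qed.

(** This is [2 pi i] times the winding number. *)
Definition winding gamma z := cint gamma (fun w => (w - z)^-1).

(** The derivative is the integral of [(w - z)^-2], which has a primitive. *)
Lemma cdiff_winding gamma L z : length_le gamma L -> cont01 gamma -> gamma 0 = gamma 1 ->
  off_curve gamma z -> cdiff (winding gamma) 0 z.
Proof.
move=> rL cg cl oz.
have c1 : on_curve gamma (fun=> 1).
  by move=> t tP e e0; exists 1 => // *; rewrite subrr nm0 ltW.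
rewrite (_ : winding gamma = fun z => cint gamma (fun w => 1 * (w - z)^-1)); last first.
  by apply/funext => z'; apply: eq_cint => t _; rewrite mul1r.
rewrite (_ : 0 = cint gamma (fun w => 1 * (w - z) ^- 2)); last first.
  by rewrite -(cint_inv2 rL cg cl oz); apply: eq_cint => t _; rewrite mul1r.
exact: (cdiff_cauchy_integral rL cg c1 oz).
Qed.

Lemma winding_segment gamma L z0 z1 : length_le gamma L -> cont01 gamma -> gamma 0 = gamma 1 ->
  (forall s : R, 0 <= s <= 1 -> off_curve gamma (z0 + s%:C * (z1 - z0))) ->
  winding gamma z0 = winding gamma z1.
Proof.
move=> rL cg cl H; apply: segment_const => s sP.
by apply: cdiff_winding rL cg cl _; exact: H.
Qed.

End cauchy_kernel.

(** * Circles *)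

Section circle.
Variable R : realType.
Local Notation C := R[i].
Implicit Types (z w c : C) (e r x y t a d : R).

Lemma sin_lip x y : `|sin x - sin y| <= `|x - y|.
Proof.
wlog yx : x y / y <= x.
  by move=> H; have [/H//|/ltW /H] := leP y x; rewrite distrC (distrC y).
have [c _ ->] := @MVT_segment R sin cos y x yx (fun x _ => is_derive_sin x)
  (continuous_subspaceT (@continuous_sin R)).
by rewrite normrM ler_piMl // ler_norml cos_le1 cos_geN1.
Qed.

Lemma cos_lip x y : `|cos x - cos y| <= `|x - y|.
Proof.
wlog yx : x y / y <= x.
  by move=> H; have [/H//|/ltW /H] := leP y x; rewrite distrC (distrC y).
have [c _ ->] := @MVT_segment R cos (fun x => - sin x) y x yx (fun x _ => is_derive_cos x)
  (continuous_subspaceT (@continuous_cos R)).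
by rewrite normrM normrN ler_piMl // ler_norml sin_le1 sin_geN1.
Qed.

Definition cis t : C := cos t +i* sin t.

Lemma nm_cis t : nm (cis t) = 1.
Proof. by rewrite /nm /= cos2Dsin2 sqrtr1. Qed.

Lemma cis_neq0 t : cis t != 0.
Proof. by rewrite -nm_gt0 nm_cis. Qed.

Lemma cis_lip x y : nm (cis x - cis y) <= 2 * `|x - y|.
Proof.
apply: le_trans (nm_le_ReIm _) _; rewrite /cis !raddfB /= mulr2n mulrDl mul1r.
by rewrite lerD ?cos_lip ?sin_lip.
Qed.

(** A term of the Riemann-Stieltjes sum is compared with the tangent vector at its tag, with
an error of second order; this evaluates the integral over the circle. *)
Lemma cis_tangent x y t : y <= t -> t <= x ->
  nm (cis x - cis y - 'i * (x - y)%:C * cis t) <= 2 * (x - y) ^+ 2.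
Proof.
move=> yt tx; have yx := le_trans yt tx.
apply: le_trans (nm_le_ReIm _) _; rewrite /cis; simpc => /=.
have dist s : s \in `[y, x] -> `|t - s| <= x - y.
  by rewrite in_itv /= => /andP[? ?]; rewrite ler_norml; apply/andP; split; lra.
have xy0 : 0 <= x - y by rewrite subr_ge0.
rewrite (_ : 2 * (x - y) ^+ 2 = (x - y) ^+ 2 + (x - y) ^+ 2); last by ring.
apply: lerD.
  have [s sP ->] := @MVT_segment R cos (fun x => - sin x) y x yx
    (fun x _ => is_derive_cos x) (continuous_subspaceT (@continuous_cos R)).
  have -> : - sin s * (x - y) + (x - y) * sin t = (sin t - sin s) * (x - y) by ring.
  rewrite normrM (ger0_norm xy0) expr2 ler_wpM2r //.
  exact: le_trans (sin_lip _ _) (dist _ sP).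
have [s sP ->] := @MVT_segment R sin cos y x yx
    (fun x _ => is_derive_sin x) (continuous_subspaceT (@continuous_sin R)).
have -> : cos s * (x - y) - (x - y) * cos t = - ((cos t - cos s) * (x - y)) by ring.
rewrite normrN normrM (ger0_norm xy0) expr2 ler_wpM2r //.
exact: le_trans (cos_lip _ _) (dist _ sP).
Qed.

Definition circ c r t : C := c + r%:C * cis (2 * pi * t).

Lemma nm_circ c r t : 0 <= r -> nm (circ c r t - c) = r.
Proof.
by move=> r0; rewrite /circ addrC addKr nmM nm_cis mulr1 nmR ger0_norm.
Qed.

Lemma circ_lip c r x y : 0 <= r -> nm (circ c r x - circ c r y) <= 4 * pi * r * `|x - y|.
Proof.
move=> r0; have -> : circ c r x - circ c r y = r%:C * (cis (2 * pi * x) - cis (2 * pi * y)).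
  by rewrite /circ; ring.
rewrite nmM nmR ger0_norm //; apply: le_trans (ler_wpM2l r0 (cis_lip _ _)) _.
rewrite -mulrBr normrM ger0_norm ?mulr_ge0 ?pi_ge0 //.
by rewrite le_eqVlt; apply/orP; left; apply/eqP; ring.
Qed.

Lemma circ_cont c r : 0 <= r -> cont01 (circ c r).
Proof.
move=> r0 t _ e e0; have K0 : 0 < 4 * pi * r + 1 by rewrite ltr_wpDl // !mulr_ge0 ?pi_ge0.
exists (e / (4 * pi * r + 1)); first by rewrite divr_gt0.
move=> t' _; rewrite ltr_pdivlMr // => tt; apply: le_trans (circ_lip _ _ _ r0) _.
by apply: le_trans (ltW tt); rewrite mulrC ler_wpM2l // lerDl.
Qed.

Lemma circ_plen c r a (s : seq R) : 0 <= r -> path <%R a s ->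
  plen (circ c r) a s <= 4 * pi * r * (last a s - a).
Proof.
move=> r0; elim: s a => [|x s IH] a /=; first by rewrite subrr mulr0.
move=> /andP[ax /IH h].
have -> : 4 * pi * r * (last x s - a) = 4 * pi * r * `|x - a| + 4 * pi * r * (last x s - x).
  by rewrite gtr0_norm ?subr_gt0 //; ring.
by rewrite lerD // circ_lip.
Qed.

Lemma circ_length c r : 0 <= r -> length_le (circ c r) (4 * pi * r).
Proof.
by move=> r0 s [ps /eqP ls]; have := circ_plen c r0 ps; rewrite ls subr0 mulr1.
Qed.

Lemma circ_closed c r : circ c r 0 = circ c r 1.
Proof. by rewrite /circ /cis mulr0 mulr1 cos0 sin0 mulr_natl cos2pi sin2pi. Qed.

Lemma circ_off c r w : nm (w - c) < r -> off_curve (circ c r) w.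
Proof.
move=> wr t _; apply/eqP => E; have r0 : 0 <= r by apply: le_trans (ltW wr); exact: nm_ge0.
by have := nm_circ c t r0; rewrite E => h; rewrite h ltxx in wr.
Qed.

Lemma circ_rsum c r a (s : seq R) (tau : nat -> R) d : 0 < r -> path <%R a s ->
  mesh_lt d a s -> tagged a s tau ->
  nm (rsum (circ c r) (fun t => (circ c r t - c)^-1) a s tau
      - two_pi_i R * (last a s - a)%:C) <= 8 * pi ^+ 2 * d * (last a s - a).
Proof.
move=> r0; elim: s a tau => [|x s IH] a tau /=.
  by move=> _ _ _; rewrite !subrr rmorph0 !mulr0 subrr nm0.
move=> /andP[ax ps] [xd ms] [/andP[at0 t0x] ts].
have h := IH x (tau \o S) ps ms ts.
set A := _ * _ : C; set B := rsum _ _ _ _ _ in h *.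
have -> : A + B - two_pi_i R * (last x s - a)%:C =
  (A - two_pi_i R * (x - a)%:C) + (B - two_pi_i R * (last x s - x)%:C).
  by rewrite !rmorphB /=; ring.
have -> : 8 * pi ^+ 2 * d * (last x s - a) =
   8 * pi ^+ 2 * d * (x - a) + 8 * pi ^+ 2 * d * (last x s - x) by ring.
apply: le_trans (nmD _ _) _; rewrite lerD //.
have rC : r%:C != 0 :> C by rewrite -nm_gt0 nmR normr_gt0 gt_eqF.
set X := 2 * pi * x; set Y := 2 * pi * a; set T := 2 * pi * tau 0%N.
have -> : A - two_pi_i R * (x - a)%:C = (cis X - cis Y - 'i * (X - Y)%:C * cis T) * (cis T)^-1.
  rewrite /A /circ -/X -/Y -/T /two_pi_i.
  have -> : (X - Y)%:C = 2 * pi%:C * (x - a)%:C.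
    by rewrite /X /Y -mulrBr !rmorphM /= rmorph_nat.
  have -> : c + r%:C * cis T - c = r%:C * cis T by rewrite addrC addKr.
  by field; rewrite cis_neq0 -nm_gt0 nmR normr_gt0 gt_eqF.
rewrite nmM nmV nm_cis invr1 mulr1.
have pi0 := pi_ge0 R.
apply: le_trans (cis_tangent _ _) _; rewrite ?ler_wpM2l ?mulr_ge0 //.
have -> : 2 * (X - Y) ^+ 2 = 8 * pi ^+ 2 * (x - a) * (x - a) by rewrite /X /Y; ring.
rewrite ler_wpM2r ?subr_ge0 ?(ltW ax) // ler_wpM2l ?mulr_ge0 ?exprn_ge0 //.
exact: ltW.
Qed.

(** By [circ_rsum] the sums differ from [two_pi_i] by a multiple of the mesh. *)
Lemma winding_circ_center c r : 0 < r -> winding (circ c r) c = two_pi_i R.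
Proof.
move=> r0; apply: rsint_cint => e e0.
have K0 : 0 < 8 * pi ^+ 2 + 1 :> R by rewrite ltr_wpDl // mulr_ge0 // exprn_ge0 // pi_ge0.
exists (e / (8 * pi ^+ 2 + 1)); first by rewrite divr_gt0.
move=> s tau ps ms ts; have := circ_rsum c r0 ps.1 ms ts.
rewrite (eqP ps.2) subr0 rmorph1 mulr1 => h; apply: le_trans h _.
rewrite mulr1 mulrCA ler_piMr ?(ltW e0) // ler_pdivrMr //.
by rewrite mul1r lerDl.
Qed.

Lemma winding_circ c r w : 0 < r -> nm (w - c) < r -> winding (circ c r) w = two_pi_i R.
Proof.
move=> r0 wr; rewrite -(winding_circ_center c r0); apply/esym.
apply: (winding_segment (circ_length c (ltW r0)) (circ_cont c (ltW r0)) (circ_closed c r)).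
move=> s /andP[s0 s1]; apply: circ_off.
rewrite addrC addKr nmM nmR ger0_norm //.
by apply: le_lt_trans wr; rewrite ler_piMl ?nm_ge0.
Qed.

End circle.

(** * Cauchy formula on a circle *)

Section cauchy_on_circle.
Variable R : realType.
Local Notation C := R[i].
Implicit Types (z w c : C) (e r x y s t : R) (f g F G H : C -> C).

Lemma sdiff_affine H c w0 p s : 0 <= s <= 1 -> sdiff H c (w0 + s%:C * (p - w0)) ->
  sdiff (fun w => H (w0 + s%:C * (w - w0))) (s%:C * c) p.
Proof.
move=> /andP[s0 s1] HS e e0; have [r r0 rH] := HS e e0; exists r => // w w' wr w'r.
have E u u' : w0 + s%:C * (u - w0) - (w0 + s%:C * (u' - w0)) = s%:C * (u - u') by ring.
have N u : nm (s%:C * u) <= nm u by rewrite nmM nmR ger0_norm // ler_piMl ?nm_ge0.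
have := rH (w0 + s%:C * (w - w0)) (w0 + s%:C * (w' - w0)).
rewrite !E mulrCA mulrA => h; apply: le_trans (h _ _) _.
- exact: le_lt_trans (N _) wr.
- exact: le_lt_trans (N _) w'r.
- by rewrite ler_wpM2l // ltW.
Qed.

Lemma sdiff_ccont H c z : sdiff H c z -> ccont H z.
Proof. by move=> /pdiff_sdiff; exact: pdiff_ccont. Qed.

Lemma ccont_cst (k : C) z : ccont (fun=> k) z.
Proof. by move=> e e0; exists 1 => // *; rewrite subrr nm0 ltW. Qed.

Lemma ccontB f g z : ccont f z -> ccont g z -> ccont (fun w => f w - g w) z.
Proof.
move=> Hf Hg e e0; have e2 : 0 < e / 2 by rewrite divr_gt0.
have [s1 s10 S1] := Hf _ e2; have [s2 s20 S2] := Hg _ e2.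
exists (Num.min s1 s2); first by rewrite lt_min s10.
move=> w; rewrite lt_min => /andP[/S1 k1 /S2 k2].
have -> (a b c' d : C) : a - b - (c' - d) = (a - c') - (b - d) by ring.
by apply: le_trans (nmB _ _) _; rewrite (splitr e) lerD.
Qed.

Lemma ccont_affine G w0 p s : 0 <= s <= 1 -> ccont G (w0 + s%:C * (p - w0)) ->
  ccont (fun w => G (w0 + s%:C * (w - w0))) p.
Proof.
move=> /andP[s0 s1] HS e e0; have [r r0 rH] := HS e e0; exists r => // w wr.
apply: rH; have -> : w0 + s%:C * (w - w0) - (w0 + s%:C * (p - w0)) = s%:C * (w - p) by ring.
by apply: le_lt_trans wr; rewrite nmM nmR ger0_norm // ler_piMl ?nm_ge0.
Qed.

Section formula.
Variables (H G : C -> C) (z0 : C) (r : R).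
Hypotheses (r0 : 0 < r).
Hypothesis HG : forall w, nm (w - z0) <= r -> sdiff H (G w) w.
Hypothesis cG : forall w, nm (w - z0) <= r -> ccont G w.
Let gamma := circ z0 r.
Let rL := circ_length z0 (ltW r0).
Let cg := circ_cont z0 (ltW r0).
Let cl := circ_closed z0 r.

Variable w0 : C.
Hypothesis w0r : nm (w0 - z0) < r.
Let off : off_curve gamma w0 := circ_off w0r.
Let pt (s : R) (w : C) := w0 + s%:C * (w - w0).

Let pt_in s t : 0 <= s <= 1 -> nm (pt s (gamma t) - z0) <= r.
Proof.
move=> /andP[s0 s1]; have -> : pt s (gamma t) - z0 =
  (1 - s)%:C * (w0 - z0) + s%:C * (gamma t - z0) by rewrite /pt rmorphB rmorph1 /=; ring.
apply: le_trans (nmD _ _) _; rewrite !nmM !nmR (nm_circ _ _ (ltW r0)).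
rewrite !ger0_norm ?subr_ge0 //.
have : (1 - s) * nm (w0 - z0) <= (1 - s) * r by rewrite ler_wpM2l ?subr_ge0 // ltW.
by move=> h; rewrite -lerBrDr; apply: le_trans h _; rewrite mulrBl mul1r.
Qed.

Let K s := cint gamma (fun w => H (pt s w) * (w - w0)^-1).

Let on_K s : 0 <= s <= 1 -> on_curve gamma (fun w => H (pt s w) * (w - w0)^-1).
Proof.
move=> sP t tP; apply: ccontM.
  by apply: ccont_affine => //; apply: sdiff_ccont; apply: HG; exact: pt_in.
exact: (@ccont_inv R w0 (gamma t) 1 (off tP)).
Qed.

Let on_G s : 0 <= s <= 1 -> on_curve gamma (fun w => G (pt s w)).
Proof. by move=> sP t tP; apply: ccont_affine => //; apply: cG; exact: pt_in. Qed.

Let int_G s : 0 <= s <= 1 -> cint gamma (fun w => G (pt s w)) = 0.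
Proof.
move=> sP; have [s0|s0] := eqVneq s 0.
  rewrite (_ : (fun w => G (pt s w)) = fun=> G w0); last first.
    by apply/funext => w; rewrite /pt s0 rmorph0 mul0r addr0.
  apply: (cint_primitive (F := fun w => G w0 * w) rL cg cl).
    by move=> t tP; exact: ccont_cst.
  move=> t tP; apply/pdiff_sdiff; rewrite -[X in pdiff _ _ X]mulr1.
  by apply: pdiffZ; exact: pdiff_id.
apply: (cint_primitive (F := fun w => s%:C^-1 * H (pt s w)) rL cg cl).
  exact: on_G.
move=> t tP; apply/pdiff_sdiff.
have sC : s%:C != 0 :> C by rewrite -nm_gt0 nmR normr_gt0.
rewrite -[G _](mulKf sC); apply: pdiffZ; apply/pdiff_sdiff.
by apply: sdiff_affine => //; apply: HG; exact: pt_in.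
Qed.

Let unif s e : 0 <= s <= 1 -> 0 < e -> exists2 d, 0 < d & forall t s', 0 <= t <= 1 ->
  0 <= s' <= 1 -> `|s' - s| < d ->
  nm (H (pt s' (gamma t)) - H (pt s (gamma t)) -
      G (pt s (gamma t)) * (pt s' (gamma t) - pt s (gamma t))) <=
  e * nm (pt s' (gamma t) - pt s (gamma t)).
Proof.
move=> sP e0; have e2 : 0 < e / 2 by rewrite divr_gt0.
pose Q t0 q := forall t s', 0 <= t <= 1 -> 0 <= s' <= 1 -> `|t - t0| < q -> `|s' - s| < q ->
  nm (H (pt s' (gamma t)) - H (pt s (gamma t)) -
      G (pt s (gamma t)) * (pt s' (gamma t) - pt s (gamma t))) <=
  e * nm (pt s' (gamma t) - pt s (gamma t)).
have dpt s1 s2 w : pt s1 w - pt s2 w = (s1 - s2)%:C * (w - w0).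
  by rewrite /pt rmorphB /=; ring.
have dist t : nm (gamma t - w0) <= 2 * r.
  apply: le_trans (nm_tri _ z0 _) _; rewrite nm_circ ?(ltW r0) // nmC.
  by have := ltW w0r; lra.
have [|d d0 dH] := @lebesgue_number R Q.
  move=> t0 t0P; have p0 := pt_in t0 sP.
  have [q1 q10 H1] := HG p0 e2; have [q2 q20 H2] := cG p0 e2.
  pose q := Num.min q1 q2.
  have q0 : 0 < q by rewrite lt_min q10.
  have q3 : 0 < q / 3 by rewrite divr_gt0.
  have [q4 q40 H4] := cg t0P q3.
  exists (Num.min q4 (q / (6 * r))).
    by rewrite lt_min q40 divr_gt0 // mulr_gt0.
  move=> t s' tP s'P; rewrite !lt_min => /andP[tt _] /andP[_ ss].
  have k1 : nm (pt s (gamma t) - pt s (gamma t0)) <= q / 3.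
    have -> : pt s (gamma t) - pt s (gamma t0) = s%:C * (gamma t - gamma t0).
      by rewrite /pt; ring.
    move: sP => /andP[s0 s1]; rewrite nmM nmR ger0_norm //.
    by apply: le_trans (H4 t tP tt); rewrite ler_piMl ?nm_ge0.
  have k2 : nm (pt s' (gamma t) - pt s (gamma t)) <= q / 3.
    rewrite dpt nmM nmR; apply: le_trans (ler_pM _ _ (ltW ss) (dist t)) _;
      rewrite ?nm_ge0 //.
    by rewrite le_eqVlt; apply/orP; left; apply/eqP; field; rewrite gt_eqF.
  have k3 : nm (pt s (gamma t) - pt s (gamma t0)) < q by lra.
  have k4 : nm (pt s' (gamma t) - pt s (gamma t0)) < q.
    by have := nm_tri (pt s' (gamma t)) (pt s (gamma t)) (pt s (gamma t0)); lra.
  have [k31 k32] : nm (pt s (gamma t) - pt s (gamma t0)) < q1 /\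
    nm (pt s (gamma t) - pt s (gamma t0)) < q2 by move: k3; rewrite lt_min => /andP[].
  have k41 : nm (pt s' (gamma t) - pt s (gamma t0)) < q1 by move: k4; rewrite lt_min => /andP[].
  have m1 := H1 _ _ k41 k31; have m2 := H2 _ k32.
  rewrite (splitr e) mulrDl.
  set A := H _ - H _ in m1 *; set B := pt s' _ - pt s _ in m1 *.
  rewrite (_ : A - _ * B = (A - G (pt s (gamma t0)) * B)
     - (G (pt s (gamma t)) - G (pt s (gamma t0))) * B); last by ring.
  apply: le_trans (nmB _ _) _; rewrite lerD //.
  by rewrite nmM ler_wpM2r ?nm_ge0.
exists d => // t s' tP s'P ss.
have [t0 [q [t0P Qt sub]]] := dH t tP.
apply: Qt => //; first by apply: sub; rewrite subrr normr0.
have h1 : `|t + `|s' - s| - t0| < q by apply: sub; rewrite addrC addKr normr_id.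
have h2 : `|t - `|s' - s| - t0| < q.
  by apply: sub; rewrite addrAC subrr sub0r normrN normr_id.
move: h1; rewrite ltr_norml => /andP[_ h1]; move: h2; rewrite ltr_norml => /andP[h2 _].
by lra.
Qed.

(** Let [K s] be the integral of
[H (w0 + s (w - w0)) / (w - w0)]. It is [H w0] times the winding integral for
[s = 0] and the integral in the statement for [s = 1]. Its derivative at
[s] is the integral of [G (w0 + s (w - w0))], which vanishes because
this function has the primitive [s^-1 H (w0 + s (w - w0))]. *)
Lemma cauchy_formula_circle :
  cint gamma (fun w => H w * (w - w0)^-1) = two_pi_i R * H w0.
Proof.
have K1 : K 1 = cint gamma (fun w => H w * (w - w0)^-1).
  by apply: eq_cint => t _; rewrite /pt rmorph1 mul1r addrC subrK.
have K0 : K 0 = two_pi_i R * H w0.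
  rewrite -(winding_circ r0 w0r) [RHS]mulrC -(cintZ rL cg); last first.
    exact: (@on_curve_inv R gamma w0 1 off).
  by apply: eq_cint => t _; rewrite /pt rmorph0 mul0r addr0.
rewrite -K1 -K0; apply/eqP; rewrite -subr_eq0 -nm_eq0 eq_le nm_ge0 andbT.
rewrite -[leRHS](mul0r (1 - 0)); apply: mean_value => // s sP e e0.
have L0 := length_ge0 rL; have L1 : 0 < 4 * pi * r + 1 by rewrite ltr_wpDl.
have [d d0 dH] := unif sP (divr_gt0 e0 L1).
exists d => // s' s'P ss; rewrite add0r.
have -> : K s' - K s = cint gamma (fun w => H (pt s' w) * (w - w0)^-1 -
   H (pt s w) * (w - w0)^-1 - (s' - s)%:C * G (pt s w)).
  rewrite (cintB rL cg); last 2 first.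
  - by move=> t tP; apply: ccontB; [exact: on_K s'P t tP|exact: on_K sP t tP].
  - by move=> t tP; apply: ccontM; [exact: ccont_cst|exact: on_G sP t tP].
  rewrite (cintB rL cg (on_K s'P) (on_K sP)) (cintZ rL cg _ (on_G sP)).
  by rewrite int_G // mulr0 subr0.
apply: (@le_trans _ _ (e / (4 * pi * r + 1) * `|s' - s| * (4 * pi * r))); last first.
  move: (4 * pi * r) (`|s' - s|) (normr_ge0 (s' - s)) L0 L1 => X y y0 X0 X1.
  have -> : e / (X + 1) * y * X = e * y * (X / (X + 1)) by field; rewrite gt_eqF.
  by rewrite ler_piMr ?mulr_ge0 ?(ltW e0) // ler_pdivrMr // mul1r lerDl.
apply: (cint_bound rL cg).
- move=> t tP; apply: ccontB.
    by apply: ccontB; [exact: on_K s'P t tP|exact: on_K sP t tP].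
  by apply: ccontM; [exact: ccont_cst|exact: on_G sP t tP].
- by rewrite mulr_ge0 // divr_ge0 // ltW.
move=> t tP; have n0 : gamma t - w0 != 0 by rewrite subr_eq0; exact: off.
have dpt : pt s' (gamma t) - pt s (gamma t) = (s' - s)%:C * (gamma t - w0).
  by rewrite /pt rmorphB /=; ring.
have := dH t s' tP s'P ss.
have -> : H (pt s' (gamma t)) / (gamma t - w0) - H (pt s (gamma t)) / (gamma t - w0) -
    (s' - s)%:C * G (pt s (gamma t)) =
  (H (pt s' (gamma t)) - H (pt s (gamma t)) -
      G (pt s (gamma t)) * (pt s' (gamma t) - pt s (gamma t))) * (gamma t - w0)^-1.
  by rewrite dpt; field.
rewrite nmM nmV => h; rewrite ler_pdivrMr ?nm_gt0 //; apply: le_trans h _.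
by rewrite dpt nmM nmR mulrA.
Qed.

End formula.

End cauchy_on_circle.

(** * Taylor expansions and the theorem of Tolstov *)

Section taylor_expansion.
Variable R : realType.
Local Notation C := R[i].
Implicit Types (z w c : C) (e r x y s t M q : R) (f g F G H : C -> C) (a : nat -> C).

Definition psum a n w : C := \sum_(k < n) a k * w ^+ k.

Lemma psumS a n w : psum a n.+1 w = psum a n w + a n * w ^+ n.
Proof. by rewrite /psum big_ord_recr. Qed.

(** [F] has the Taylor coefficients [a] at [z], with geometric bounds of the remainders of
all orders. From these bounds, estimates of the coefficients, Lipschitz constants and
expansions of derivatives are read off directly. *)
Definition taylor F z a M q := forall w n, q * nm (w - z) <= 2^-1 ->
  nm (F w - psum a n (w - z)) <= M * (q * nm (w - z)) ^+ n.

Section circle_expansion.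
Variables (H : C -> C) (z0 : C) (r : R).
Hypothesis r0 : 0 < r.
Hypothesis cH : on_curve (circ z0 r) H.
Hypothesis formula : forall w, nm (w - z0) < r ->
  cint (circ z0 r) (fun u : C => H u * (u - w)^-1) = two_pi_i R * H w.

Lemma two_pi_i_neq0 : two_pi_i R != 0.
Proof.
rewrite /two_pi_i -nm_gt0 !nmM nmi mulr1 (nm_nat R 2) nmR.
by rewrite gtr0_norm ?pi_gt0 // mulr_gt0 // pi_gt0.
Qed.

(** Expanding the Cauchy kernel into a finite geometric sum leaves as
remainder the integral of [H u ((w - z0) / (u - z0))^n / (u - w)]. *)
Lemma taylor_circle : exists a M, 0 <= M /\ taylor H z0 a M r^-1.
Proof.
pose gamma := circ z0 r; have rL := circ_length z0 (ltW r0).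
have cg := circ_cont z0 (ltW r0).
have oz : off_curve gamma z0 by apply: circ_off; rewrite subrr nm0.
have [B B0 HB] := cont01_max (cont01_comp cg cH).
pose a k := (two_pi_i R)^-1 * cint gamma (fun u : C => H u * (u - z0) ^- k.+1).
pose N := nm (two_pi_i R)^-1.
exists a, (N * (B * (2 / r) * (4 * pi * r))); split.
  by rewrite !mulr_ge0 ?nm_ge0 ?invr_ge0 ?pi_ge0 // ltW.
move=> w n; rewrite mulrC ler_pdivrMr // mulrC => wr.
have wr1 : nm (w - z0) < r by apply: le_lt_trans wr _; rewrite gtr_pMl // invf_lt1 ?ltr1n.
have ow : off_curve gamma w by exact: circ_off.
have fH : H w = (two_pi_i R)^-1 * cint gamma (fun u : C => H u * (u - w)^-1).
  by rewrite formula // mulKf // two_pi_i_neq0.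
have onk k : on_curve gamma (fun u : C => (w - z0) ^+ k * (H u * ((u - z0) ^- k * (u - w)^-1))).
  move=> t tP; apply: ccontM; first exact: ccont_cst.
  apply: ccontM; first exact: cH.
  apply: ccontM; first by apply: ccont_inv; exact: oz.
  exact: (@ccont_inv R w (gamma t) 1 (ow t tP)).
have E k : H w - psum a k (w - z0) = (two_pi_i R)^-1 *
    cint gamma (fun u : C => (w - z0) ^+ k * (H u * ((u - z0) ^- k * (u - w)^-1))).
  elim: k => [|k IH].
    rewrite /psum big_ord0 subr0 fH; congr (_ * _); apply: eq_cint => t _.
    by rewrite !expr0 invr1 !mul1r.
  rewrite psumS opprD addrA IH /a -[X in _ - X]mulrA -mulrBr; congr (_ * _).
  have onk' : on_curve gamma (fun u : C => H u * (u - z0) ^- k.+1).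
    exact: on_curve_kernel.
  rewrite [_ * (w - z0) ^+ k]mulrC -(cintZ rL cg _ onk') -(cintB rL cg) //; last first.
    by move=> t tP; apply: ccontM; [exact: ccont_cst|exact: onk'].
  apply: eq_cint => t tP; have := oz t tP; have := ow t tP => n1 n2.
  rewrite !exprS; field; rewrite !subr_eq0 n1 n2 expf_neq0 // subr_eq0 //.
rewrite E nmM -mulrA ler_wpM2l ?nm_ge0 //.
rewrite [leRHS](_ : _ = B * (2 / r) * (r^-1 * nm (w - z0)) ^+ n * (4 * pi * r)); last by ring.
apply: (cint_bound rL cg (onk n)).
  by rewrite !mulr_ge0 ?invr_ge0 ?exprn_ge0 ?mulr_ge0 ?nm_ge0 ?invr_ge0 // ltW.
move=> t tP; have dt : nm (gamma t - z0) = r by apply: nm_circ; exact: ltW.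
have dw : r / 2 <= nm (gamma t - w).
  by have := nm_tri (gamma t) w z0; rewrite dt; lra.
rewrite !nmM !nmV !nmX dt exprMn exprVn.
have -> : nm (w - z0) ^+ n * (nm (H (gamma t)) * ((r ^+ n)^-1 * (nm (gamma t - w))^-1)) =
  nm (H (gamma t)) * (nm (gamma t - w))^-1 * ((r ^+ n)^-1 * nm (w - z0) ^+ n) by ring.
rewrite ler_wpM2r ?mulr_ge0 ?invr_ge0 ?exprn_ge0 ?nm_ge0 ?(ltW r0) //.
rewrite ler_pM ?invr_ge0 ?nm_ge0 //; first exact: HB.
rewrite -[leRHS]invf_div lef_pV2 ?posrE ?divr_gt0 //.
by apply: lt_le_trans dw; rewrite divr_gt0.
Qed.

End circle_expansion.

Section expansion.
Variables (F : C -> C) (z : C) (a : nat -> C) (M q : R).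
Hypotheses (q0 : 0 < q) (M0 : 0 <= M) (HF : taylor F z a M q).

(** The term of order [n] is the difference of two consecutive remainders; it is
evaluated at distance [1 / (2 q)]. *)
Lemma taylor_coef n : nm (a n) <= 2 * M * q ^+ n.
Proof.
have h : nm (((2 * q)^-1)%:C : C) = (2 * q)^-1 by rewrite nmR ger0_norm // invr_ge0 mulr_ge0 // ltW.
have E : z + ((2 * q)^-1)%:C - z = ((2 * q)^-1)%:C by rewrite addrC addKr.
have qh : q * (2 * q)^-1 = 2^-1 by field; rewrite gt_eqF.
have := HF (w := z + ((2 * q)^-1)%:C) n; have := HF (w := z + ((2 * q)^-1)%:C) n.+1.
rewrite E h qh => /(_ (lexx _)) k1 /(_ (lexx _)) k2.
rewrite psumS in k1.
have k3 : nm (a n * ((2 * q)^-1)%:C ^+ n) <= M * 2^-1 ^+ n.+1 + M * 2^-1 ^+ n.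
  have -> : a n * ((2 * q)^-1)%:C ^+ n = (F (z + ((2 * q)^-1)%:C) - psum a n ((2 * q)^-1)%:C)
    - (F (z + ((2 * q)^-1)%:C) - (psum a n ((2 * q)^-1)%:C + a n * ((2 * q)^-1)%:C ^+ n)) by ring.
  by apply: le_trans (nmB _ _) _; rewrite addrC lerD.
rewrite nmM nmX h in k3.
have p0 : 0 < (2 * q) ^+ n by rewrite exprn_gt0 // mulr_gt0.
rewrite [((2 * q)^-1) ^+ n]exprVn ler_pdivrMr // in k3; apply: le_trans k3 _.
rewrite exprMn exprS !exprVn mulrDl.
have t0 : (2 : R) ^+ n != 0 by rewrite expf_neq0 // pnatr_eq0.
have -> : M * (2^-1 / 2 ^+ n) * (2 ^+ n * q ^+ n) + M / 2 ^+ n * (2 ^+ n * q ^+ n) =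
   3 / 2 * (M * q ^+ n) by field.
rewrite -[leRHS]mulrA ler_wpM2r ?mulr_ge0 ?exprn_ge0 ?(ltW q0) //; lra.
Qed.

Lemma pow_diff (w w' : C) x n : nm w <= x -> nm w' <= x ->
  nm (w ^+ n - w' ^+ n) <= n%:R * x ^+ n.-1 * nm (w - w').
Proof.
move=> wx w'x; have x0 : 0 <= x by apply: le_trans wx; exact: nm_ge0.
rewrite subrXX nmM mulrC ler_wpM2r ?nm_ge0 //.
apply: le_trans (nm_sum _ _ _) _.
have -> : n%:R * x ^+ n.-1 = \sum_(i < n) x ^+ n.-1.
  by rewrite sumr_const card_ord mulr_natl.
apply: ler_sum => i _; rewrite nmM !nmX.
have E : n.-1 = (n.-1 - i + i)%N.
  by rewrite subnK // -ltnS (ltn_predK (ltn_ord i)).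
by rewrite [in leRHS]E exprD ler_pM ?exprn_ge0 ?nm_ge0 // lerXn2r ?nnegrE ?nm_ge0.
Qed.

(** The difference of the remainders at two points is the sum of the
differences of the later terms of the expansion; these are bounded by
[taylor_coef] and [pow_diff], with a geometric series as sum. *)
Lemma taylor_lip n w w' x : x <= 4^-1 -> q * nm (w - z) <= x -> q * nm (w' - z) <= x ->
  nm ((F w - psum a n.+1 (w - z)) - (F w' - psum a n.+1 (w' - z))) <=
  4 * M * q * (2 * x) ^+ n * nm (w - w').
Proof.
move=> x4 wx w'x; have x0 : 0 <= x.
  by apply: le_trans wx; rewrite mulr_ge0 ?nm_ge0 // ltW.
set D := nm (w - w'); have D0 : 0 <= D := nm_ge0 _.
have wq : nm (w - z) <= x / q by rewrite ler_pdivlMr // mulrC.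
have w'q : nm (w' - z) <= x / q by rewrite ler_pdivlMr // mulrC.
have term k : nm (a k * (w - z) ^+ k - a k * (w' - z) ^+ k) <=
    2 * M * q * (2 * x) ^+ k.-1 * D.
  rewrite -mulrBr nmM.
  have := pow_diff k wq w'q; rewrite opprD opprK addrACA addNr addr0 -/D => pk.
  apply: le_trans (ler_pM (nm_ge0 _) (nm_ge0 _) (taylor_coef k) pk) _.
  rewrite mulrA ler_wpM2r //.
  case: k {pk} => [|k] /=; first by rewrite mul0r mulr0 !mulr_ge0 ?exprn_ge0 // ?mulr_ge0 // ltW.
  have -> : 2 * M * q ^+ k.+1 * (k.+1%:R * (x / q) ^+ k) = 2 * M * q * (k.+1%:R * x ^+ k).
    by rewrite exprMn exprVn exprS; field; rewrite expf_neq0 // gt_eqF.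
  rewrite ler_wpM2l ?mulr_ge0 ?(ltW q0) // exprMn ler_wpM2r ?exprn_ge0 //.
  by rewrite -natrX ler_nat; exact: ltn_expl.
have fin m : nm ((psum a (n.+1 + m) (w - z) - psum a n.+1 (w - z)) -
    (psum a (n.+1 + m) (w' - z) - psum a n.+1 (w' - z))) <=
    4 * M * q * (2 * x) ^+ n * (1 - 2^-1 ^+ m) * D.
  elim: m => [|m IH]; first by rewrite addn0 !subrr nm0 !mulr0 mul0r.
  rewrite addnS !(psumS a (n.+1 + m)).
  set A := psum _ (n.+1 + m) _; set B := psum _ n.+1 _; set A' := psum _ (n.+1 + m) _; set B' := psum _ n.+1 _.
  set u := a _ * _; set u' := a _ * _.
  have -> : A + u - B - (A' + u' - B') = (A - B - (A' - B')) + (u - u') by ring.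
  apply: le_trans (nmD _ _) _; apply: le_trans (lerD IH (term _)) _.
  rewrite -mulrDl ler_wpM2r // addSn /= exprD exprS.
  have p0 : 0 <= 4 * M * q * (2 * x) ^+ n.
    by rewrite !mulr_ge0 ?exprn_ge0 ?mulr_ge0 // ltW.
  have xm : (2 * x) ^+ m <= 2^-1 ^+ m.
    by rewrite lerXn2r ?nnegrE ?mulr_ge0 ?invr_ge0 //; lra.
  have := ler_wpM2l p0 xm.
  move: (_ ^+ m) (_ ^+ m) => X Y h; move: p0 h.
  have -> : 2 * M * q * ((2 * x) ^+ n * Y) = 4 * M * q * (2 * x) ^+ n * Y / 2 by field.
  by move: (4 * M * q * (2 * x) ^+ n) => Z Z0 h; lra.
apply/ler_addgt0Pr => e e0.
have [m me] : exists m, 2 * M * x ^+ (n.+1 + m) <= e.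
  have M1 : 0 < 2 * M + 1 by rewrite ltr_wpDl // mulr_ge0.
  have [m mm] := small_inv (divr_gt0 e0 M1).
  exists m.+1; have xh : x ^+ (n.+1 + m.+1) <= m.+1%:R^-1.
    apply: (@le_trans _ _ (2^-1 ^+ (n.+1 + m.+1))).
      by rewrite lerXn2r ?nnegrE ?invr_ge0 //; lra.
    rewrite exprVn lef_pV2 ?posrE ?exprn_gt0 // -natrX ler_nat.
    apply: leq_trans (ltnW (ltn_expl m.+1 (isT : 1 < 2)%N)) _.
    by rewrite leq_exp2l // leq_addl.
  apply: (@le_trans _ _ ((2 * M + 1) * m.+1%:R^-1)).
    by rewrite ler_pM ?mulr_ge0 ?exprn_ge0 //; lra.
  by rewrite mulrC -ler_pdivlMr // ltW.
have small u : q * nm (u - z) <= x -> nm (F u - psum a (n.+1 + m) (u - z)) <= M * x ^+ (n.+1 + m).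
  move=> ux; apply: le_trans (HF _ _) _; first by lra.
  by rewrite ler_wpM2l // lerXn2r ?nnegrE ?mulr_ge0 ?nm_ge0 // ltW.
have s1 := small _ wx; have s2 := small _ w'x.
set A := psum a n.+1 _; set A' := psum a n.+1 _.
have -> : F w - A - (F w' - A') =
  (psum a (n.+1 + m) (w - z) - A - (psum a (n.+1 + m) (w' - z) - A')) +
  ((F w - psum a (n.+1 + m) (w - z)) - (F w' - psum a (n.+1 + m) (w' - z))) by ring.
apply: le_trans (nmD _ _) _; apply: lerD; last first.
  apply: le_trans (nmB _ _) _; apply: le_trans (lerD s1 s2) _.
  by apply: le_trans me; rewrite -mulrA mulr2n mulrDl !mul1r.
apply: le_trans (fin m) _; rewrite ler_wpM2r //.
rewrite ler_piMr ?mulr_ge0 ?exprn_ge0 ?mulr_ge0 ?(ltW q0) //.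
Qed.

End expansion.

Lemma psum0 a n : psum a n.+1 0 = a 0%N.
Proof.
rewrite /psum big_ord_recl /= expr0 mulr1 big1 ?addr0 // => i _.
by rewrite exprS mul0r mulr0.
Qed.

Lemma taylor_center F z a M q : taylor F z a M q -> F z = a 0%N.
Proof.
move=> H; apply/eqP; rewrite -subr_eq0 -nm_eq0 eq_le nm_ge0 andbT.
have := H z 1%N; rewrite subrr nm0 mulr0 psum0 expr1 mulr0; apply.
by rewrite invr_ge0.
Qed.

Lemma pdiff_pow W z p k : W p -> pdiff W (fun w => (w - z) ^+ k) (k%:R * (p - z) ^+ k.-1) p.
Proof.
move=> Wp; elim: k => [|k IH].
  by rewrite mul0r; exact: pdiff_cst.
have := pdiffM Wp (pdiff_shift W z p) IH.
have -> : (fun w : C => (w - z) * (w - z) ^+ k) = (fun w => (w - z) ^+ k.+1).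
  by apply/funext => w; rewrite exprS.
congr pdiff; case: k {IH} => [|k]; first by ring.
by rewrite -[k.+2%:R]natr1 /= exprS; ring.
Qed.

Lemma pdiff_psum W z p a n : W p ->
  pdiff W (fun w => psum a n.+1 (w - z)) (psum (fun k => k.+1%:R * a k.+1) n (p - z)) p.
Proof.
move=> Wp; elim: n => [|n IH].
  have -> : (fun w : C => psum a 1 (w - z)) = (fun=> a 0%N).
    by apply/funext => w; rewrite /psum big_ord1 expr0 mulr1.
  by rewrite /psum big_ord0; exact: pdiff_cst.
have -> : (fun w : C => psum a n.+2 (w - z)) =
    (fun w => psum a n.+1 (w - z) + a n.+1 * (w - z) ^+ n.+1).
  by apply/funext => w; rewrite psumS.
rewrite psumS [_ * a n.+1]mulrC -mulrA.
by apply: pdiffD => //; apply: pdiffZ; exact: pdiff_pow.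
Qed.

Lemma axdiffB f g c d z : axdiff f c z -> axdiff g d z -> axdiff (fun w => f w - g w) (c - d) z.
Proof.
move=> Hf Hg e e0; have e2 : 0 < e / 2 by rewrite divr_gt0.
have [r r0 rH] := Hf _ e2; have [r' r'0 rH'] := Hg _ e2.
exists (Num.min r r'); first by rewrite lt_min r0.
move=> h; rewrite lt_min => /andP[/rH [h1 h2] /rH' [h3 h4]].
have E (u u' v v' k : C) : u - v - (u' - v') - (c - d) * k = (u - u' - c * k) - (v - v' - d * k) by ring.
by rewrite !E (splitr e) mulrDl; split; apply: le_trans (nmB _ _) _; exact: lerD.
Qed.

(** A derivative is bounded by any local Lipschitz constant. *)
Lemma axdiff_bound f c z K r : 0 < r -> axdiff f c z ->
  (forall w, nm (w - z) < r -> nm (f w - f z) <= K * nm (w - z)) -> nm c <= K.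
Proof.
move=> r0 H fK; apply/ler_addgt0Pr => e e0; have [r' r'0 rH] := H e e0.
pose h := Num.min r r' / 2.
have m0 : 0 < Num.min r r' by rewrite lt_min r0.
have h0 : 0 < h by rewrite divr_gt0.
have [hr hr'] : h < r /\ h < r'.
  have hm : h < Num.min r r' by rewrite /h; lra.
  by move: hm; rewrite lt_min => /andP[].
have nh : nm (h%:C : C) = h by rewrite nmR gtr0_norm.
have [k _] := rH h ltac:(by rewrite gtr0_norm); rewrite gtr0_norm // in k.
have := fK (z + h%:C); rewrite [z + _]addrC addrK nh addrC => /(_ hr) k2.
rewrite -(ler_pM2r h0) -[X in _ * X]nh -nmM.
have -> : c * h%:C = (f (z + h%:C) - f z) - (f (z + h%:C) - f z - c * h%:C) by ring.
by apply: le_trans (nmB _ _) _; rewrite mulrDl lerD.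
Qed.

(** The remainder of order [n] of [D] is the derivative of the remainder of order
[n + 1] of [F], so it is bounded by the Lipschitz constant of the latter given
by [taylor_lip]. *)
Lemma taylor_deriv F D z a M q s : 0 < q -> 0 <= M -> 0 < s -> taylor F z a M q ->
  (forall w, nm (w - z) < s -> axdiff F (D w) w) ->
  exists M' q', [/\ 0 <= M', 0 < q' & taylor D z (fun k => k.+1%:R * a k.+1) M' q'].
Proof.
move=> q0 M0 s0 HF FD; exists (4 * M * q), (8 * q + s^-1).
have is0 : 0 < s^-1 by rewrite invr_gt0.
have K0 : 0 <= 4 * M * q by rewrite !mulr_ge0 // ltW.
have q'0 : 0 < 8 * q + s^-1 by rewrite addr_gt0 // mulr_gt0.
split => // w n; set o := nm (w - z); have o0 : 0 <= o := nm_ge0 _.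
rewrite mulrDl => ho.
have ws : o < s.
  have : s^-1 * o <= 2^-1 by apply: le_trans ho; rewrite lerDr !mulr_ge0 // ltW.
  by rewrite mulrC ler_pdivrMr // => k; apply: le_lt_trans k _; rewrite gtr_pMl // invf_lt1 ?ltr1n.
have qo : q * o <= 16^-1.
  have : 8 * q * o <= 2^-1 by apply: le_trans ho; rewrite lerDl mulr_ge0 // ltW.
  by rewrite -mulrA; lra.
set c := D w - psum _ n (w - z).
have crc : axdiff (fun w => F w - psum a n.+1 (w - z)) c w.
  apply: axdiffB; first exact: FD.
  by apply: cdiff_axdiff; apply/pdiff_cdiff; exact: pdiff_psum.
have est x : q * o < x -> x <= 4^-1 -> nm c <= 4 * M * q * (2 * x) ^+ n.
  move=> ox x4; apply: (@axdiff_bound _ c w _ ((x - q * o) / q) _ crc).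
    by rewrite divr_gt0 // subr_gt0.
  move=> w'; rewrite ltr_pdivlMr // => w'w.
  apply: (taylor_lip q0 M0 HF n x4); last by rewrite ltW.
  have := ler_wpM2l (ltW q0) (nm_tri w' w z); rewrite -/o mulrDr mulrC.
  by move: w'w; rewrite [nm (w' - w) * q]mulrC; move: (q * nm (w' - w)) (q * o) => X Y; lra.
have [oz|on] := eqVneq o 0.
  rewrite oz !mulr0 addr0; rewrite oz mulr0 in est.
  case: n @c crc est => [|n] c crc est.
    by have := est 4^-1; rewrite !expr0; apply => //; rewrite invr_gt0.
  rewrite exprS mul0r mulr0; apply/ler_addgt0Pr => e e0; rewrite add0r.
  (* At [w = z] the remainder vanishes for [n > 0]: the estimate holds with arbitrarily small [x]. *)
  pose x := Num.min 4^-1 (e / (8 * M * q + 1)).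
  have K1 : 0 < 8 * M * q + 1 by rewrite ltr_wpDl // !mulr_ge0 // ltW.
  have x0 : 0 < x by rewrite lt_min invr_gt0 ltr0n divr_gt0.
  have [x4 xe] : x <= 4^-1 /\ x <= e / (8 * M * q + 1) by rewrite !ge_min !lexx orbT.
  apply: le_trans (est x x0 x4) _.
  apply: (@le_trans _ _ (4 * M * q * (2 * x))).
    rewrite ler_wpM2l // exprS ler_piMr ?mulr_ge0 ?(ltW x0) // exprn_ile1 //.
      by rewrite mulr_ge0 // ltW.
    lra.
  rewrite ler_pdivlMr // in xe; apply: le_trans xe.
  have -> : 4 * M * q * (2 * x) = x * (8 * M * q) by ring.
  by rewrite ler_wpM2l ?(ltW x0) // lerDl.
have op : 0 < q * o by rewrite mulr_gt0 // lt_def on.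
(* For [w] different from [z], the Lipschitz constant on the disc of twice the radius. *)
apply: le_trans (est (2 * (q * o)) _ _) _; [lra|lra|].
have h1 : 0 <= 8 * (q * o) by rewrite mulr_ge0 // ltW.
have h2 : 0 <= s^-1 * o := mulr_ge0 (ltW is0) o0.
by rewrite -[8 * q * o]mulrA ler_wpM2l // lerXn2r ?nnegrE //; lra.
Qed.

(** A second primitive of [f] has a Taylor expansion by Cauchy's formula
on a circle; its derivatives, the first primitive and then [f], inherit it. *)
Theorem tolstov f z r B : 0 < r -> (forall w, box z r w -> exists c, axdiff f c w) ->
  (forall w, box z r w -> nm (f w) <= B) ->
  exists a M q, [/\ 0 <= M, 0 < q & taylor f z a M q].
Proof.
move=> r0 fcr fB; have [G [H GH]] := axdiff_box_second_primitive r0 fcr fB.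
have r4 : 0 < r / 4 by rewrite divr_gt0.
have r8 : 0 < r / 8 by rewrite divr_gt0.
have inb w : nm (w - z) <= r / 8 -> box z (r / 4) w.
  by move=> wr; apply: nm_box; apply: le_lt_trans wr _; lra.
have inb4 w : nm (w - z) < r / 4 -> box z (r / 4) w by exact: nm_box.
have bb w : box z (r / 4) w -> box z r w.
  by case=> h1 h2; split; lra.
have sH w : nm (w - z) <= r / 8 -> sdiff H (G w) w.
  by move=> /inb /GH[].
have lipG w w' : box z (r / 4) w -> box z (r / 4) w' -> nm (G w' - G w) <= 2 * B * nm (w' - w).
  move=> wb w'b; have := @axdiff_box_lip R G f 0 z (r / 4) B _ _ w w' wb w'b.
  by rewrite mul0r subr0; apply => u ub; [have [] := GH u ub|rewrite subr0; apply: fB; exact: bb].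
have cG w : nm (w - z) <= r / 8 -> ccont G w.
  move=> wr e e0.
  have B0 : 0 <= B by apply: le_trans (fB w (bb _ (inb _ wr))); exact: nm_ge0.
  have B1 : 0 < 2 * B + 1 by rewrite ltr_wpDl // mulr_ge0.
  exists (Num.min (r / 8) (e / (2 * B + 1))); first by rewrite lt_min r8 divr_gt0.
  move=> w'; rewrite lt_min => /andP[w'r w'e].
  have w'b : box z (r / 4) w'.
    by apply: inb4; apply: le_lt_trans (nm_tri _ w _) _; lra.
  apply: le_trans (lipG w w' (inb _ wr) w'b) _.
  rewrite ltr_pdivlMr // in w'e; apply: le_trans (ltW w'e).
  by rewrite mulrC ler_wpM2l ?nm_ge0 // lerDl.
have cH : on_curve (circ z (r / 8)) H.
  move=> t tP; apply: sdiff_ccont; apply: sH.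
  by rewrite nm_circ // ltW.
have [a [M [M0 HT]]] := taylor_circle r8 cH (fun w wr => cauchy_formula_circle r8 sH cG wr).
have i0 : 0 < (r / 8)^-1 by rewrite invr_gt0.
have [M1 [q1 [M10 q10 GT]]] := taylor_deriv (D := G) i0 M0 r4 HT
  (fun w wr => cdiff_axdiff (sdiff_cdiff (proj2 (GH w (inb4 w wr))))).
have [M2 [q2 [M20 q20 fT]]] := taylor_deriv (D := f) q10 M10 r4 GT
  (fun w wr => proj1 (GH w (inb4 w wr))).
by eexists; exists M2, q2; split; last exact: fT.
Qed.

End taylor_expansion.

(** * Holomorphic functions *)

Section holomorphic.
Variable R : realType.
Local Notation C := R[i].
Implicit Types (z w c : C) (e r x y s t M q B L K : R) (f g F G H : C -> C) (a : nat -> C)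
  (D : set C).

Definition copen D := forall z, D z -> exists2 r, 0 < r & forall w, nm (w - z) < r -> D w.

Definition hol D F := forall z, D z -> exists a M q, [/\ 0 <= M, 0 < q & taylor F z a M q].

Lemma taylor_sdiff F z a M q : 0 < q -> 0 <= M -> taylor F z a M q -> sdiff F (a 1%N) z.
Proof.
move=> q0 M0 HF e e0; pose k := 8 * M * q + 1.
have k0 : 0 < k by rewrite ltr_wpDl // !mulr_ge0 // ltW.
pose x := Num.min 4^-1 (e / k).
have x0 : 0 < x by rewrite lt_min invr_gt0 ltr0n divr_gt0.
have [x4 xe] : x <= 4^-1 /\ x <= e / k by rewrite !ge_min !lexx orbT.
exists (x / q); first by rewrite divr_gt0.
move=> w w'; rewrite !ltr_pdivlMr // ![_ * q]mulrC => wx w'x.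
have := taylor_lip q0 M0 HF 1 x4 (ltW wx) (ltW w'x).
rewrite !psumS /psum !big_ord0 !add0r !expr0 !mulr1 !expr1.
have -> : F w - (a 0%N + a 1%N * (w - z)) - (F w' - (a 0%N + a 1%N * (w' - z))) =
  F w - F w' - a 1%N * (w - w') by ring.
move=> h; apply: le_trans h _; rewrite ler_wpM2r ?nm_ge0 //.
rewrite ler_pdivlMr // in xe; apply: le_trans xe.
have -> : 4 * M * q * (2 * x) = x * (8 * M * q) by ring.
by rewrite ler_wpM2l ?(ltW x0) // lerDl.
Qed.

Lemma taylor_cdiff F z a M q : 0 < q -> 0 <= M -> taylor F z a M q -> cdiff F (a 1%N) z.
Proof. by move=> q0 M0 HF; apply/sdiff_cdiff/(taylor_sdiff q0 M0 HF). Qed.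

Lemma axdiff_uniq F c d z : axdiff F c z -> axdiff F d z -> c = d.
Proof.
move=> Hc Hd; apply/eqP; rewrite -subr_eq0; apply/eqP; apply: nm_small => e e0.
apply: (@axdiff_bound _ (fun w => F w - F w) _ z _ 1) => //; first exact: axdiffB.
by move=> w _; rewrite !subrr nm0 mulr_ge0 ?nm_ge0 // ltW.
Qed.

Lemma cdiff_uniq F c d z : cdiff F c z -> cdiff F d z -> c = d.
Proof. by move=> /cdiff_axdiff Hc /cdiff_axdiff; exact: axdiff_uniq Hc. Qed.

(** The complex derivative where it exists, and [0] elsewhere. *)
Definition der F z : C := xget 0 [set c | cdiff F c z].

Lemma derE F c z : cdiff F c z -> der F z = c.
Proof.
move=> H; apply: (cdiff_uniq _ H).
exact: (xgetI _ (H : [set c | cdiff F c z] c)).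
Qed.

Lemma hol_sdiff D F z : hol D F -> D z -> sdiff F (der F z) z.
Proof.
move=> HF /HF[a [M [q [M0 q0 T]]]]; have H := taylor_sdiff q0 M0 T.
by rewrite (derE (sdiff_cdiff H)).
Qed.

Lemma hol_cdiff D F z : hol D F -> D z -> cdiff F (der F z) z.
Proof. by move=> HF Dz; apply/sdiff_cdiff/(hol_sdiff HF Dz). Qed.

Lemma hol_ccont D F z : hol D F -> D z -> ccont F z.
Proof. by move=> HF Dz; apply: sdiff_ccont (hol_sdiff HF Dz). Qed.

Lemma taylor_der D F z a M q : copen D -> hol D F -> D z -> 0 < q -> 0 <= M ->
  taylor F z a M q ->
  exists M' q', [/\ 0 <= M', 0 < q' & taylor (der F) z (fun k => k.+1%:R * a k.+1) M' q'].
Proof.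
move=> oD HF Dz q0 M0 T; have [r r0 rH] := oD z Dz.
apply: (taylor_deriv q0 M0 r0 T) => w wr; apply: cdiff_axdiff; apply: (hol_cdiff HF); exact: rH.
Qed.

Lemma hol_der D F : copen D -> hol D F -> hol D (der F).
Proof.
move=> oD HF z Dz; have [a [M [q [M0 q0 T]]]] := HF z Dz.
have [M' [q' H]] := taylor_der oD HF Dz q0 M0 T.
by exists (fun k => k.+1%:R * a k.+1), M', q'.
Qed.

Lemma tolstov_hol D F : copen D -> (forall z, D z -> exists c, axdiff F c z) ->
  (forall z, D z -> exists B r, 0 < r /\ forall w, nm (w - z) < r -> nm (F w) <= B) -> hol D F.
Proof.
move=> oD FD FB z Dz; have [r r0 rH] := oD z Dz; have [B [r' [r'0 BH]]] := FB z Dz.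
(* The box of size [s] lies in both discs, as the modulus is at most the sum of the two coordinates. *)
pose s := Num.min r r' / 2.
have m0 : 0 < Num.min r r' by rewrite lt_min r0.
have sb w : box z s w -> nm (w - z) < r /\ nm (w - z) < r'.
  move=> [h1 h2]; apply/andP; rewrite -lt_min.
  apply: le_lt_trans (nm_le_ReIm _) _; rewrite !raddfB /=; rewrite /s in h1 h2; lra.
apply: (@tolstov R F z s B); first by rewrite divr_gt0.
  by move=> w /sb[wr _]; apply: FD; exact: rH.
by move=> w /sb[_ wr]; exact: BH.
Qed.

Lemma cdiff_hol D F : copen D -> (forall z, D z -> exists c, cdiff F c z) -> hol D F.
Proof.
move=> oD FD; apply: tolstov_hol => // z /FD[c Hc]; first by exists c; exact: cdiff_axdiff.
have [r r0 rH] := cdiff_ccont Hc ltr01.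
exists (nm (F z) + 1), r; split => // w /rH h.
by rewrite -lerBlDl; apply: le_trans (nm_sub _ _) h.
Qed.

Lemma cdiff_near F G c z r : 0 < r -> (forall w, nm (w - z) < r -> F w = G w) ->
  cdiff F c z -> cdiff G c z.
Proof.
move=> r0 FG H e e0; have [r' r'0 rH'] := H e e0.
exists (Num.min r r'); first by rewrite lt_min r0.
move=> w; rewrite lt_min => /andP[wr /rH']; rewrite !FG //.
by rewrite subrr nm0.
Qed.

(** The difference quotient of [F] at [z], with its removable singularity filled in.
Iterating it yields the Taylor coefficients of [F] at [z] as values. *)
Definition quot F z w := if w == z then der F z else (F w - F z) * (w - z)^-1.

Lemma quot_ne F z w : w != z -> quot F z w = (F w - F z) * (w - z)^-1.
Proof. by rewrite /quot => /negPf ->. Qed.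

Lemma quot_center F z : quot F z z = der F z.
Proof. by rewrite /quot eqxx. Qed.

Lemma taylor_quot F z a M q : 0 < q -> 0 <= M -> taylor F z a M q ->
  taylor (quot F z) z (fun k => a k.+1) (2 * M * q) q.
Proof.
move=> q0 M0 T w n wq; have Fz := taylor_center T.
have d1 := derE (taylor_cdiff q0 M0 T).
have [->|wz] := eqVneq w z.
  rewrite quot_center d1 subrr nm0 mulr0; case: n => [|n].
    by rewrite /psum big_ord0 subr0 expr0 mulr1 -[q in leRHS]expr1; exact: (taylor_coef q0 M0 T).
  by rewrite psum0 subrr nm0 !mulr_ge0 ?exprn_ge0 // ltW.
rewrite quot_ne //; have wz' : w - z != 0 by rewrite subr_eq0.
have -> : (F w - F z) * (w - z)^-1 - psum (fun k => a k.+1) n (w - z) =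
   (F w - psum a n.+1 (w - z)) * (w - z)^-1.
  have -> : psum a n.+1 (w - z) = a 0%N + (w - z) * psum (fun k => a k.+1) n (w - z).
    rewrite /psum big_ord_recl /= expr0 mulr1 mulr_sumr; congr (_ + _).
    by apply: eq_bigr => i _; rewrite /bump /= exprS mulrCA.
  by rewrite Fz; field.
rewrite nmM nmV ler_pdivrMr ?nm_gt0 //; apply: le_trans (T w n.+1 wq) _.
rewrite exprS; move: (nm (w - z)) (nm_ge0 (w - z)) => o o0.
have -> : M * (q * o * (q * o) ^+ n) = M * q * (q * o) ^+ n * o by ring.
rewrite ler_wpM2r // ler_wpM2r ?exprn_ge0 ?mulr_ge0 ?(ltW q0) //.
by rewrite ler_wpM2r ?(ltW q0) // ler_peMl // ler1n.
Qed.

Lemma quot_hol D F z : copen D -> hol D F -> D z -> hol D (quot F z).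
Proof.
move=> oD HF Dz; apply: cdiff_hol => // w Dw; have [->|wz] := eqVneq w z.
  have [a [M [q [M0 q0 T]]]] := HF z Dz; exists (a 2%N).
  by apply: (taylor_cdiff q0 _ (taylor_quot q0 M0 T)); rewrite !mulr_ge0 // ltW.
have H1 := (proj2 (pdiff_cdiff _ _ _)) (hol_cdiff HF Dw).
have ww : [set w] w by [].
have H2 := pdiffM ww (pdiffB H1 (pdiff_cst [set w] (F z) w)) (pdiff_inv ww wz).
eexists; apply: (@cdiff_near _ _ _ w (nm (w - z)) _ _ ((proj1 (pdiff_cdiff _ _ _)) H2)).
  by rewrite nm_gt0 subr_eq0.
move=> u uw; rewrite quot_ne //; apply: contraL uw => /eqP ->.
by rewrite nmC ltxx.
Qed.

Lemma hol_lip D F z : hol D F -> D z -> exists s K, [/\ 0 < s, 0 <= K &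
  forall w w', nm (w - z) <= s -> nm (w' - z) <= s -> nm (F w - F w') <= K * nm (w - w')].
Proof.
move=> HF /HF[a [M [q [M0 q0 T]]]]; exists (4^-1 / q), (4 * M * q); split.
- by rewrite divr_gt0 // invr_gt0.
- by rewrite !mulr_ge0 // ltW.
move=> w w'; rewrite !ler_pdivlMr // ![_ * q]mulrC => h1 h2.
have := taylor_lip q0 M0 T 0 (lexx _) h1 h2.
rewrite !psumS /psum !big_ord0 !expr0 !mulr1.
have -> : F w - (0 + a 0%N) - (F w' - (0 + a 0%N)) = F w - F w' by ring.
by rewrite [q * (4 * M)]mulrC.
Qed.

Lemma ccont_bound F z K r : 0 < r -> ccont F z ->
  (forall w, nm (w - z) < r -> w != z -> nm (F w) <= K) -> nm (F z) <= K.
Proof.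
move=> r0 cF FK; apply/ler_addgt0Pr => e e0; have [s s0 sH] := cF e e0.
pose h := Num.min r s / 2; have m0 : 0 < Num.min r s by rewrite lt_min r0.
have h0 : 0 < h by rewrite divr_gt0.
have nh : nm (h%:C : C) = h by rewrite nmR gtr0_norm.
have E : z + h%:C - z = h%:C by rewrite addrC addKr.
have /andP[hr hs] : (h < r) && (h < s) by rewrite -lt_min /h; lra.
have := sH (z + h%:C); rewrite E nh => /(_ hs) k1.
have := FK (z + h%:C); rewrite E nh -subr_eq0 E -nm_gt0 nh => /(_ hr h0) k2.
have -> : F z = F (z + h%:C) - (F (z + h%:C) - F z) by ring.
exact: le_trans (nmB _ _) (lerD k2 k1).
Qed.

End holomorphic.

(** * The general Cauchy formula *)

Section dixon.
Variable R : realType.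
Local Notation C := R[i].
Implicit Types (z w c : C) (e r x y s M q B L K : R) (f g F G H : C -> C) (a : nat -> C)
  (D : set C) (gamma : R -> C).

Lemma copenT : copen (@setT C).
Proof. by move=> z _; exists 1. Qed.

(** By Cauchy's formula, [H z] is at most twice the maximum of the modulus of [H] on a
circle around [z], and this maximum tends to [0] as the radius grows. *)
Lemma liouville0 H : hol setT H ->
  (forall e, 0 < e -> exists K, forall w, K < nm w -> nm (H w) <= e) -> forall z, H z = 0.
Proof.
move=> HH inf z; apply: nm_small => e e0; have e2 : 0 < e / 2 by rewrite divr_gt0.
have [K KH] := inf _ e2; pose r := `|K| + nm z + 1.
have r0 : 0 < r by rewrite /r ltr_wpDl // addr_ge0 ?nm_ge0.
have sH w : nm (w - z) <= r -> sdiff H (der H w) w by move=> _; apply: (hol_sdiff HH).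
have cG w : nm (w - z) <= r -> ccont (der H) w.
  by move=> _; apply: (hol_ccont (hol_der copenT HH)).
have zz : nm (z - z) < r by rewrite subrr nm0.
have := cauchy_formula_circle r0 sH cG zz; set I := cint _ _ => E.
have B0 : 0 <= e / 2 / r by rewrite !divr_ge0 // ltW.
have IB : nm I <= e / 2 / r * (4 * pi * r).
  apply: (cint_bound (circ_length z (ltW r0)) (circ_cont z (ltW r0))) => //.
    move=> t tP; apply: ccontM; first exact: (hol_ccont HH).
    by apply: (@ccont_inv R z _ 1); apply: circ_off zz t tP.
  move=> t tP; rewrite nmM nmV nm_circ ?(ltW r0) // ler_wpM2r ?invr_ge0 ?(ltW r0) //.
  apply: KH; have := nm_sub (circ z r t - z) (- z); rewrite nm_circ ?(ltW r0) // nmN opprK subrK.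
  by rewrite /r; have := ler_norm K; lra.
have p0 : 0 < nm (two_pi_i R) by rewrite nm_gt0 two_pi_i_neq0.
rewrite -(ler_pM2l p0) -nmM -E; apply: le_trans IB _.
have -> : nm (two_pi_i R) = 2 * pi.
  by rewrite /two_pi_i !nmM nmi mulr1 (nm_nat R 2) nmR gtr0_norm ?pi_gt0.
by rewrite le_eqVlt; apply/orP; left; apply/eqP; field; rewrite gt_eqF.
Qed.

Section curve.
Variables (gamma : R -> C) (L : R).
Hypotheses (rL : length_le gamma L) (cg : cont01 gamma) (cl : gamma 0 = gamma 1).

Lemma curve_bounded : exists2 K, 0 <= K & forall t, 0 <= t <= 1 -> nm (gamma t) <= K.
Proof. exact: cont01_max. Qed.

Lemma cauchy_integral_infty f : on_curve gamma f -> forall e, 0 < e ->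
  exists K, forall w, K < nm w -> off_curve gamma w /\
     nm (cint gamma (fun t => f t * (t - w)^-1)) <= e.
Proof.
move=> cf e e0; have [K K0 KH] := curve_bounded; have L0 := length_ge0 rL.
have [B B0 BH] := cont01_max (cont01_comp cg cf).
have k0 : 0 < B * L + 1 by rewrite ltr_wpDl // mulr_ge0.
pose d := (B * L + 1) / e; have d0 : 0 < d by rewrite divr_gt0.
exists (K + d) => w Kw.
have far t : 0 <= t <= 1 -> d < nm (gamma t - w).
  by move=> /KH h; have := nm_sub w (gamma t); rewrite nmC; lra.
have ow : off_curve gamma w.
  by move=> t /far h; apply: contraTneq h => ->; rewrite subrr nm0 -leNgt ltW.
split=> //.
have b0 : 0 <= B / d by rewrite divr_ge0 // ltW.
apply: (@le_trans _ _ (B / d * L)).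
  apply: (cint_bound rL cg) => //; first exact: (@on_curve_kernel R gamma f w 1).
  move=> t tP; rewrite nmM nmV ler_pM ?nm_ge0 ?invr_ge0 ?nm_ge0 //; first exact: BH.
  by rewrite lef_pV2 ?posrE ?(ltW (far t tP)) // (lt_trans d0) // far.
have -> : B / d * L = e * (B * L / (B * L + 1)) by rewrite /d; field; rewrite !gt_eqF.
by rewrite ler_piMr ?(ltW e0) // ler_pdivrMr // mul1r lerDl.
Qed.

(** The winding number is constant along a ray that goes to infinity outside a large
disc, and tends to [0] along it. *)
Lemma winding_infty : exists K, forall w, K < nm w -> off_curve gamma w /\ winding gamma w = 0.
Proof.
have c1 : on_curve gamma (fun=> 1) by move=> t tP; exact: ccont_cst.
have [K1 H1] := cauchy_integral_infty c1 ltr01.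
exists `|K1| => w Kw; split.
  by apply: (proj1 (H1 w _)); apply: le_lt_trans Kw; exact: ler_norm.
apply: nm_small => e e0; have [K2 H2] := cauchy_integral_infty c1 e0.
have w0 : 0 < nm w by apply: le_lt_trans Kw.
have [k k1 kK] : exists2 k, 1 <= k & K2 < k * nm w.
  exists (1 + `|K2| / nm w); first by rewrite lerDl divr_ge0 // ltW.
  rewrite mulrDl mul1r -mulrA mulVf ?gt_eqF // mulr1.
  by have := ler_norm K2; lra.
have kn : nm (k%:C : C) = k by rewrite nmR ger0_norm // (le_trans _ k1).
rewrite (@winding_segment R gamma L w (k%:C * w)) //; last first.
  move=> s /andP[s0 s1]; apply: (proj1 (H1 _ _)).
  have -> : w + s%:C * (k%:C * w - w) = (1 + s * (k - 1))%:C * w.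
    by rewrite rmorphD rmorphM rmorphB /= rmorph1; ring.
  have m1 : 1 <= 1 + s * (k - 1) by rewrite lerDl mulr_ge0 // subr_ge0.
  rewrite nmM nmR ger0_norm; last by rewrite (le_trans _ m1).
  apply: le_lt_trans (ler_norm K1) _; apply: lt_le_trans Kw _.
  by rewrite ler_peMl // ltW.
have := H2 (k%:C * w); rewrite nmM kn => /(_ kK)[_].
by rewrite (@eq_cint _ gamma _ (fun u => (u - k%:C * w)^-1)) // => t tP; rewrite mul1r.
Qed.

Section formula.
Variables (D : set C).
Hypothesis oD : copen D.
Hypothesis gD : forall t, 0 <= t <= 1 -> D (gamma t).
Hypothesis out : forall z, ~ D z -> exists2 r, 0 < r &
  forall w, nm (w - z) < r -> off_curve gamma w /\ winding gamma w = 0.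

Lemma hol_on_curve F : hol D F -> on_curve gamma F.
Proof. by move=> HF t tP; apply: (hol_ccont HF); exact: gD. Qed.

Lemma cint_quot F z : hol D F -> off_curve gamma z ->
  cint gamma (quot F z) = cint gamma (fun t => F t * (t - z)^-1) - F z * winding gamma z.
Proof.
move=> HF oz; have cF := hol_on_curve HF.
have o1 : on_curve gamma (fun t => F t * (t - z)^-1) by exact: (on_curve_kernel 1 cF oz).
have o2 : on_curve gamma (fun t => (t - z)^-1) by exact: (on_curve_inv 1 oz).
rewrite /winding -(cintZ rL cg _ o2) -(cintB rL cg o1); last first.
  by move=> t tP; apply: ccontM; [exact: ccont_cst|exact: o2].
by apply: eq_cint => t tP; rewrite quot_ne ?oz // mulrBl.
Qed.

(** Let [c0] and [c1] be the first and second quotients of [F] at [z0]. Then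
[quot F z t - c0 t - (z - z0) c1 t] equals
[(z - z0)^2 (c1 t - c1 z) / (t - z)], and the last factor is bounded uniformly in
[t] on the curve and [z] near [z0]: near [z0] the function [c1] is Lipschitz, and
elsewhere [t - z] is bounded away from [0]. *)
Lemma dixon_cdiff F z0 : hol D F -> D z0 ->
  cdiff (fun z => cint gamma (quot F z)) (cint gamma (quot (quot F z0) z0)) z0.
Proof.
move=> HF Dz; have [d d0 dD] := oD Dz; have L0 := length_ge0 rL.
(* [F t = F z0 + (t - z0) c0 t] and [c0 t = der F z0 + (t - z0) c1 t]. *)
pose c0 := quot F z0; pose c1 := quot c0 z0.
have H0 : hol D c0 := quot_hol oD HF Dz.
have H1 : hol D c1 := quot_hol oD H0 Dz.
have [s [K [s0 K0 lip]]] := hol_lip H1 Dz.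
have [B B0 BH] := cont01_max (cont01_comp cg (hol_on_curve H1)).
have c0E t : c0 t = der F z0 + (t - z0) * c1 t.
  have [->|tz] := eqVneq t z0; first by rewrite subrr mul0r addr0 /c0 quot_center.
  by rewrite /c1 quot_ne // {3}/c0 quot_center; field; rewrite subr_eq0.
have FE t : F t = F z0 + (t - z0) * c0 t.
  have [->|tz] := eqVneq t z0; first by rewrite subrr mul0r addr0.
  by rewrite /c0 quot_ne //; field; rewrite subr_eq0.
pose E z t := quot F z t - c0 t - (z - z0) * c1 t.
have EE z t : t != z -> E z t = (z - z0) ^+ 2 * ((c1 t - c1 z) * (t - z)^-1).
  move=> tz; rewrite /E quot_ne // (FE t) (FE z) !c0E; field; by rewrite subr_eq0.
have Econt z t : D z -> D t -> ccont (E z) t.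
  move=> Dz' Dt; apply: ccontB; first apply: ccontB.
  - exact: (hol_ccont (quot_hol oD HF Dz')).
  - exact: (hol_ccont H0).
  - by apply: ccontM; [exact: ccont_cst|exact: (hol_ccont H1)].
pose B' := K + (B + (nm (c1 z0) + K * s)) / (s / 2).
have b0 : 0 <= (B + (nm (c1 z0) + K * s)) / (s / 2).
  by rewrite divr_ge0 ?addr_ge0 ?nm_ge0 // ?mulr_ge0 // ltW.
have B'0 : 0 <= B' by rewrite addr_ge0.
have Ebound z t : D z -> nm (z - z0) <= s / 2 -> 0 <= t <= 1 ->
    nm (E z (gamma t)) <= nm (z - z0) ^+ 2 * B'.
  move=> Dz' zs tP; have zs' : nm (z - z0) <= s by lra.
  have [ts|ts] := ltP (nm (gamma t - z0)) s.
    have near w : nm (w - z0) <= s -> w != z -> nm (E z w) <= nm (z - z0) ^+ 2 * B'.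
      move=> ws wz; rewrite EE // nmM nmX ler_wpM2l ?exprn_ge0 ?nm_ge0 //.
      apply: (@le_trans _ _ K); last by rewrite lerDl.
      by rewrite nmM nmV ler_pdivrMr ?nm_gt0 ?subr_eq0 // lip.
    have [tz|tz] := eqVneq (gamma t) z; last by rewrite near // ltW.
    (* The formula for [E z t] fails at [t = z]; the bound there follows by continuity. *)
    rewrite tz; apply: (@ccont_bound _ (E z) z _ (s / 2)); first by rewrite divr_gt0.
      exact: Econt.
    move=> w wz wz'; apply: near => //.
    by have := nm_tri w z z0; lra.
  have far : s / 2 <= nm (gamma t - z) by have := nm_tri (gamma t) z z0; lra.
  have s2 : 0 < s / 2 by rewrite divr_gt0.
  have tz : gamma t != z.
    by rewrite -subr_eq0 -nm_gt0 (lt_le_trans s2).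
  rewrite EE // nmM nmX ler_wpM2l ?exprn_ge0 ?nm_ge0 // nmM nmV.
  apply: (@le_trans _ _ ((B + (nm (c1 z0) + K * s)) / (s / 2))); last by rewrite lerDr.
  apply: ler_pM; rewrite ?invr_ge0 ?nm_ge0 //; last first.
    by rewrite lef_pV2 ?posrE // (lt_le_trans s2).
  apply: le_trans (nmB _ _) _; apply: lerD; first exact: BH.
  have k := lip z z0 zs'; rewrite subrr nm0 in k.
  have {}k := le_trans (k (ltW s0)) (ler_wpM2l K0 zs').
  by have := nm_sub (c1 z) (c1 z0); lra.
move=> e e0; have k0 : 0 < B' * L + 1 by rewrite ltr_wpDl // mulr_ge0.
have m0 : 0 < Num.min (s / 2) (e / (B' * L + 1)) by rewrite lt_min !divr_gt0.
exists (Num.min d (Num.min (s / 2) (e / (B' * L + 1)))); first by rewrite lt_min d0.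
move=> z; rewrite !lt_min => /andP[zd /andP[zs ze]].
have Dz' : D z by exact: dD.
have on0 := hol_on_curve H0; have on1 := hol_on_curve H1.
have onz := hol_on_curve (quot_hol oD HF Dz').
have onZ : on_curve gamma (fun t => (z - z0) * c1 t).
  by move=> t tP; apply: ccontM; [exact: ccont_cst|exact: on1].
rewrite -/c0 -/c1 [_ * (z - z0)]mulrC -(cintZ rL cg _ on1) -(cintB rL cg onz on0).
rewrite -(cintB rL cg) //; last by move=> t tP; apply: ccontB; [exact: onz|exact: on0].
have := @cint_bound _ _ _ rL cg (E z) (nm (z - z0) ^+ 2 * B').
move=> h; apply: le_trans (h _ _ _) _.
- by move=> t tP; apply: Econt => //; exact: gD.
- by rewrite mulr_ge0 // exprn_ge0 ?nm_ge0.
- by move=> t tP; apply: Ebound => //; exact: ltW.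
have -> : nm (z - z0) ^+ 2 * B' * L = nm (z - z0) * (B' * L) * nm (z - z0) by ring.
rewrite ler_wpM2r ?nm_ge0 //.
rewrite ltr_pdivlMr // in ze; apply: le_trans (ltW ze).
by rewrite ler_wpM2l ?nm_ge0 // lerDl.
Qed.

(** Dixon's proof. The function [h] is the integral of the quotient of [F] for points of
[D], and the Cauchy integral of [F] for the others; the two agree where the
winding number vanishes, hence near the complement of [D]. So [h] is entire; it tends to
[0] at infinity and vanishes by [liouville0]. *)
Theorem cauchy_formula F z : hol D F -> D z -> off_curve gamma z ->
  cint gamma (fun t => F t * (t - z)^-1) = winding gamma z * F z.
Proof.
move=> HF Dz oz; have cF := hol_on_curve HF.
pose h w := if pselect (D w) then cint gamma (quot F w)
            else cint gamma (fun t => F t * (t - w)^-1).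
have hD w : D w -> h w = cint gamma (quot F w) by rewrite /h; case: pselect.
have hout w : off_curve gamma w -> winding gamma w = 0 ->
    h w = cint gamma (fun t => F t * (t - w)^-1).
  by move=> ow w0; rewrite /h; case: pselect => // Dw; rewrite cint_quot // w0 mulr0 subr0.
have hh : hol setT h.
  apply: cdiff_hol => [|w _]; first exact: copenT.
  have [Dw|nDw] := pselect (D w).
    have [r r0 rH] := oD Dw; eexists.
    by apply: (cdiff_near r0 _ (dixon_cdiff HF Dw)) => u /rH Du; rewrite hD.
  have [r r0 rH] := out nDw; have [ow _] := rH w ltac:(by rewrite subrr nm0).
  eexists; apply: (cdiff_near r0 _ (cdiff_cauchy_integral rL cg cF ow)).
  by move=> u /rH[ou u0]; rewrite hout.
have h0 : h z = 0.
  apply: (liouville0 hh _ z) => e e0.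
  have [K1 H1] := winding_infty; have [K2 H2] := cauchy_integral_infty cF e0.
  exists (Num.max K1 K2) => w; rewrite gt_max => /andP[/H1[ow w0] /H2[_ k]].
  by rewrite hout.
move: h0; rewrite hD // cint_quot // => /eqP; rewrite subr_eq0 => /eqP ->.
by rewrite mulrC.
Qed.

(** The formula for [quot F z], up to the integral of [(t - z)^-2], which is
[0]. *)
Lemma cauchy_formula2 F z : hol D F -> D z -> off_curve gamma z ->
  cint gamma (fun t => F t * (t - z) ^- 2) = winding gamma z * der F z.
Proof.
move=> HF Dz oz; rewrite -(quot_center F z) -(cauchy_formula (quot_hol oD HF Dz)) //.
have cF := hol_on_curve HF.
rewrite -[LHS]subr0 -[X in _ - X](mulr0 (F z)) -(cint_inv2 rL cg cl oz).
have o2 := on_curve_inv 2 oz.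
rewrite -(cintZ rL cg _ o2) -(cintB rL cg); last first.
- by move=> t tP; apply: ccontM; [exact: ccont_cst|exact: o2].
- exact: on_curve_kernel.
by apply: eq_cint => t tP; rewrite quot_ne ?oz //; field; rewrite subr_eq0 oz.
Qed.

(** The formula of order two for [quot F z], whose derivative at [z] is half the
second derivative of [F]. *)
Lemma cauchy_formula3 F z : hol D F -> D z -> off_curve gamma z ->
  cint gamma (fun t => F t * (t - z) ^- 3) = winding gamma z * (2^-1 * der (der F) z).
Proof.
move=> HF Dz oz; have HQ := quot_hol oD HF Dz.
have -> : 2^-1 * der (der F) z = der (quot F z) z.
  have [a [M [q [M0 q0 T]]]] := HF z Dz.
  have [M' [q' [M'0 q'0 T']]] := taylor_der oD HF Dz q0 M0 T.
  rewrite (derE (taylor_cdiff q'0 M'0 T')).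
  have Mq : 0 <= 2 * M * q by rewrite !mulr_ge0 // ltW.
  rewrite (derE (taylor_cdiff q0 Mq (taylor_quot q0 M0 T))).
  by rewrite mulKf // pnatr_eq0.
rewrite -(cauchy_formula2 HQ) //.
have cF := hol_on_curve HF.
rewrite -[LHS]subr0 -[X in _ - X](mulr0 (F z)) -(cint_inv3 rL cg cl oz).
have o3 := on_curve_inv 3 oz.
rewrite -(cintZ rL cg _ o3) -(cintB rL cg); last first.
- by move=> t tP; apply: ccontM; [exact: ccont_cst|exact: o3].
- exact: on_curve_kernel.
by apply: eq_cint => t tP; rewrite quot_ne ?oz //; field; rewrite subr_eq0 oz.
Qed.

End formula.
End curve.
End dixon.

(** * Topology of the complement of a curve *)

Section topology.
Variable R : realType.
Local Notation C := R[i].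
Implicit Types (z w c : C) (e r x y s M q B L K : R) (f g F G H : C -> C) (a : nat -> C)
  (D : set C) (gamma : R -> C).

Lemma realC_pos (e : C) : 0 < e -> exists2 r : R, 0 < r & e = r%:C.
Proof. by case: e => x y; rewrite ltcE /= => /andP[/eqP -> x0]; exists x. Qed.

Lemma nbhs_nm (V : normedModType C) (x : V) (U : set V) :
  nbhs x U <-> exists2 r : R, 0 < r & forall y : V, `|y - x| < r%:C -> U y.
Proof.
rewrite -nbhs_nbhs_norm; split.
  move=> [e /= /realC_pos[r r0 ->] H]; exists r => // y yx; apply: H.
  by rewrite /ball_ /= distrC.
move=> [r r0 H]; exists (r%:C) => /=; first by rewrite ltcR.
by move=> y; rewrite /ball_ /= distrC; exact: H.
Qed.

Lemma open_nm (V : normedModType C) (U : set V) :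
  open U <-> forall x : V, U x -> exists2 r : R, 0 < r & forall y : V, `|y - x| < r%:C -> U y.
Proof.
rewrite openE; split=> H x Ux; first by apply/nbhs_nm; exact: H.
by rewrite /interior; apply/nbhs_nm; exact: H.
Qed.

Lemma copenP D : open D <-> copen D.
Proof.
rewrite open_nm; split=> H z /H[r r0 rH]; exists r => // w wr; apply: rH.
  by rewrite nm_lt.
by rewrite -nm_lt.
Qed.

Lemma nbhsR_itv (x : R) (U : set R) :
  within `[0, 1] (nbhs x) U <-> exists2 r, 0 < r &
    forall y, 0 <= y <= 1 -> `|y - x| < r -> U y.
Proof.
rewrite /within /= -nbhs_nbhs_norm; split.
  move=> [r /= r0 H]; exists r => // y yP yx.
  by apply: H; rewrite /ball_ /= ?in_itv // distrC.
move=> [r r0 H]; exists r => //= y; rewrite /ball_ /= in_itv /= distrC => yx yP.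
exact: H.
Qed.

Lemma cont01P gamma : {within `[0, 1], continuous gamma} <-> cont01 gamma.
Proof.
rewrite subspace_continuousP; split=> H t.
  move=> tP e e0; have tI : [set` `[0 : R, 1]] t by rewrite /= in_itv.
  have /H : [set` `[0 : R, 1]] t by rewrite /= in_itv.
  move=> /(_ [set w | nm (w - gamma t) <= e]) k.
  have /k : nbhs (gamma t) [set w | nm (w - gamma t) <= e].
    by apply/nbhs_nm; exists e => // w; rewrite nm_lt; exact: ltW.
  move=> /nbhsR_itv[r r0 rH]; exists r => // t' t'P tt; exact: rH.
rewrite /= in_itv /= => tP U /nbhs_nm[r r0 rH].
have [s s0 sH] := H t tP (r / 2) ltac:(by rewrite divr_gt0).
apply/nbhsR_itv; exists s => // y yP ys; apply: rH; rewrite nm_lt.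
by apply: le_lt_trans (sH y yP ys) _; lra.
Qed.

Lemma rectifiableP gamma : rectifiable gamma <-> exists L, length_le gamma L.
Proof.
split=> -[L H]; exists L => s ps.
  rewrite -lecR -plenE rmorph_sum /=; apply: le_trans (H s ps).
  by rewrite le_eqVlt; apply/orP; left; apply/eqP; apply: eq_bigr => k _; rewrite /knot nmE.
rewrite -[L%:C]/(L%:C); apply: (@le_trans _ _ ((plen gamma 0 s)%:C)); last by rewrite lecR H.
rewrite -plenE rmorph_sum /=.
by rewrite le_eqVlt; apply/orP; left; apply/eqP; apply: eq_bigr => k _; rewrite /knot nmE.
Qed.

Lemma is_curve_integralP gamma f (I : C) : is_curve_integral gamma (f : C -> C) I <->
  rsint gamma (f \o gamma) I.
Proof.
have E (s : seq R) (tau : nat -> R) : \sum_(0 <= k < size s) (gamma (knot s k.+1) - gamma (knot s k)) *: f (gamma (tau k))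
    = rsum gamma (f \o gamma) 0 s tau by rewrite -rsumE.
split=> H e e0.
  have [d d0 dH] := H e e0; exists d => // s tau ps ms ts.
  by have := dH s tau ps (proj2 (meshP _ _ _) ms) (proj2 (taggedP _ _ _) ts);
    rewrite E nm_lt; exact: ltW.
have [d d0 dH] := H (e / 2) ltac:(by rewrite divr_gt0); exists d => // s tau ps ms ts.
rewrite E nm_lt; apply: le_lt_trans (dH s tau ps _ _) _; last by lra.
- exact/meshP.
- exact/taggedP.
Qed.

(** The set where [k] takes a given value and the set where it does not are both
relatively open. *)
Lemma connected_const (V : normedModType C) (K : set V) (T : Type) (k : V -> T) :
  connected K ->
  (forall x : V, K x -> exists2 r : R, 0 < r &
     forall y : V, `|y - x| < r%:C -> K y -> k y = k x) ->
  forall x y : V, K x -> K y -> k x = k y.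
Proof.
move=> cK loc x0 y0 Kx0 Ky0.
(* The union of the balls of local constancy around the points whose value satisfies [P]. *)
pose U (P : T -> Prop) : set V := [set y | exists (x : V) (r : R), [/\ K x, P (k x), `|y - x| < r%:C &
  forall y' : V, `|y' - x| < r%:C -> K y' -> k y' = k x]].
have oU P : open (U P).
  apply/open_nm => y [x [r [Kx Px yx xH]]].
  have /realC_pos[s s0 sE] : 0 < r%:C - `|y - x| by rewrite subr_gt0.
  exists s => // z; rewrite -sE => zy; exists x, r; split=> //.
  have -> : z - x = (z - y) + (y - x) by rewrite addrA subrK.
  by apply: le_lt_trans (ler_normD _ _) _; rewrite -ltrBrDr.
have UK P : K `&` U P = [set x | K x /\ P (k x)].
  apply/seteqP; split=> x /=.
    by move=> [Kx [x' [r [Kx' Px' xx' /(_ x xx' Kx) ->]]]].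
  move=> [Kx Px]; split=> //; have [r r0 rH] := loc x Kx.
  by exists x, r; split=> //; rewrite subrr normr0 ltcR.
pose B : set V := [set x | K x /\ k x = k x0].
suff : B = K by move=> BK; have [_ ->] : B y0 by rewrite BK.
apply: cK; first by exists x0.
  by exists (U (fun v => v = k x0)) => //; rewrite UK.
exists (~` U (fun v => v <> k x0)); first by rewrite -openC setCK.
apply/seteqP; split=> x /=.
  move=> [Kx kx]; split=> // Ux; have : (K `&` U (fun v => v <> k x0)) x by [].
  by rewrite UK => -[].
move=> [Kx nUx]; split=> //; apply: contrapT => kx; apply: nUx.
suff [] : (K `&` U (fun v => v <> k x0)) x by [].
by rewrite UK.
Qed.

Lemma unboundedP (A : set C) : ~ bounded_set A -> forall M, exists2 w, A w & M < nm w.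
Proof.
move=> nb M; apply: contrapT => H; apply: nb.
exists (M%:C); split; first by apply/complex_realP; exists M.
move=> x Mx w Aw /=; apply: le_trans (ltW Mx); rewrite nm_le leNgt.
by apply/negP => wM; apply: H; exists w.
Qed.

Lemma boundedP (A : set C) M : (forall w, A w -> nm w <= M) -> bounded_set A.
Proof.
move=> H; exists (M%:C); split; first by apply/complex_realP; exists M.
by move=> x Mx w Aw /=; apply: le_trans (ltW Mx); rewrite nm_le H.
Qed.

Lemma not_bounded (A : set C) : (forall M, exists2 w, A w & M < nm w) -> ~ bounded_set A.
Proof.
move=> H [M [rM MH]]; have [w Aw] := H (complex.Re M + 1).
apply/negP; rewrite -leNgt -nm_le; apply: (MH _ _ w Aw).
have [m ->] : exists m : R, M = m%:C by move: rM => /complex_realP.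
by rewrite ltcR ltrDl.
Qed.

Lemma off_curveP gamma z : off_curve gamma z <-> (~` curve_image gamma) z.
Proof.
split=> [H [t /= tP tz]|H t tP].
  by rewrite in_itv in tP; have := H t tP; rewrite tz eqxx.
by apply/eqP => tz; apply: H; exists t => //=; rewrite in_itv.
Qed.

Section components.
Variables (gamma : R -> C) (L : R).
Hypotheses (rL : length_le gamma L) (cg : cont01 gamma) (cl : gamma 0 = gamma 1).

Lemma winding_near z : off_curve gamma z -> exists2 r, 0 < r &
  forall w, nm (w - z) < r -> off_curve gamma w /\ winding gamma w = winding gamma z.
Proof.
move=> oz; have [r r0 rH] := curve_dist cg oz; exists r => // w wr.
have off u : nm (u - z) < r -> off_curve gamma u.
  by move=> ur t tP; apply: contraTneq (rH t tP) => ->; rewrite -ltNge.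
split; first exact: off.
symmetry; apply: (winding_segment rL cg cl) => s /andP[s0 s1]; apply: off.
rewrite addrC addKr nmM nmR ger0_norm //.
by apply: le_lt_trans wr; rewrite ler_piMl ?nm_ge0.
Qed.

(** The winding number is locally constant off the curve. *)
Lemma winding_component z w : connected_component (~` curve_image gamma) z w ->
  winding gamma w = winding gamma z.
Proof.
move=> cw; have oz : (~` curve_image gamma) z.
  by case: cw => K [Kz /(_ _ Kz)].
apply: (connected_const (@component_connected _ (~` curve_image gamma) z)) => //.
  move=> x /connected_component_sub /off_curveP ox; have [r r0 rH] := winding_near ox.
  by exists r => // y; rewrite nm_lt => /rH[].
exact: connected_component_refl.
Qed.

(** An unbounded component contains points far away, where the winding number is
[0]. *)
Lemma winding_outside z : off_curve gamma z -> ~ inside gamma z -> winding gamma z = 0.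
Proof.
move=> /off_curveP oz nz; have [K KH] := winding_infty rL cg cl.
have : ~ bounded_set (connected_component (~` curve_image gamma) z) by move=> b; apply: nz.
move=> /unboundedP /(_ K)[w cw /KH[_ w0]].
by rewrite -(winding_component cw).
Qed.

Lemma winding_out D : curve_image gamma `|` inside gamma `<=` D ->
  forall z, ~ D z -> exists2 r, 0 < r &
    forall w, nm (w - z) < r -> off_curve gamma w /\ winding gamma w = 0.
Proof.
move=> sub z nDz.
have oz : off_curve gamma z by apply/off_curveP => h; apply: nDz; apply: sub; left.
have nz : ~ inside gamma z by move=> h; apply: nDz; apply: sub; right.
by have [r r0 rH] := winding_near oz; exists r => // w /rH[? ->]; rewrite winding_outside.
Qed.

End components.

Lemma hol_analytic D F : hol D F -> analytic_on D F.
Proof.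
move=> HF z Dz; have [a [M [q [M0 q0 T]]]] := HF z Dz; exists a.
apply/nbhs_nm; exists (2 * q)^-1; first by rewrite invr_gt0 mulr_gt0.
move=> w; rewrite nm_lt => wr.
have qw : q * nm (w - z) <= 2^-1.
  by move: wr; rewrite invfM ltr_pdivlMr // mulrC => /ltW.
apply/cvgrPdist_le => e /realC_pos[d d0 ->].
have [k kd] := small_inv (divr_gt0 d0 (ltr_wpDl M0 ltr01)).
exists k.+1 => // n /= kn; rewrite nm_le.
have -> : series (fun n => a n * (w - z) ^+ n) n = psum a n (w - z).
  by rewrite /series /= big_mkord.
apply: le_trans (T w n qw) _.
have x0 : 0 <= q * nm (w - z) by rewrite mulr_ge0 ?nm_ge0 // ltW.
have xn : (q * nm (w - z)) ^+ n <= k.+1%:R^-1.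
  apply: (@le_trans _ _ (2^-1 ^+ n)); first by rewrite lerXn2r ?nnegrE ?invr_ge0.
  rewrite exprVn lef_pV2 ?posrE ?exprn_gt0 // -natrX ler_nat.
  by apply: leq_trans kn _; apply: ltnW; exact: ltn_expl.
have M1 : 0 < M + 1 by rewrite ltr_wpDl.
rewrite ltr_pdivlMr // in kd; apply: le_trans (ltW kd).
by rewrite mulrC ler_pM ?exprn_ge0 // lerDl.
Qed.

End topology.

(** * Circles as Jordan curves *)

Section circle_curve.
Variable R : realType.
Local Notation C := R[i].
Implicit Types (z w c : C) (e r x y M q B L K : R).

Lemma cis_inj x y : 0 <= x < 1 -> 0 <= y < 1 -> cis (2 * pi * x) = cis (2 * pi * y) -> x = y.
Proof.
wlog xy : x y / x <= y => [W|] xP yP.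
  have [h|/ltW h] := leP x y; first exact: W.
  by move=> E; symmetry; apply: W => //; rewrite E.
move=> [Ec Es]; apply/eqP; rewrite eq_le xy leNgt; apply/negP => lt_xy.
have p0 : 0 < (pi : R) := pi_gt0 R.
pose d := pi * (y - x).
have [d0 dp] : 0 < d /\ d < pi.
  split; first by rewrite mulr_gt0 // subr_gt0.
  by rewrite -[ltRHS]mulr1 ltr_pM2l //; lra.
have : cos (d *+ 2) = 1.
  have -> : d *+ 2 = 2 * pi * y - 2 * pi * x by rewrite /d; ring.
  by rewrite cosB Ec Es -!expr2 cos2Dsin2.
have s0 : 0 < sin d by rewrite sin_gt0_pi // d0.
rewrite cos_mulr2n => E; have := cos2Dsin2 d; have := exprn_gt0 2 s0; lra.
Qed.

Lemma circ_jordan c r : 0 < r -> jordan_curve (circ c r).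
Proof.
move=> r0; split; first by apply/cont01P; apply: circ_cont; exact: ltW.
  exact: circ_closed.
move=> x y; rewrite !in_itv /= => xP yP /addrI /mulfI E.
by apply: cis_inj xP yP (E _); rewrite -nm_eq0 nmR normr_eq0 gt_eqF.
Qed.

(** A point at a distance greater than [r] from the centre is joined to points
arbitrarily far away by segments that do not meet the circle, so its component is
unbounded. *)
Lemma circ_inside c r z : 0 < r -> inside (circ c r) z -> nm (z - c) <= r.
Proof.
move=> r0 [oz bz]; rewrite leNgt; apply/negP => rz.
apply: (not_bounded _ bz) => M.
have z0 : 0 < nm (z - c) by exact: lt_trans rz.
(* [c + k (z - c)] has modulus greater than [M]. *)
pose k := (`|M| + nm c + 1) / nm (z - c) + 1.
have k0 : 0 <= (`|M| + nm c + 1) / nm (z - c) by rewrite divr_ge0 ?addr_ge0 ?nm_ge0 // ltW.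
pose ray (s : R) : C := c + (1 + s * (k - 1))%:C * (z - c).
have rayc s : nm (ray s - c) = `|1 + s * (k - 1)| * nm (z - c).
  by rewrite /ray addrC addKr nmM nmR.
have raycl x y : nm (ray x - ray y) = `|x - y| * ((k - 1) * nm (z - c)).
  have -> : ray x - ray y = ((x - y) * (k - 1))%:C * (z - c).
    by rewrite /ray !(rmorphD, rmorphM, rmorphN) /=; ring.
  by rewrite nmM nmR normrM (ger0_norm (_ : 0 <= k - 1)) ?mulrA // /k addrK.
have cray : cont01 ray.
  move=> t _ e e0; pose K := (k - 1) * nm (z - c).
  have K0 : 0 <= K by rewrite mulr_ge0 ?nm_ge0 // /k addrK.
  have K1 : 0 < K + 1 by rewrite ltr_wpDl.
  exists (e / (K + 1)); first by rewrite divr_gt0.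
  move=> t' _; rewrite ltr_pdivlMr // raycl -/K => h; apply: le_trans (ltW h).
  by rewrite ler_wpM2l // lerDl.
have con : connected (ray @` `[0, 1]).
  by apply: connected_continuous_connected; [exact: segment_connected|exact/cont01P].
exists (ray 1).
  apply: (@connected_component_max _ _ (ray @` `[0, 1]) z) => //.
  - by exists 0; rewrite /= ?in_itv /= ?lexx ?ler01 // /ray mul0r addr0 mul1r addrC subrK.
  - move=> _ [s /= sP <-]; apply/off_curveP => t tP.
    apply: contraTneq rz => E; rewrite -leNgt.
    have := nm_circ c t (ltW r0); rewrite E rayc => <-.
    move: sP; rewrite in_itv /= => /andP[s0 _].
    have s1 : 1 <= 1 + s * (k - 1) by rewrite lerDl mulr_ge0 // /k addrK.
    by rewrite ger0_norm ?ler_peMl ?nm_ge0 // (le_trans _ s1).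
  by exists 1 => //=; rewrite in_itv /= lexx ler01.
have k1 : 0 <= k by rewrite /k addr_ge0.
have h : nm (ray 1 - c) = `|M| + nm c + 1 + nm (z - c).
  rewrite rayc mul1r addrC subrK ger0_norm // /k mulrDl mul1r divfK // gt_eqF //.
have := nm_sub (ray 1 - c) (- c); rewrite nmN opprK subrK h.
by have := ler_norm M; lra.
Qed.

(** A small circle around [z] works. Its inside is contained in the closed disc,
where the winding integral is [two_pi_i] by continuation from the open
disc; the component of the centre is bounded because the winding number
vanishes far away. *)
Lemma circ_cauchy_curve D z : open D -> D z -> exists gamma, cauchy_curve D z gamma.
Proof.
move=> /copenP oD Dz; have [d d0 dD] := oD z Dz.
pose r := d / 2; have r0 : 0 < r by rewrite divr_gt0.
have rL := circ_length z (ltW r0); have cg := circ_cont z (ltW r0).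
have cl := circ_closed z r.
have wind w : inside (circ z r) w -> winding (circ z r) w = two_pi_i R.
  move=> iw; have ow : off_curve (circ z r) w by apply/off_curveP; case: iw.
  have [s s0 sH] := winding_near rL cg cl ow.
  have wr := circ_inside r0 iw.
  (* The point [u] of the open disc is so close to [w] that the winding number is the same. *)
  pose k := s / (2 * (r + s)).
  have rs : 0 < r + s by rewrite addr_gt0.
  have k0 : 0 < k by rewrite divr_gt0 // mulr_gt0.
  have k1 : k < 1 by rewrite ltr_pdivrMr ?mulr_gt0 //; lra.
  pose u := z + (1 - k)%:C * (w - z).
  have [_ <-] : off_curve (circ z r) u /\ winding (circ z r) u = winding (circ z r) w.
    apply: sH; have -> : u - w = - k%:C * (w - z) by rewrite /u rmorphB rmorph1; ring.
    rewrite nmM nmN nmR gtr0_norm //; apply: (@le_lt_trans _ _ (k * r)); first by rewrite ler_wpM2l // ltW.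
    rewrite /k mulrAC ltr_pdivrMr ?mulr_gt0 //.
    by rewrite ltr_pM2l //; lra.
  apply: winding_circ => //; rewrite /u addrC addKr nmM nmR gtr0_norm ?subr_gt0 //.
  apply: (@le_lt_trans _ _ ((1 - k) * r)); first by rewrite ler_wpM2l // subr_ge0 ltW.
  by rewrite gtr_pMl // gtrBl.
have zz : nm (z - z) < r by rewrite subrr nm0.
have oz : off_curve (circ z r) z by exact: circ_off.
exists (circ z r); split.
- exact: circ_jordan.
- by apply/rectifiableP; exists (4 * pi * r).
- move=> w iw; have ow : off_curve (circ z r) w by apply/off_curveP; case: iw.
  apply/is_curve_integralP; rewrite -(wind w iw).
  by apply: (cint_rsint rL cg); exact: (on_curve_inv 1 ow).
- move=> w [[t tP <-]|iw]; apply: dD.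
    by rewrite nm_circ ?(ltW r0) // /r; lra.
  by apply: le_lt_trans (circ_inside r0 iw) _; rewrite /r; lra.
split; first exact/off_curveP.
have [K KH] := winding_infty rL cg cl.
apply: (@boundedP _ _ K) => w cw; rewrite leNgt; apply/negP => /KH[_ w0].
move: (winding_component rL cg cl cw); rewrite w0 winding_circ //.
by move=> /esym /eqP; rewrite (negPf (two_pi_i_neq0 R)).
Qed.

End circle_curve.

(** * Functions that are constant on slices *)

Section slices.
Variable R : realType.
Local Notation C := R[i].
Local Notation A := (A3 R).
Implicit Types (e r s B : R) (x y h : A) (k z w : C) (F G : C -> C) (P Q T : A -> C).

Lemma norm_coef x : [/\ `|coef0 x| <= `|x|, `|coef1 x| <= `|x| & `|coef2 x| <= `|x|].
Proof.
have E : `|x| = sqrtC (`|coef0 x| ^+ 2 + `|coef1 x| ^+ 2 + `|coef2 x| ^+ 2) by [].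
have sq (a b : C) : `|a| ^+ 2 <= b -> 0 <= b -> `|a| <= sqrtC b.
  move=> ab b0; rewrite -(@ler_pXn2r _ 2) ?nnegrE ?sqrtC_ge0 // sqrtCK //.
have p (a : C) : 0 <= `|a| ^+ 2 by rewrite exprn_ge0.
have s0 : 0 <= `|coef0 x| ^+ 2 + `|coef1 x| ^+ 2 + `|coef2 x| ^+ 2 by rewrite !addr_ge0.
rewrite E; split; apply: sq => //.
- by rewrite -addrA lerDl addr_ge0.
- by rewrite addrAC lerDr addr_ge0.
- by rewrite lerDr addr_ge0.
Qed.

Lemma norm_le_coef x : `|x| <= `|coef0 x| + `|coef1 x| + `|coef2 x|.
Proof.
have E : `|x| = sqrtC (`|coef0 x| ^+ 2 + `|coef1 x| ^+ 2 + `|coef2 x| ^+ 2) by [].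
move: (normr_ge0 (coef0 x)) (normr_ge0 (coef1 x)) (normr_ge0 (coef2 x)).
rewrite E; move: `|coef0 x| `|coef1 x| `|coef2 x| => a b c a0 b0 c0.
rewrite -(@ler_pXn2r _ 2) ?nnegrE ?sqrtC_ge0 ?addr_ge0 ?exprn_ge0 // sqrtCK.
rewrite -subr_ge0 (_ : _ - _ = 2 * (a * b + b * c + a * c)); last by ring.
by rewrite mulr_ge0 // !addr_ge0 // mulr_ge0.
Qed.

(** Neighbourhoods in which the three coordinates can be moved independently. *)
Definition polydisc x r y := [/\ nm (coef0 y - coef0 x) < r,
  nm (coef1 y - coef1 x) < r & nm (coef2 y - coef2 x) < r].

Lemma polydisc_min x r s y : polydisc x (Num.min r s) y -> polydisc x r y /\ polydisc x s y.
Proof. by case; rewrite !lt_min => /andP[? ?] /andP[? ?] /andP[? ?]. Qed.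

Lemma norm_polydisc x r y : `|y - x| < r%:C -> polydisc x r y.
Proof.
have [h0 h1 h2] := norm_coef (y - x).
by move=> yx; split; rewrite -nm_lt; [apply: le_lt_trans h0 yx|apply: le_lt_trans h1 yx|
  apply: le_lt_trans h2 yx].
Qed.

Lemma polydisc_norm x r y : polydisc x (r / 3) y -> `|y - x| < r%:C.
Proof.
move=> [h0 h1 h2]; apply: le_lt_trans (norm_le_coef _) _.
rewrite !nmE -!rmorphD ltcR /=; lra.
Qed.

(** Axis derivative of [Q] in the complex direction [h]. *)
Definition along Q h c x := axdiff (fun u => Q (x + u *: h)) c 0.

Definition cdiff_along Q h c x := cdiff (fun u => Q (x + u *: h)) c 0.

Lemma cdiff_alongM P Q h c d x : cdiff_along P h c x -> cdiff_along Q h d x ->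
  cdiff_along (fun x => P x * Q x) h (c * Q x + P x * d) x.
Proof.
move=> /pdiff_cdiff HP /pdiff_cdiff HQ; apply/pdiff_cdiff.
have o : [set (0 : C)] 0 by [].
by have := pdiffM o HP HQ; rewrite scale0r addr0.
Qed.

Lemma cdiff_alongD P Q h c d x : cdiff_along P h c x -> cdiff_along Q h d x ->
  cdiff_along (fun x => P x + Q x) h (c + d) x.
Proof.
move=> /pdiff_cdiff HP /pdiff_cdiff HQ; apply/pdiff_cdiff; exact: pdiffD HP HQ.
Qed.

Lemma cdiff_affine F c z k : cdiff F c z -> cdiff (fun u => F (z + u * k)) (k * c) 0.
Proof.
move=> H e e0; have k0 : 0 < nm k + 1 by rewrite ltr_wpDl ?nm_ge0.
have [r r0 rH] := H _ (divr_gt0 e0 k0).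
exists (r / (nm k + 1)); first by rewrite divr_gt0.
move=> u; rewrite subr0 ltr_pdivlMr // => ur.
have uk : nm (u * k) <= nm u * (nm k + 1) by rewrite nmM ler_wpM2l ?nm_ge0 // lerDl.
have := rH (z + u * k); rewrite addrC addKr => /(_ (le_lt_trans uk ur)).
rewrite mul0r addr0 (_ : k * c * u = c * (u * k)); last by ring.
move=> h; apply: le_trans h _; rewrite mulrAC ler_pdivrMr // -mulrA.
by rewrite ler_wpM2l // ltW.
Qed.

Lemma cdiff_along_coef0 F c h x : cdiff F c (coef0 x) ->
  cdiff_along (fun y => F (coef0 y)) h (coef0 h * c) x.
Proof. exact: cdiff_affine. Qed.

Lemma cdiff_id z : cdiff id 1 z.
Proof. by apply/pdiff_cdiff; exact: pdiff_id. Qed.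

Lemma cdiff_along_coef1 h x : cdiff_along (@coef1 R) h (coef1 h) x.
Proof. by rewrite -[coef1 h]mulr1; exact: (cdiff_affine _ (cdiff_id (coef1 x))). Qed.

Lemma cdiff_along_coef2 h x : cdiff_along (@coef2 R) h (coef2 h) x.
Proof. by rewrite -[coef2 h]mulr1; exact: (cdiff_affine _ (cdiff_id (coef2 x))). Qed.

Lemma cdiff_alongZ k Q h c x : cdiff_along Q h c x ->
  cdiff_along (fun x => k * Q x) h (k * c) x.
Proof. by move=> /pdiff_cdiff HQ; apply/pdiff_cdiff; exact: pdiffZ HQ. Qed.

Lemma alongB P Q h c d x : along P h c x -> cdiff_along Q h d x ->
  along (fun x => P x - Q x) h (c - d) x.
Proof. by move=> HP /cdiff_axdiff; exact: axdiffB HP. Qed.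

(** Change of parametrization from [u] with [x + u h] to a coordinate. *)
Lemma along_line Q h c x z (L : C -> A) : along Q h c x -> L z = x ->
  (forall u, L (z + u) = x + u *: h) -> axdiff (fun w => Q (L w)) c z.
Proof.
move=> H Lz LE e /H[r r0 rH]; exists r => // t tr; have := rH t tr.
by rewrite !add0r scale0r addr0 !LE Lz.
Qed.

Lemma axdiff_near F G c z r : 0 < r -> (forall w, nm (w - z) < r -> F w = G w) ->
  axdiff F c z -> axdiff G c z.
Proof.
move=> r0 FG H e e0; have [s s0 sH] := H e e0.
exists (Num.min r s); first by rewrite lt_min r0.
move=> t; rewrite lt_min => /andP[tr /sH].
have n0 : nm (z - z) < r by rewrite subrr nm0.
by rewrite !FG // addrC addKr ?nmM ?nmi ?mul1r nmR.
Qed.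

Variable Omega : set A.
Hypothesis openO : forall x, Omega x -> exists2 r, 0 < r & forall y, polydisc x r y -> Omega y.
Hypothesis slices : forall x : A, connected (Omega `&` [set x + u | u in radical R]).

Lemma slice_open x : Omega x -> exists2 r, 0 < r & forall z, nm (z - coef0 x) < r ->
  Omega (MkA3 z (coef1 x) (coef2 x)).
Proof.
move=> /openO[r r0 rH]; exists r => // z zr; apply: rH; split=> //=.
  by rewrite subrr nm0.
by rewrite subrr nm0.
Qed.

Lemma copen_image : copen (fA3 @` Omega).
Proof.
move=> z [x Ox <-]; have [r r0 rH] := slice_open Ox; exists r => // w wr.
by exists (MkA3 w (coef1 x) (coef2 x)) => //; exact: rH.
Qed.

(** Inside a polydisc a point of the slice is reached from the centre by moving one
coordinate after the other, and a function whose axis derivatives vanish in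
a box is constant there. So [Q] is locally constant on the slices, which
are connected. *)
Lemma slice_const Q : (forall x, Omega x -> along Q (rho R) 0 x) ->
  (forall x, Omega x -> along Q (rho R ^+ 2) 0 x) ->
  forall x y, Omega x -> Omega y -> coef0 x = coef0 y -> Q x = Q y.
Proof.
move=> Q1 Q2 x y Ox Oy xy.
have inS x' : Omega x' -> coef0 x' = coef0 x ->
    (Omega `&` [set x + u | u in radical R]) x'.
  move=> Ox' x'0; split=> //.
  exists ((coef1 x' - coef1 x) *: rho R + (coef2 x' - coef2 x) *: rho R ^+ 2); first by eexists; eexists.
  by case: x' x'0 {Ox'} => a b c /= ->; case: (x) => a' b' c' /=; congr MkA3 => /=; ring.
apply: (connected_const (@slices x)); [|exact: inS|exact: inS].
move=> x' [Ox' [_ [l1 [l2 ->]] x'E]]; have [r r0 rH] := openO Ox'.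
exists (r / 2); first by rewrite divr_gt0.
move=> y' /norm_polydisc[_ y1 y2] [Oy' [_ [m1 [m2 ->]] y'E]].
have E0 : coef0 x' = coef0 y' by rewrite -x'E -y'E /=; ring.
have r2 : 0 < r / 2 by rewrite divr_gt0.
have bx z w : box z (r / 2) w -> nm (w - z) < r.
  move=> [h1 h2]; apply: le_lt_trans (nm_le_ReIm _) _; rewrite !raddfB /=; lra.
have zr z : nm (z - z) < r by rewrite subrr nm0.
have bz z : box z (r / 2) z by apply: nm_box; rewrite subrr nm0.
pose L1 w : A := MkA3 (coef0 x') w (coef2 x').
pose L2 w : A := MkA3 (coef0 x') (coef1 y') w.
have O1 w : nm (w - coef1 x') < r -> Omega (L1 w) by move=> wr; apply: rH; split.
have O2 w : nm (w - coef2 x') < r -> Omega (L2 w).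
  by move=> wr; apply: rH; split => //=; lra.
have cr1 w : box (coef1 x') (r / 2) w -> axdiff (fun w => Q (L1 w)) 0 w.
  move=> /bx /O1 Ow; apply: (along_line (Q1 _ Ow)) => // u.
  by congr MkA3 => /=; ring.
have cr2 w : box (coef2 x') (r / 2) w -> axdiff (fun w => Q (L2 w)) 0 w.
  move=> /bx /O2 Ow; apply: (along_line (Q2 _ Ow)) => // u.
  by congr MkA3 => /=; ring.
have z0 (w : C) : nm (0 - 0 : C) <= 0 by rewrite subrr nm0.
have e1 := @axdiff_box_lip R _ (fun=> 0) 0 _ _ 0 cr1 (fun w _ => z0 w) _ _ (bz _) (nm_box y1).
have e2 := @axdiff_box_lip R _ (fun=> 0) 0 _ _ 0 cr2 (fun w _ => z0 w) _ _ (bz _) (nm_box y2).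
have eq0 (p q u : C) : nm (p - q - 0 * u) <= 2 * 0 * nm u -> p = q.
  rewrite mulr0 !mul0r subr0 => h; apply/eqP; rewrite -subr_eq0 -nm_eq0.
  by rewrite eq_le h nm_ge0.
have {e1}e1 := eq0 _ _ _ e1; have {e2}e2 := eq0 _ _ _ e2.
have -> : y' = L2 (coef2 y') by rewrite /L2 E0; case: (y').
rewrite e2; have -> : L2 (coef2 x') = L1 (coef1 y') by [].
by rewrite e1 /L1; case: (x').
Qed.

Definition lbounded Q := forall x, Omega x -> exists B r, 0 < r /\
  forall y, polydisc x r y -> nm (Q y) <= B.

Lemma lboundedB P Q : lbounded P -> lbounded Q -> lbounded (fun x => P x - Q x).
Proof.
move=> HP HQ x Ox; have [B [r [r0 H]]] := HP x Ox; have [B' [r' [r'0 H']]] := HQ x Ox.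
exists (B + B'), (Num.min r r'); split; first by rewrite lt_min r0.
move=> y /polydisc_min[yr yr'].
by apply: le_trans (nmB _ _) _; apply: lerD; [exact: H|exact: H'].
Qed.

Lemma lboundedD P Q : lbounded P -> lbounded Q -> lbounded (fun x => P x + Q x).
Proof.
move=> HP HQ x Ox; have [B [r [r0 H]]] := HP x Ox; have [B' [r' [r'0 H']]] := HQ x Ox.
exists (B + B'), (Num.min r r'); split; first by rewrite lt_min r0.
move=> y /polydisc_min[yr yr'].
by apply: le_trans (nmD _ _) _; apply: lerD; [exact: H|exact: H'].
Qed.

Lemma lboundedM P Q : lbounded P -> lbounded Q -> lbounded (fun x => P x * Q x).
Proof.
move=> HP HQ x Ox; have [B [r [r0 H]]] := HP x Ox; have [B' [r' [r'0 H']]] := HQ x Ox.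
exists (B * B'), (Num.min r r'); split; first by rewrite lt_min r0.
move=> y /polydisc_min[yr yr'].
by rewrite nmM; apply: ler_pM; rewrite ?nm_ge0 //; [exact: H|exact: H'].
Qed.

Lemma lbounded_cst k : lbounded (fun=> k).
Proof. by move=> x _; exists (nm k), 1. Qed.

Lemma lbounded_coef1 : lbounded (@coef1 R).
Proof.
move=> x _; exists (nm (coef1 x) + 1), 1; split=> // y [_ h _].
by have := nm_sub (coef1 y) (coef1 x); lra.
Qed.

Lemma lbounded_coef2 : lbounded (@coef2 R).
Proof.
move=> x _; exists (nm (coef2 x) + 1), 1; split=> // y [_ _ h].
by have := nm_sub (coef2 y) (coef2 x); lra.
Qed.

Lemma lbounded_coef0 F : hol (fA3 @` Omega) F -> lbounded (fun x => F (coef0 x)).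
Proof.
move=> HF x Ox; have Dx : (fA3 @` Omega) (coef0 x) by exists x.
have [r r0 rH] := hol_ccont HF Dx ltr01.
exists (nm (F (coef0 x)) + 1), r; split=> // y [/rH h _ _].
by have := nm_sub (F (coef0 y)) (F (coef0 x)); lra.
Qed.

(** Locally the descended function is [Q] restricted to a complex line of direction
[1], so it is bounded and has axis derivatives; it is holomorphic by Tolstov's
theorem. *)
Lemma descend Q p : (forall x, Omega x -> along Q 1 (p x) x) ->
  (forall x, Omega x -> along Q (rho R) 0 x) ->
  (forall x, Omega x -> along Q (rho R ^+ 2) 0 x) -> lbounded Q ->
  exists F, [/\ hol (fA3 @` Omega) F, (forall x, Omega x -> F (coef0 x) = Q x) &
    forall x, Omega x -> der F (coef0 x) = p x].
Proof.
move=> Q0 Q1 Q2 QB.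
pose F z := xget 0 [set v | exists x, [/\ Omega x, coef0 x = z & Q x = v]].
have FQ x : Omega x -> F (coef0 x) = Q x.
  move=> Ox; rewrite /F; case: xgetP => [v -> [y [Oy yx <-]]|/(_ (Q x))].
    exact: slice_const.
  by case; exists x.
have Fcr x : Omega x -> axdiff F (p x) (coef0 x).
  move=> Ox; have [r r0 rH] := slice_open Ox.
  apply: (@axdiff_near (fun z => Q (MkA3 z (coef1 x) (coef2 x))) F _ _ r) => //.
    by move=> w /rH Ow; rewrite -FQ.
  apply: (along_line (Q0 x Ox)); first by case: (x).
  by move=> u; case: (x) => a b c; congr MkA3 => /=; ring.
have hF : hol (fA3 @` Omega) F.
  apply: tolstov_hol; first exact: copen_image.
    by move=> z [x Ox <-]; exists (p x); exact: Fcr.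
  move=> z [x Ox <-]; have [B [r [r0 rH]]] := QB x Ox.
  have [s s0 sH] := slice_open Ox.
  exists B, (Num.min r s); split; first by rewrite lt_min r0.
  move=> w; rewrite lt_min => /andP[wr /sH Ow].
  rewrite (_ : F w = Q (MkA3 w (coef1 x) (coef2 x))); last by rewrite -FQ.
  by apply: rH; split=> //=; rewrite subrr nm0.
exists F; split=> // x Ox; apply: (@axdiff_uniq _ F _ _ (coef0 x)); last exact: Fcr.
by apply: cdiff_axdiff; apply: (hol_cdiff hF); exists x.
Qed.

End slices.

(** * The representation *)

Section representation.
Variable R : realType.
Local Notation C := R[i].
Local Notation A := (A3 R).
Implicit Types (e r s B : R) (x y h d : A) (k v z w : C) (F G : C -> C) (P Q T : A -> C).

Lemma one_sided_limit (Phi : A -> A) x h l :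
  (delta%:C)^-1 *: (Phi (x + delta%:C *: h) - Phi x) @[delta --> (0 : R)^'+] --> l ->
  forall e, 0 < e -> exists2 r, 0 < r & forall t : R, 0 < t -> t < r ->
    `|Phi (x + t%:C *: h) - Phi x - t%:C *: l| <= (e * t)%:C.
Proof.
move=> /cvgrPdist_le H e e0; have ec0 : 0 < e%:C by rewrite ltcR.
have : nbhs (0 : R) (fun t : R => 0 < t ->
    `|l - t%:C^-1 *: (Phi (x + t%:C *: h) - Phi x)| <= e%:C) := H _ ec0.
rewrite -nbhs_nbhs_norm.
move=> [r /= r0 rH]; exists r => // t t0 tr.
have := rH t; rewrite /ball_ /= sub0r normrN gtr0_norm // => /(_ tr t0) k.
have tn : t%:C != 0 by rewrite -nm_eq0 nmR normr_eq0 gt_eqF.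
have -> : Phi (x + t%:C *: h) - Phi x - t%:C *: l =
  t%:C *: - (l - t%:C^-1 *: (Phi (x + t%:C *: h) - Phi x)).
  by rewrite opprB scalerBr scalerA mulfV // scale1r.
rewrite normrZ normrN nmE nmR gtr0_norm // rmorphM /= mulrC.
by rewrite ler_wpM2r // lecR ltW.
Qed.

(** The four one-sided limits in the directions [h], [- h], [i h], [- i h] are the two
two-sided limits along the axes of the complex line of direction [h]. Linearity of the
coordinate [q] passes from vector values to complex ones. *)
Lemma along_directions (Phi : A -> A) (q : A -> C) x h d :
  (forall y y', q (y - y') = q y - q y') -> (forall k y, q (k *: y) = k * q y) ->
  (forall y, `|q y| <= `|y|) ->
  (forall h', h' \in [:: h; - h; 'i *: h; - ('i *: h)] ->
    (delta%:C)^-1 *: (Phi (x + delta%:C *: h') - Phi x) @[delta --> (0 : R)^'+] --> h' * d) ->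
  along (fun y => q (Phi y)) h (q (h * d)) x.
Proof.
move=> qB qZ qn H e e0.
have side v : v *: h \in [:: h; - h; 'i *: h; - ('i *: h)] -> exists2 r, 0 < r &
    forall t : R, 0 < t -> t < r ->
    nm (q (Phi (x + (t%:C * v) *: h)) - q (Phi x) - q (h * d) * (t%:C * v)) <= e * t.
  move=> /H /one_sided_limit /(_ e e0)[r r0 rH]; exists r => // t t0 tr.
  have := rH t t0 tr; rewrite scalerA => k; rewrite -nm_le; apply: le_trans k.
  apply: le_trans (qn _); rewrite !qB qZ -scalerAl qZ.
  by rewrite (_ : q (h * d) * (t%:C * v) = t%:C * (v * q (h * d))) //; ring.
have [r1 r10 H1] := side 1 ltac:(by rewrite scale1r !inE eqxx).
have [r2 r20 H2] := side (-1) ltac:(by rewrite scaleN1r !inE eqxx !orbT).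
have [r3 r30 H3] := side 'i ltac:(by rewrite !inE eqxx !orbT).
have [r4 r40 H4] := side (- 'i) ltac:(by rewrite scaleNr !inE eqxx !orbT).
exists (Num.min (Num.min r1 r2) (Num.min r3 r4)); first by rewrite !lt_min r10 r20 r30.
move=> t; rewrite !lt_min => /andP[/andP[t1 t2] /andP[t3 t4]].
rewrite !add0r scale0r addr0.
have [t0|t0|t0] := ltrgt0P t.
- rewrite ger0_norm ?(ltW t0) // in t1 t3 *.
  by have := H1 t t0 t1; have := H3 t t0 t3; rewrite mulr1 ['i * _]mulrC.
- rewrite ltr0_norm // in t2 t4 *; have nt : 0 < - t by rewrite oppr_gt0.
  have := H2 _ nt t2; have := H4 _ nt t4.
  by rewrite rmorphN /= !mulrNN mulr1 ['i * _]mulrC.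
by rewrite t0 rmorph0 !mulr0 scale0r addr0 !subr0 !subrr nm0.
Qed.

End representation.

Section integral.
Variable R : realType.
Local Notation C := R[i].
Local Notation A := (A3 R).
Implicit Types (z w : C).

Lemma A3_invE (y : A) : coef0 y != 0 -> y^-1 = MkA3 (coef0 y)^-1
  (- coef1 y * coef0 y ^- 2) (coef1 y ^+ 2 * coef0 y ^- 3 + - coef2 y * coef0 y ^- 2).
Proof.
move=> y0; rewrite -[LHS]/(invA3 y) /invA3 /unitA3 y0.
by rewrite !mulNr.
Qed.

Lemma A3_curve_integral (gamma : R -> C) (g : C -> A) (I : A) :
  is_curve_integral gamma (fun t => coef0 (g t)) (coef0 I) ->
  is_curve_integral gamma (fun t => coef1 (g t)) (coef1 I) ->
  is_curve_integral gamma (fun t => coef2 (g t)) (coef2 I) ->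
  is_curve_integral gamma g I.
Proof.
move=> H0 H1 H2 e e0; have e3 : 0 < e / 3 by rewrite divr_gt0.
have [d0 d00 D0] := H0 _ e3; have [d1 d10 D1] := H1 _ e3; have [d2 d20 D2] := H2 _ e3.
exists (Num.min d0 (Num.min d1 d2)); first by rewrite !lt_min d00 d10.
move=> s tau ps ms ts.
have m0 k : (k < size s)%N -> knot s k.+1 - knot s k < d0 by move=> /ms; rewrite lt_min => /andP[].
have m1 k : (k < size s)%N -> knot s k.+1 - knot s k < d1.
  by move=> /ms; rewrite !lt_min => /and3P[].
have m2 k : (k < size s)%N -> knot s k.+1 - knot s k < d2.
  by move=> /ms; rewrite !lt_min => /and3P[].
have {D0} := D0 s tau ps m0 ts; have {D1} := D1 s tau ps m1 ts; have {D2} := D2 s tau ps m2 ts.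
set S := \sum_(0 <= k < size s) _ => k2.
set S1 := \sum_(0 <= k < size s) _ => k1.
set S0 := \sum_(0 <= k < size s) _ => k0.
set X := \sum_(0 <= k < size s) _.
have [E0 E1 E2] : [/\ coef0 X = S0, coef1 X = S1 & coef2 X = S].
  rewrite /X /S0 /S1 /S; split.
  - by elim/big_rec2: _ => //= k ? ? _ <-.
  - by elim/big_rec2: _ => //= k ? ? _ <-.
  - by elim/big_rec2: _ => //= k ? ? _ <-.
apply: polydisc_norm.
by split; rewrite -nm_lt ?E0 ?E1 ?E2.
Qed.

End integral.

Theorem theorem4 (R : realType) (Omega : set (A3 R)) (Phi : A3 R -> A3 R) :
  open Omega -> Omega !=set0 -> connected Omega ->
  (forall zeta0 : A3 R,
     connected (Omega `&` [set zeta0 + u | u in radical R])) ->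
  [locally [bounded Phi zeta | zeta in Omega]] ->
  (forall zeta : A3 R, Omega zeta ->
     exists dPhi : A3 R, forall h : A3 R, h \in directions R ->
       (delta%:C)^-1 *: (Phi (zeta + delta%:C *: h) - Phi zeta)
         @[delta --> (0 : R)^'+] --> h * dPhi) ->
  exists F0 F1 F2 : R[i] -> R[i],
    [/\ analytic_on (fA3 @` Omega) F0,
        analytic_on (fA3 @` Omega) F1,
        analytic_on (fA3 @` Omega) F2 &
        forall zeta : A3 R, Omega zeta ->
          (exists gamma : R -> R[i],
             cauchy_curve (fA3 @` Omega) (fA3 zeta) gamma) /\
          (forall gamma : R -> R[i],
             cauchy_curve (fA3 @` Omega) (fA3 zeta) gamma ->
             exists2 J : A3 R,
               is_curve_integral gamma
                 (fun t : R[i] =>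
                    ((F0 t)%:A + F1 t *: rho R + F2 t *: rho R ^+ 2)
                      * (t%:A - zeta)^-1) J &
               Phi zeta = (two_pi_i R)^-1 *: J)].
Proof.
move=> oO _ _ slices bPhi dPhi.
have openO x : Omega x -> exists2 r : R, 0 < r & forall y, polydisc x r y -> Omega y.
  move: oO => /open_nm H /H[r r0 rH]; exists (r / 3); first by rewrite divr_gt0.
  by move=> y /polydisc_norm; exact: rH.
have oD := copen_image openO; set D := fA3 @` Omega in oD *.
have [d dP] : exists d, forall x, Omega x -> forall h : A3 R, h \in directions R ->
    (delta%:C)^-1 *: (Phi (x + delta%:C *: h) - Phi x) @[delta --> (0 : R)^'+] --> h * d x.
  have ex x : exists y, Omega x -> forall h : A3 R, h \in directions R ->
    (delta%:C)^-1 *: (Phi (x + delta%:C *: h) - Phi x) @[delta --> (0 : R)^'+] --> h * y.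
    by have [/dPhi[y yP]|nO] := pselect (Omega x); [exists y|exists 0].
  by have [f fP] := choice ex; exists f.
have bounded : lbounded Omega (fun x => coef0 (Phi x)) /\
   (lbounded Omega (fun x => coef1 (Phi x)) /\ lbounded Omega (fun x => coef2 (Phi x))).
  suff H x : Omega x -> exists B r : R, 0 < r /\
      forall y, polydisc x r y -> `|Phi y| <= B%:C.
    split; last split; move=> x /H[B [r [r0 rH]]]; exists B, r; split=> // y /rH h;
      rewrite -nm_le; apply: le_trans h; by have [] := norm_coef (Phi y).
  move=> Ox; have [M [/complex_realP[m ->] mH]] := bPhi x Ox.
  have : nbhs x (fun y => Omega y -> `|Phi y| <= (m + 1)%:C) := mH (m + 1)%:C ltac:(by rewrite ltcR ltrDl).
  move=> /nbhs_nm[r r0 rH]; have [r' r'0 r'H] := openO x Ox.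
  exists (m + 1), (Num.min (r / 3) r'); split; first by rewrite lt_min divr_gt0.
  by move=> y /polydisc_min[/polydisc_norm yr yr']; apply: rH => //; exact: r'H.
have [B0 [B1 B2]] := bounded.
have rho2 : rho R ^+ 2 = MkA3 0 0 1 by congr MkA3 => /=; ring.
have dir h : h \in [:: 1; rho R; rho R ^+ 2] ->
    {subset [:: h; - h; 'i *: h; - ('i *: h)] <= directions R}.
  rewrite !inE => /or3P[] /eqP -> h'; rewrite !inE => /or4P[] /eqP ->;
    by rewrite eqxx ?orbT.
have al h x : Omega x -> h \in [:: 1; rho R; rho R ^+ 2] ->
  [/\ along (fun y => coef0 (Phi y)) h (coef0 (h * d x)) x,
      along (fun y => coef1 (Phi y)) h (coef1 (h * d x)) x &
      along (fun y => coef2 (Phi y)) h (coef2 (h * d x)) x].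
  move=> Ox hh; have H h' hin := dP x Ox h' (dir h hh h' hin).
  by split; (apply: along_directions => //; first by move=> y; have [] := norm_coef y).
have in1 : 1 \in [:: 1; rho R; rho R ^+ 2] by rewrite !inE eqxx.
have in2 : rho R \in [:: 1; rho R; rho R ^+ 2] by rewrite !inE eqxx orbT.
have in3 : rho R ^+ 2 \in [:: 1; rho R; rho R ^+ 2] by rewrite !inE eqxx !orbT.
have Dc x : Omega x -> D (coef0 x) by move=> Ox; exists x.
have to h Q c c' x : along Q h c x -> c = c' -> along Q h c' x by move=> + <-.
have [F0 [hF0 F0E F0d]] := @descend R Omega openO slices (fun x => coef0 (Phi x)) (fun x => coef0 (d x))
  ltac:(by move=> x Ox; have [H _ _] := al 1 x Ox in1; apply: to H _; rewrite mul1r)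
  ltac:(by move=> x Ox; have [H _ _] := al _ x Ox in2; apply: to H _; rewrite /= mul0r)
  ltac:(by move=> x Ox; have [H _ _] := al _ x Ox in3; apply: to H _; rewrite rho2 /= mul0r)
  B0.
have hF0' := hol_der oD hF0.
have hF0'' := hol_der oD hF0'.
(* What remains of [Phi1] after subtracting [T1] depends on [a] only. *)
pose T1 x : R[i] := coef1 x * der F0 (coef0 x).
have T1d h x : Omega x -> cdiff_along T1 h
    (coef1 h * der F0 (coef0 x) + coef1 x * (coef0 h * der (der F0) (coef0 x))) x.
  move=> Ox; apply: cdiff_alongM; first exact: cdiff_along_coef1.
  by apply: cdiff_along_coef0; apply: (hol_cdiff hF0'); exact: Dc.
have [F1 [hF1 F1E F1d]] := @descend R Omega openO slices (fun x => coef1 (Phi x) - T1 x)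
  (fun x => coef1 (d x) - coef1 x * der (der F0) (coef0 x))
  ltac:(by move=> x Ox; have [_ H _] := al 1 x Ox in1; apply: to (alongB H (T1d 1 x Ox)) _;
    rewrite mul1r /=; ring)
  ltac:(by move=> x Ox; have [_ H _] := al _ x Ox in2; apply: to (alongB H (T1d _ x Ox)) _;
    rewrite F0d //=; ring)
  ltac:(by move=> x Ox; have [_ H _] := al _ x Ox in3; apply: to (alongB H (T1d _ x Ox)) _;
    rewrite rho2 /=; ring)
  (lboundedB B1 (lboundedM (@lbounded_coef1 R Omega) (lbounded_coef0 hF0'))).
have hF1' := hol_der oD hF1.
(* Likewise for [Phi2] and [T2]. *)
pose T2 x : R[i] := 2^-1 * (coef1 x * coef1 x * der (der F0) (coef0 x)) +
   (coef1 x * der F1 (coef0 x) + coef2 x * der F0 (coef0 x)).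
have T2d h x : Omega x -> exists c, cdiff_along T2 h c x /\
    (coef0 h = 0 -> c = coef1 h * coef1 x * der (der F0) (coef0 x) +
      (coef1 h * der F1 (coef0 x) + coef2 h * der F0 (coef0 x))).
  move=> Ox; have Dx := Dc x Ox; eexists; split.
    apply: cdiff_alongD.
      apply: cdiff_alongZ; apply: cdiff_alongM; last first.
        by apply: cdiff_along_coef0; exact: (hol_cdiff hF0'' Dx).
      by apply: cdiff_alongM; exact: cdiff_along_coef1.
    apply: cdiff_alongD; apply: cdiff_alongM.
    - exact: cdiff_along_coef1.
    - by apply: cdiff_along_coef0; exact: (hol_cdiff hF1' Dx).
    - exact: cdiff_along_coef2.
    - by apply: cdiff_along_coef0; exact: (hol_cdiff hF0' Dx).
  by move=> ->; field.
have T2b : lbounded Omega T2.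
  have b1 := @lbounded_coef1 R Omega; have b2 := @lbounded_coef2 R Omega.
  apply: lboundedD; last apply: lboundedD.
  - exact: (lboundedM (@lbounded_cst R Omega _) (lboundedM (lboundedM b1 b1) (lbounded_coef0 hF0''))).
  - exact: (lboundedM b1 (lbounded_coef0 hF1')).
  - exact: (lboundedM b2 (lbounded_coef0 hF0')).
have exc x : exists c, Omega x -> along (fun x => coef2 (Phi x) - T2 x) 1 c x.
  have [Ox|nO] := pselect (Omega x); last by exists 0.
  have [_ _ H] := al 1 x Ox in1; have [c [Hc _]] := T2d 1 x Ox.
  by eexists => _; exact: alongB H Hc.
have [c2 c2P] := choice exc.
have [F2 [hF2 F2E _]] := @descend R Omega openO slices (fun x => coef2 (Phi x) - T2 x) c2
  c2P
  ltac:(by move=> x Ox; have [_ _ H] := al _ x Ox in2; have [c [Hc cE]] := T2d (rho R) x Ox;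
    apply: to (alongB H Hc) _; rewrite cE //= F1d // F0d //; ring)
  ltac:(by move=> x Ox; have [_ _ H] := al _ x Ox in3; have [c [Hc cE]] := T2d (rho R ^+ 2) x Ox;
    rewrite rho2 in Hc cE H *; apply: to (alongB H Hc) _; rewrite cE //= F0d //; ring)
  (lboundedB B2 T2b).
exists F0, F1, F2; split; [exact: hol_analytic|exact: hol_analytic|exact: hol_analytic|].
move=> x Ox; have Dx := Dc x Ox; split.
  by apply: circ_cauchy_curve => //; apply/copenP.
move=> gamma [[/cont01P cg cl _] /rectifiableP[L rL] po sub ins].
have oz : off_curve gamma (fA3 x) by apply/off_curveP; case: ins.
have gD t : 0 <= t <= 1 -> D (gamma t).
  by move=> tP; apply: sub; left; exists t => //=; rewrite in_itv.
have out := winding_out rL cg cl sub.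
have wx : winding gamma (fA3 x) = two_pi_i R.
  by apply: rsint_cint; apply/is_curve_integralP; exact: po.
have cf F (hF : hol D F) := cauchy_formula rL cg cl oD gD out hF Dx oz.
have cf2 F (hF : hol D F) := cauchy_formula2 rL cg cl oD gD out hF Dx oz.
have cf3 F (hF : hol D F) := cauchy_formula3 rL cg cl oD gD out hF Dx oz.
rewrite wx in cf cf2 cf3.
set a := fA3 x in oz wx ins cf cf2 cf3 *; set b := coef1 x; set c := coef2 x.
have on1 F (hF : hol D F) := on_curve_kernel 1 (hol_on_curve gD hF) oz.
have on2 F (hF : hol D F) := on_curve_kernel 2 (hol_on_curve gD hF) oz.
have on3 F (hF : hol D F) := on_curve_kernel 3 (hol_on_curve gD hF) oz.
have i1 F (hF : hol D F) := cint_rsint rL cg (on1 F hF).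
have i2 F (hF : hol D F) := cint_rsint rL cg (on2 F hF).
have i3 F (hF : hol D F) := cint_rsint rL cg (on3 F hF).
(* The integral is identified by its components, from Cauchy's formulas at [a]. *)
pose W := two_pi_i R.
exists (W *: Phi x); last by rewrite scalerA mulVf ?scale1r // two_pi_i_neq0.
have inv t : 0 <= t <= 1 -> ((gamma t)%:A - x)^-1 =
    MkA3 (gamma t - a)^-1 (b * (gamma t - a) ^- 2)
      (b ^+ 2 * (gamma t - a) ^- 3 + c * (gamma t - a) ^- 2).
  move=> tP; have t0 : gamma t - a != 0 by rewrite subr_eq0 oz.
  have E : coef0 ((gamma t)%:A - x) = gamma t - a by rewrite /= mulr1.
  rewrite A3_invE E //; congr MkA3 => /=; rewrite !mulr0 !add0r; first by rewrite opprK.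
  by rewrite sqrrN opprK.
have P0 : coef0 (Phi x) = F0 a by rewrite F0E.
have P1 : coef1 (Phi x) = F1 a + b * der F0 a by rewrite F1E // /T1 -/b subrK.
have P2 : coef2 (Phi x) = F2 a + (2^-1 * (b * b * der (der F0) a) + (b * der F1 a + c * der F0 a)).
  by rewrite F2E // subrK.
apply: A3_curve_integral; apply/is_curve_integralP.
- have -> : coef0 (W *: Phi x) = W * F0 a by rewrite /= P0.
  rewrite -cf //; apply: rsint_eq (i1 _ hF0) => t tP /=.
  by rewrite inv //= expr1 !(mulr0, mulr1, addr0).
- have -> : coef1 (W *: Phi x) = b * (W * der F0 a) + W * F1 a by rewrite /= P1; ring.
  rewrite -cf2 // -cf //.
  apply: rsint_eq (rsintD (rsintZ b (i2 _ hF0)) (i1 _ hF1)) => t tP /=.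
  by rewrite inv //= expr1; ring.
have -> : coef2 (W *: Phi x) = (b ^+ 2 * (W * (2^-1 * der (der F0) a)) + c * (W * der F0 a)) +
    (b * (W * der F1 a) + W * F2 a) by rewrite /= P2; ring.
rewrite -cf3 // -!cf2 // -cf //.
apply: rsint_eq (rsintD (rsintD (rsintZ (b ^+ 2) (i3 _ hF0)) (rsintZ c (i2 _ hF0)))
  (rsintD (rsintZ b (i2 _ hF1)) (i1 _ hF2))) => t tP /=.
by rewrite inv //= expr1; ring.
Qed.
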